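(* Let $p\ge2$, $\frac1p+\frac1q=1$. Suppose assumptions (A1)–(A6) of the context hold, let $\rho>0$, and let the mirror descent linearized augmented Lagrangian algorithm of the context be run with $K\ge2$, $$\rho_k=\frac\rho K\ (k=0,\ldots,K-1),\qquad \eta L_\mu\le\frac12,\qquad 0<\alpha\le1,\qquad n\ge\frac{96(p-1)S_p\eta^2L_f^2}{\alpha}.$$ Then $$\mathbb E_{R;u^{[K]},\xi^{[K]}}[\|c(x^R)\|_p^2]\le\frac{\|c(x^0)\|_p^2}{K}+\frac{8(M_f^2+M_h^2+m^2\rho^2\bar M_c^2M_c^2)}{\beta^2\mu^2}+\frac{8(8L_v^2+3)\Delta_0}{\beta^2\mu^2\eta K}+\frac{4(2L_v^2+1)\nu^2\,\mathbb E_u[\|u\|_2^6]}{\beta^2\mu^2\eta^2}+\frac{32(2L_v^2+1)(p-1)}{\beta^2\mu^2}\Big(\frac1{n_0\alpha K}+\frac{2\alpha}{n}\Big)\tilde\sigma^2.$$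
   Context: Problem. Let $d\ge3$ and $m\ge1$. Consider $\min_{x\in X}\Phi(x):=f(x)+h(x)$ subject to $c(x)=0$, where $f(x)=\mathbb E_\xi[F(x;\xi)]$, $X\subset\mathbb R^d$ is convex, $f:\mathbb R^d\to\mathbb R$ and $c=(c_1,\ldots,c_m):\mathbb R^d\to\mathbb R^m$ are continuously differentiable, $\xi\sim\mathbb P$ is a random variable independent of $x$, $F(\cdot;\xi)$ is continuously differentiable for almost every $\xi$, and $h:\mathbb R^d\to\mathbb R\cup\{\infty\}$ is convex. Write $\nabla c(x)^\top\lambda=\sum_i\lambda_i\nabla c_i(x)$. $\mathcal N_X(x)$ is the normal cone of $X$ at $x$ and $\mathrm{dist}_p(a,B)=\inf_{b\in B}\|a-b\|_p$. Let $\mathbb P_u$ be the sampling distribution of a random vector $u\in\mathbb R^d$; for $\nu>0$ let $X_\nu=\{x+t\nu u: x\in X,\ t\in[0,1],\ u\text{ in the range of }\mathbb P_u\}$ and let $\mathcal O_\nu$ be an open set containing $X_\nu$. Assumptions. (A1) $X$ is nonempty, closed, convex and $\|x\|_q\le D_X$ for all $x\in X$ ($D_X>0$). $\|\nabla f(x)-\nabla f(y)\|_2\le L_f\|x-y\|_2$ and $|f(x)-f(y)|\le M_f\|x-y\|_2$ for all $x,y\in\mathcal O_\nu$ ($L_f,M_f>0$). $h$ is proper, lower semicontinuous and convex over $X$, and for all $x\in X$, $\partial h(x)\neq\emptyset$ and $\sup_{g\in\partial h(x)}\|g\|_2\le M_h$ ($M_h>0$). For $i=1,\ldots,m$ and $x,y\in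 X$: $|c_i(x)|\le\bar M_c$, $\|\nabla c_i(x)\|_2\le M_c$, $\|\nabla c_i(x)-\nabla c_i(y)\|_2\le L_c\|x-y\|_2$ ($\bar M_c,M_c,L_c>0$). $\Phi$ has a finite lower bound $\Phi_{\inf}$ over $X$. (A2) For all $x\in\mathcal O_\nu$: $\mathbb E_\xi[\nabla F(x;\xi)]=\nabla f(x)$ and $\mathbb E_\xi[\|\nabla F(x;\xi)-\nabla f(x)\|_2^2]\le\sigma^2$ ($\sigma>0$). (A3) $(\mathbb E_\xi[\|\nabla F(x;\xi)-\nabla F(y;\xi)\|_2^2])^{1/2}\le L_f\|x-y\|_2$ for all $x,y\in\mathcal O_\nu$. (A4) There is a constant $S_p\ge1$ with $\mathbb E_u[\|\langle g,u\rangle u\|_p^2]\le S_p\|g\|_2^2$ for all $g\in\mathbb R^d$; moreover $\mathbb E_u[uu^\top]=I_d$ and $\mathbb E_u[\|u\|_2^6]<\infty$. (A5) The distance-generating function $v:\mathbb R^d\to\mathbb R$ satisfies $\langle x-y,\nabla v(x)-\nabla v(y)\rangle\ge\|x-y\|_q^2$ for all $x,y\in\mathbb R^d$ and $\|\nabla v(x)-\nabla v(y)\|_p\le L_v\|x-y\|_q$ for all $x,y\in X$. (A6) There is a constant $\beta>0$ such that the iterates $x^0,\ldots,x^K$ of the algorithm satisfy $\beta\|c(x^k)\|_p\le\mathrm{dist}_p(\nabla c(x^k)^\top c(x^k),-\mathcal N_X(x^k))$ for $k=0,\ldots,K$. Algorithm. Let $G_\nu(x;u,\xi)=\frac{F(x+\nu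 u;\xi)-F(x;\xi)}{\nu}u$ and $V(x,y)=v(y)-v(x)-\langle\nabla v(x),y-x\rangle$. Inputs: $x^0\in X$, $\lambda^0=0\in\mathbb R^m$, $\mu,\eta,\nu>0$, $\alpha\in(0,1]$, $\rho_k\in(0,\mu)$, positive integers $K,n_0,n$. All random directions $u_j^k\sim\mathbb P_u$ and samples $\xi_j^k\sim\mathbb P$ are mutually independent. For $k=0,\ldots,K-1$: $s^0=\frac1{n_0}\sum_{j=1}^{n_0}G_\nu(x^0;u_j^0,\xi_j^0)$, and for $k\ge1$, $s^k=\frac1n\sum_{j=1}^n[G_\nu(x^k;u_j^k,\xi_j^k)+(1-\alpha)(s^{k-1}-G_\nu(x^{k-1};u_j^k,\xi_j^k))]$; $x^{k+1}=\arg\min_{x\in X}\langle s^k+\nabla c(x^k)^\top(\lambda^k+\mu c(x^k)),x\rangle+h(x)+\frac1\eta V(x^k,x)$; $\lambda^{k+1}=\lambda^k+\rho_kc(x^k)$. Output $x^R$, with $R$ uniform on $\{0,\ldots,K-1\}$. $\mathbb E_{R;u^{[K]},\xi^{[K]}}$ denotes expectation over $R$ and all directions and samples of iterations $0,\ldots,K-1$. Notation. $\mathcal L(x,\lambda;\mu)=f(x)+h(x)+\lambda^\top c(x)+\frac\mu2\|c(x)\|_2^2$; $L_\mu=L_f+m(\mu M_c^2+\mu\bar M_cL_c+\rho\bar M_cL_c)$; $\Delta_0=\mathcal L(x^0,\lambda^0;\mu)-\Phi_{\inf}+2m\rho\bar M_c^2$; $\tilde\sigma^2=\nu^2L_f^2\,\mathbb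 E_u[\|u\|_2^6]+4S_p(\sigma^2+M_f^2)+2M_f^2$. *)

(* Defs.v *)
From HB Require Import structures.
From mathcomp Require Import all_boot all_order all_algebra.
From mathcomp Require Import finmap.
From mathcomp Require Import all_classical all_reals all_analysis.

Set Implicit Arguments.
Unset Strict Implicit.
Unset Printing Implicit Defensive.

Import Order.TTheory GRing.Theory Num.Theory.
Import numFieldNormedType.Exports.

Local Open Scope classical_set_scope.
Local Open Scope ring_scope.

Section Vectors.
Context {R : realType}.

Definition dotv {n : nat} (x y : 'rV[R]_n) : R := \sum_(i < n) x 0 i * y 0 i.

(* The library norm on 'rV[R]_n is the sup norm; it is used here only for its
   topology (and hence for differentiability), never as a norm. *)
Definition lpnorm {n : nat} (p : R) (x : 'rV[R]_n) : R :=
  (\sum_(i < n) `|x 0 i| `^ p) `^ p^-1.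

Definition lpdist {n : nat} (p : R) (a : 'rV[R]_n) (B : set 'rV[R]_n) : R :=
  inf [set lpnorm p (a - b) | b in B].

Definition grad {n : nat} (f : 'rV[R]_n -> R) (x : 'rV[R]_n) : 'rV[R]_n :=
  \row_(i < n) 'D_(delta_mx 0 i) f x.

Definition cont_diff {n : nat} (f : 'rV[R]_n -> R) : Prop :=
  (forall x, differentiable f x) /\ continuous (grad f).

Definition comp_fun {n m : nat} (c : 'rV[R]_n -> 'rV[R]_m) (i : 'I_m) :
  'rV[R]_n -> R := fun x => c x 0 i.

Definition gradT {n m : nat} (c : 'rV[R]_n -> 'rV[R]_m) (x : 'rV[R]_n)
    (lam : 'rV[R]_m) : 'rV[R]_n :=
  \sum_(i < m) lam 0 i *: grad (comp_fun c i) x.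

(* Only meaningful for x in X, where it contains 0. *)
Definition normal_cone {n : nat} (X : set 'rV[R]_n) (x : 'rV[R]_n) :
  set 'rV[R]_n := [set g | forall y, X y -> dotv g (y - x) <= 0].

Definition convex_ext {n : nat} (h : 'rV[R]_n -> \bar R) : Prop :=
  forall (x y : 'rV[R]_n) (t : R), 0 <= t <= 1 ->
    (h (t *: x + (1 - t) *: y)%R <= t%:E * h x + (1 - t)%R%:E * h y)%E.

Definition lsc_on {n : nat} (X : set 'rV[R]_n) (h : 'rV[R]_n -> \bar R) : Prop :=
  forall x, X x -> forall a : R, (a%:E < h x)%E ->
    \forall y \near within X (nbhs x), (a%:E < h y)%E.

(* Empty at points where h is +oo, as soon as h is finite somewhere. *)
Definition subdiff {n : nat} (h : 'rV[R]_n -> \bar R) (x : 'rV[R]_n) :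
  set 'rV[R]_n :=
  [set g | forall y, (h x + (dotv g (y - x)%R)%:E <= h y)%E].

Definition bregman {n : nat} (v : 'rV[R]_n -> R) (x y : 'rV[R]_n) : R :=
  v y - v x - dotv (grad v x) (y - x).

Definition is_argmin {n : nat} (X : set 'rV[R]_n) (g : 'rV[R]_n -> \bar R)
    (x : 'rV[R]_n) : Prop :=
  X x /\ forall y, X y -> (g x <= g y)%E.

Definition aug_lagrangian {n m : nat} (f : 'rV[R]_n -> R)
    (h : 'rV[R]_n -> \bar R) (c : 'rV[R]_n -> 'rV[R]_m)
    (x : 'rV[R]_n) (lam : 'rV[R]_m) (mu : R) : \bar R :=
  ((f x)%:E + h x + (dotv lam (c x))%:E
   + (mu / 2 * lpnorm 2 (c x) ^+ 2)%R%:E)%E.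

End Vectors.

(* The library puts no measurable structure on 'rV[R]_n; this alias carries the
   Borel one and is convertible to 'rV[R]_n. *)
Notation borelRV R n := (g_sigma_algebraType (@open 'rV[R]_n)).

Section Probability.
Context {R : realType}.

(* The set of values a direction may take: the topological support of its law. *)
Definition msupport {n : nat} (Pu : set (borelRV R n) -> \bar R) :
  set 'rV[R]_n := [set u | forall U : set 'rV[R]_n, open U -> U u -> (0 < Pu U)%E].

Definition smoothing_domain {n : nat} (X : set 'rV[R]_n)
    (Pu : set (borelRV R n) -> \bar R) (nu : R) : set 'rV[R]_n :=
  [set z | exists x (t : R) u,
     [/\ X x, 0 <= t <= 1, msupport Pu u & z = x + (t * nu) *: u]].

Definition has_mean {d} {T : measurableType d} {n : nat} (P : probability T R)
    (Y : T -> 'rV[R]_n) (a : 'rV[R]_n) : Prop :=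
  forall i, P.-integrable [set: T] (fun w => (Y w 0 i)%:E) /\
            ('E_P[fun w => (Y w 0 i)%R] = (a 0 i)%:E)%E.

Definition has_law {d d'} {T : measurableType d} {T' : measurableType d'}
    (P : probability T R) (Y : T -> T') (Q : probability T' R) : Prop :=
  measurable_fun [set: T] Y /\
  forall A, measurable A -> P (Y @^-1` A) = Q A.

Definition mutually_independent {d} {T : measurableType d} {I : choiceType}
    (P : probability T R) (D : set I) (G : I -> set (set T)) : Prop :=
  forall (J : {fset I}) (A : I -> set T),
    (forall i, i \in J -> D i /\ G i (A i)) ->
    P (\bigcap_(i in [set` J]) A i) =
    (\prod_(i <- enum_fset J) fine (P (A i)))%:E.

End Probability.

Section Algorithm.
Context {R : realType}.

Definition two_point {n : nat} {T : Type} (F : 'rV[R]_n -> T -> R) (nu : R)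
    (x u : 'rV[R]_n) (xi : T) : 'rV[R]_n :=
  ((F (x + nu *: u) xi - F x xi) / nu) *: u.

Definition batch (n0 n k : nat) : nat := if k == 0%N then n0 else n.

(* [inl (inl (k, j))] is the direction u_j^k, [inl (inr (k, j))] the sample
   xi_j^k, and [inr tt] the output index. *)
Definition source : choiceType := ((nat * nat) + (nat * nat) + unit)%type.

Definition used_sources (K n0 n : nat) : set source :=
  [set i | match i with
           | inl (inl (k, j)) | inl (inr (k, j)) =>
               (k < K)%N /\ (j < batch n0 n k)%N
           | inr _ => True
           end].

Definition source_sigma {dX dO} {Xi : measurableType dX}
    {Omega : measurableType dO} {d K : nat}
    (u : nat -> nat -> Omega -> borelRV R d) (xi : nat -> nat -> Omega -> Xi)
    (r : Omega -> 'I_K) (i : source) : set (set Omega) :=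
  match i with
  | inl (inl (k, j)) => preimage_set_system [set: Omega] (u k j) measurable
  | inl (inr (k, j)) => preimage_set_system [set: Omega] (xi k j) measurable
  | inr _ => preimage_set_system [set: Omega] r [set: set 'I_K]
  end.

(* Pathwise: the sequences are constrained only up to x K, s (K - 1), lam K.
   The argmin is stated relationally; strong convexity of v makes it unique. *)
Definition is_run {d m : nat} {T : Type} (F : 'rV[R]_d -> T -> R)
    (X : set 'rV[R]_d) (h : 'rV[R]_d -> \bar R) (c : 'rV[R]_d -> 'rV[R]_m)
    (v : 'rV[R]_d -> R) (mu eta nu alpha : R) (rhos : nat -> R)
    (K n0 n : nat) (x0 : 'rV[R]_d)
    (u : nat -> nat -> 'rV[R]_d) (xi : nat -> nat -> T)
    (x s : nat -> 'rV[R]_d) (lam : nat -> 'rV[R]_m) : Prop :=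
  [/\ x 0%N = x0 /\ lam 0%N = 0,
      s 0%N = n0%:R^-1 *:
        \sum_(j < n0) two_point F nu (x 0%N) (u 0%N j) (xi 0%N j),
      forall k, (k.+1 < K)%N ->
        s k.+1 = n%:R^-1 *: \sum_(j < n)
          (two_point F nu (x k.+1) (u k.+1 j) (xi k.+1 j)
           + (1 - alpha) *:
             (s k - two_point F nu (x k) (u k.+1 j) (xi k.+1 j))),
      forall k, (k < K)%N ->
        is_argmin X
          (fun y =>
             ((dotv (s k + gradT c (x k) (lam k + mu *: c (x k)))%R y)%:E
              + h y + (eta^-1 * bregman v (x k) y)%R%:E)%E)
          (x k.+1)
    & forall k, (k < K)%N -> lam k.+1 = lam k + rhos k *: c (x k)].

End Algorithm.

(* Main.v *)
Require Import Defs.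
From HB Require Import structures.
From mathcomp Require Import all_boot all_order all_algebra.
From mathcomp Require Import finmap.
From mathcomp Require Import all_classical all_reals all_analysis.
From mathcomp Require Import measurable_realfun ring lra.

(* Pathwise, the variational inequality of the mirror step and the smoothness of
   the augmented Lagrangian bound the sum of |x^(k+1) - x^k|_q^2 by Delta_0 plus
   the gradient errors, and (A6) at x^(k+1) bounds |c(x^(k+1))|_p by the residual
   of the same inequality: no sum rule for subdifferentials is needed, a normal
   vector is obtained by projecting on the tangent cone of X.  The estimator errors
   e^k = s^k - E G_nu(x^k) satisfy a contraction, because |.|_p^2 is 2-smooth with
   constant p - 1 and each fresh sample (u_j^k, xi_j^k) is centred given the past;
   its noise is controlled by |x^k - x^(k-1)|^2, which the batch size n makes
   absorbable in the descent inequality. *)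

Set Implicit Arguments.
Unset Strict Implicit.
Unset Printing Implicit Defensive.

Import Order.TTheory GRing.Theory Num.Theory.
Import numFieldNormedType.Exports.

Local Open Scope classical_set_scope.
Local Open Scope ring_scope.

(** The sum of squared estimator errors and the sum of squared moves (divided by eta^2) bound each
    other. Descent gives moves <= 5/2 errors + ... on every path; the batch size gives errors <=
    moves / 12 + ... in expectation only, with 96 = 8 * 12, where 8 is the weight of the move in the
    sampling noise. As 5/24 < 1 the pair can be solved; the pathwise bounds are kept linear in both
    sums so that they survive the expectation. Errors are measured from the mean of the two-point
    estimator, not from the gradient of [f]: only then do fresh samples average out, and the bias,
    of size nu, is added back inside the descent. (A6) is exploited at x^1, ..., x^K while the
    output ranges over x^0, ..., x^(K-1), whence the term |c(x^0)|^2 / K. The main obstacle is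
    measurability: a run is given by relations on each path, so every iterate must be shown to be a
    measurable function of the sources already drawn before Fubini can integrate out a fresh sample.
    For this, almost sure hypotheses are turned into sure ones, by altering [F] on a null set and
    rerunning the bad paths. *)

(* lpnorm is sealed: otherwise comparing lpnorm p x with lpnorm p y makes
   conversion unfold powR. *)
Fact pnorm_key : unit. Proof. by []. Qed.
Definition pnorm {R : realType} {n : nat} : R -> 'rV[R]_n -> R :=
  locked_with pnorm_key (@lpnorm R n).

Lemma lpnormE (R : realType) n : @lpnorm R n = @pnorm R n.
Proof. by rewrite /pnorm unlock. Qed.

(** * Vectors and p-norms *)

Section LpNorm.
Context {R : realType} {n : nat}.
Implicit Types (x y z : 'rV[R]_n) (p q r s t : R).

Lemma dotvC x y : dotv x y = dotv y x.
Proof. by apply: eq_bigr => i _; rewrite mulrC. Qed.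

Lemma dotvDl x y z : dotv (x + y) z = dotv x z + dotv y z.
Proof. by rewrite -big_split; apply: eq_bigr => i _; rewrite mxE mulrDl. Qed.

Lemma dotvDr x y z : dotv z (x + y) = dotv z x + dotv z y.
Proof. by rewrite dotvC dotvDl !(dotvC z). Qed.

Lemma dotvZl (a : R) x y : dotv (a *: x) y = a * dotv x y.
Proof. by rewrite mulr_sumr; apply: eq_bigr => i _; rewrite mxE mulrA. Qed.

Lemma dotvZr (a : R) x y : dotv x (a *: y) = a * dotv x y.
Proof. by rewrite dotvC dotvZl dotvC. Qed.

Lemma dotvNl x y : dotv (- x) y = - dotv x y.
Proof. by rewrite -scaleN1r dotvZl mulN1r. Qed.

Lemma dotvNr x y : dotv x (- y) = - dotv x y.
Proof. by rewrite dotvC dotvNl dotvC. Qed.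

Lemma dotvBl x y z : dotv (x - y) z = dotv x z - dotv y z.
Proof. by rewrite dotvDl dotvNl. Qed.

Lemma dotvBr x y z : dotv z (x - y) = dotv z x - dotv z y.
Proof. by rewrite dotvDr dotvNr. Qed.

Lemma dotv0l x : dotv 0 x = 0.
Proof. by rewrite -(scale0r x) dotvZl mul0r. Qed.

Lemma dotv0r x : dotv x 0 = 0.
Proof. by rewrite dotvC dotv0l. Qed.

Lemma dotv_suml (I : Type) (l : seq I) (P : pred I) (F : I -> 'rV[R]_n) y :
  dotv (\sum_(i <- l | P i) F i) y = \sum_(i <- l | P i) dotv (F i) y.
Proof.
elim/big_rec2: _ => [|i a b _ <-]; first exact: dotv0l.
by rewrite dotvDl.
Qed.

(** Young's inequality with the conjugate exponents 1/(1-t) and 1/t. The endpoints are treated apart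
    because one exponent would be infinite there. *)
Lemma wamgm (a b t : R) : 0 <= a -> 0 <= b -> 0 <= t <= 1 ->
  a `^ (1 - t) * b `^ t <= (1 - t) * a + t * b.
Proof.
move=> a0 b0 /andP[t0 t1].
have [->|tn0] := eqVneq t 0; first by rewrite subr0 powRr1// powRr0 !mulr1 mul1r mul0r addr0.
have [->|tn1] := eqVneq t 1; first by rewrite subrr powRr0 powRr1// !mul1r mul0r add0r.
have tp : 0 < t by rewrite lt_def tn0.
have t1p : 0 < 1 - t by rewrite subr_gt0 lt_def eq_sym tn1.
have := @conjugate_powR _ (a `^ (1 - t)) (b `^ t) (1 - t)^-1 t^-1.
rewrite !powR_ge0 !invr_gt0 t1p tp !invrK subrK => /(_ isT isT isT isT erefl).
rewrite -!powRrM !divff ?gt_eqF// !powRr1//.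
by rewrite [a * _]mulrC [b * _]mulrC.
Qed.

(** Scaling both sums to 1 reduces it to [wamgm] term by term. The form with a weight [t] serves
    twice: for the duality of the p- and q-norms, and with [t = 2 / p] for the second derivative of
    the squared p-norm. *)
Lemma hoelder_sum (I : finType) (a b : I -> R) t :
  (forall i, 0 <= a i) -> (forall i, 0 <= b i) -> 0 <= t <= 1 ->
  \sum_i a i `^ (1 - t) * b i `^ t <= (\sum_i a i) `^ (1 - t) * (\sum_i b i) `^ t.
Proof.
move=> a0 b0 t01; have /andP[t0 t1] := t01.
have [->|tn0] := eqVneq t 0.
  rewrite subr0 powRr1 ?sumr_ge0// powRr0 mulr1 ler_sum// => i _.
  by rewrite powRr1// powRr0 mulr1.
have [->|tn1] := eqVneq t 1.
  rewrite subrr powRr0 powRr1 ?sumr_ge0// mul1r ler_sum// => i _.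
  by rewrite powRr1// powRr0 mul1r.
have [A0|An0] := eqVneq (\sum_i a i) 0.
  rewrite A0 big1 ?mulr_ge0 ?powR_ge0// => i _.
  move/eqP: A0; rewrite psumr_eq0// => /allP/(_ i (mem_index_enum _))/eqP ->.
  by rewrite powR0 ?mul0r// subr_eq0 eq_sym.
have [B0|Bn0] := eqVneq (\sum_i b i) 0.
  rewrite B0 big1 ?mulr_ge0 ?powR_ge0// => i _.
  move/eqP: B0; rewrite psumr_eq0// => /allP/(_ i (mem_index_enum _))/eqP ->.
  by rewrite powR0 ?mulr0.
set A := \sum_i a i in An0 *; set B := \sum_i b i in Bn0 *.
have Ap : 0 < A by rewrite lt_def An0 sumr_ge0.
have Bp : 0 < B by rewrite lt_def Bn0 sumr_ge0.
have S : \sum_i (a i / A) `^ (1 - t) * (b i / B) `^ t <= 1.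
  apply: (@le_trans _ _ (\sum_i ((1 - t) * (a i / A) + t * (b i / B)))).
    by apply: ler_sum => i _; apply: wamgm => //; rewrite divr_ge0// ltW.
  by rewrite big_split/= -!mulr_sumr -!mulr_suml -/A -/B !divff// !mulr1 subrK.
rewrite -[leRHS]mulr1 -ler_pdivrMl ?mulr_gt0 ?powR_gt0//.
apply: le_trans S; rewrite mulr_sumr ler_sum// => i _.
rewrite !powRM ?invr_ge0 ?(ltW Ap) ?(ltW Bp)//.
rewrite -(powR_inv1 (ltW Ap)) -(powR_inv1 (ltW Bp)) -!powRrM !mulN1r !powRN.
rewrite invfM le_eqVlt; apply/orP; left; apply/eqP; ring.
Qed.

Lemma pnormE p x : pnorm p x = (\sum_(i < n) `|x 0 i| `^ p) `^ p^-1.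
Proof. by rewrite -lpnormE. Qed.

Lemma pnorm_ge0 p x : 0 <= pnorm p x.
Proof. by rewrite pnormE powR_ge0. Qed.

Lemma sum_powR_ge0 p x : 0 <= \sum_(i < n) `|x 0 i| `^ p.
Proof. by apply: sumr_ge0 => i _; exact: powR_ge0. Qed.

Lemma pnorm_powR p x : 0 < p -> pnorm p x `^ p = \sum_(i < n) `|x 0 i| `^ p.
Proof.
by move=> p0; rewrite !pnormE -powRrM mulVf ?gt_eqF// powRr1 ?sum_powR_ge0.
Qed.

Lemma pnorm2_sqr x : pnorm 2 x ^+ 2 = \sum_(i < n) x 0 i ^+ 2.
Proof.
rewrite -powR_mulrn ?pnorm_ge0// pnorm_powR//.
by apply: eq_bigr => i _; rewrite powR_mulrn// -normrX ger0_norm// sqr_ge0.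
Qed.

Lemma dotvv x : dotv x x = pnorm 2 x ^+ 2.
Proof. by rewrite pnorm2_sqr; apply: eq_bigr => i _; rewrite expr2. Qed.

Lemma pnorm0 p : 0 < p -> pnorm p (0 : 'rV[R]_n) = 0.
Proof.
move=> p0; rewrite !pnormE big1 ?powR0// ?invr_eq0 ?gt_eqF// => i _.
by rewrite mxE normr0 powR0// gt_eqF.
Qed.

Lemma pnormZ p (a : R) x : 0 < p -> pnorm p (a *: x) = `|a| * pnorm p x.
Proof.
move=> p0; rewrite !pnormE.
under eq_bigr do rewrite mxE normrM powRM//.
rewrite -mulr_sumr powRM ?powR_ge0 ?sum_powR_ge0// -powRrM divff ?gt_eqF//.
by rewrite powRr1.
Qed.

Lemma pnormN p x : pnorm p (- x) = pnorm p x.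
Proof. by rewrite !pnormE; under eq_bigr do rewrite mxE normrN. Qed.

Lemma pnormBC p x y : pnorm p (x - y) = pnorm p (y - x).
Proof. by rewrite -opprB pnormN. Qed.

Lemma coord_le_pnorm p x i : 0 < p -> `|x 0 i| <= pnorm p x.
Proof.
move=> p0; rewrite -[leLHS]powRr1// -(@divff _ p) ?gt_eqF// powRrM.
rewrite pnormE ge0_ler_powR ?invr_ge0 ?nnegrE ?powR_ge0 ?sum_powR_ge0 ?(ltW p0)//.
by rewrite (bigD1 i)//= lerDl sumr_ge0// => j _; exact: powR_ge0.
Qed.

Lemma pnorm_eq0 p x : 0 < p -> pnorm p x = 0 -> x = 0.
Proof.
move=> p0 x0; apply/rowP => i; apply/eqP; rewrite mxE -normr_le0 -x0.
exact: coord_le_pnorm.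
Qed.

(** With N the s-norm, |x_i|^r <= N^(r-s) |x_i|^s, and the right-hand sides sum to N^r. Since q <= 2
    <= p, this moves between the p-, 2- and q-norms without any dimensional factor. *)
Lemma pnorm_le r s x : 0 < s -> s <= r -> pnorm r x <= pnorm s x.
Proof.
move=> s0 sr; have r0 := lt_le_trans s0 sr.
have [x0|xn0] := eqVneq (pnorm s x) 0.
  by rewrite (pnorm_eq0 s0 x0) !pnorm0.
have xp : 0 < pnorm s x by rewrite lt_def xn0 pnorm_ge0.
set N := pnorm s x in xn0 xp *.
suff H : \sum_(i < n) `|x 0 i| `^ r <= N `^ r.
  rewrite -[leRHS]powRr1 ?(ltW xp)// -(@divff _ r) ?gt_eqF// powRrM.
  by rewrite pnormE ge0_ler_powR ?invr_ge0 ?nnegrE ?powR_ge0 ?sum_powR_ge0 ?(ltW r0).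
rewrite -(subrK s r) powRD ?(gt_eqF xp) ?implybT//.
rewrite pnorm_powR// mulr_sumr ler_sum// => i _.
have [xi0|xin0] := eqVneq (x 0 i) 0.
  by rewrite xi0 normr0 subrK powR0 ?gt_eqF// mulr_ge0 ?powR_ge0.
rewrite powRD ?normr_eq0 ?xin0 ?implybT// ler_wpM2r ?powR_ge0//.
rewrite ge0_ler_powR ?subr_ge0 ?nnegrE ?(ltW xp)//.
exact: coord_le_pnorm.
Qed.

Lemma dotv_hoelder p q x y : 0 < p -> 0 < q -> p^-1 + q^-1 = 1 ->
  dotv x y <= pnorm p x * pnorm q y.
Proof.
move=> p0 q0 pq.
have p' : p^-1 = 1 - q^-1 by rewrite -pq addrK.
apply: (@le_trans _ _ (\sum_(i < n) `|x 0 i| * `|y 0 i|)).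
  by apply: ler_sum => i _; rewrite -normrM ler_norm.
have := @hoelder_sum 'I_n (fun i => `|x 0 i| `^ p) (fun i => `|y 0 i| `^ q) q^-1.
rewrite -p' => /(_ (fun=> powR_ge0 _ _) (fun=> powR_ge0 _ _)).
have -> : 0 <= q^-1 <= 1.
  by rewrite invr_ge0 (ltW q0) -pq lerDr invr_ge0 ltW.
move=> /(_ isT); rewrite -!pnormE; apply: le_trans; apply: ler_sum => i _.
by rewrite -!powRrM !divff ?gt_eqF// !powRr1.
Qed.

Lemma normr_dotv_hoelder p q x y : 0 < p -> 0 < q -> p^-1 + q^-1 = 1 ->
  `|dotv x y| <= pnorm p x * pnorm q y.
Proof.
move=> p0 q0 pq; rewrite ler_norml dotv_hoelder// andbT lerNl -dotvNl.
by rewrite -(pnormN p x) dotv_hoelder.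
Qed.

Lemma inv2D : 2^-1 + 2^-1 = 1 :> R.
Proof. lra. Qed.

Lemma dotv_cauchy x y : `|dotv x y| <= pnorm 2 x * pnorm 2 y.
Proof. by apply: normr_dotv_hoelder => //; exact: inv2D. Qed.

(** Minkowski's inequality by convexity: with A and B the two norms, (x + y) / (A + B) is the convex
    combination of x / A and y / B with weights A / (A + B) and B / (A + B), and [powR] is
    convex. *)
Lemma pnormD p x y : 1 <= p -> pnorm p (x + y) <= pnorm p x + pnorm p y.
Proof.
move=> p1; have p0 : 0 < p by apply: lt_le_trans p1.
have [x0|xn0] := eqVneq (pnorm p x) 0.
  by rewrite (pnorm_eq0 p0 x0) pnorm0// !add0r.
have [y0|yn0] := eqVneq (pnorm p y) 0.
  by rewrite (pnorm_eq0 p0 y0) pnorm0// !addr0.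
have Ap : 0 < pnorm p x by rewrite lt_def xn0 pnorm_ge0.
have Bp : 0 < pnorm p y by rewrite lt_def yn0 pnorm_ge0.
move EA : (pnorm p x) Ap => A Ap; move EB : (pnorm p y) Bp => B Bp.
have ABp : 0 < A + B by rewrite addr_gt0.
have [A0 B0 AB0] := And3 (ltW Ap) (ltW Bp) (ltW ABp).
have H i : `|x 0 i + y 0 i| `^ p <= (A + B) `^ p *
   (A / (A + B) * (`|x 0 i| / A) `^ p + B / (A + B) * (`|y 0 i| / B) `^ p).
  apply: (@le_trans _ _ ((A + B) `^ p *
    (A / (A + B) * (`|x 0 i| / A) + B / (A + B) * (`|y 0 i| / B)) `^ p)).
    rewrite -powRM ?(ltW ABp)//; last first.
      by rewrite !(addr_ge0, divr_ge0, mulr_ge0).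
    rewrite ge0_ler_powR ?nnegrE ?(ltW p0)//.
      by rewrite !(addr_ge0, divr_ge0, mulr_ge0).
    rewrite (le_trans (ler_normD _ _))// le_eqVlt; apply/orP; left; apply/eqP.
    by field; rewrite !gt_eqF.
  rewrite ler_wpM2l ?powR_ge0//.
  have t01 : 0 <= A / (A + B) <= 1.
    by rewrite divr_ge0 ?(ltW Ap) ?(ltW ABp)//= ler_pdivrMr// mul1r lerDl ltW.
  pose t := Itv01 (andP t01).1 (andP t01).2.
  have Bt : B / (A + B) = 1 - A / (A + B) by field; rewrite gt_eqF.
  have := @convex_powR R p p1 t (`|x 0 i| / A) (`|y 0 i| / B).
  rewrite !inE/= !in_itv/= !andbT !divr_ge0 ?(ltW Ap) ?(ltW Bp)//.
  by move=> /(_ isT isT); rewrite !convRE /= Bt.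
have S : \sum_(i < n) `|x 0 i + y 0 i| `^ p <= (A + B) `^ p.
  apply: (le_trans (ler_sum _ (fun i _ => H i))).
  rewrite -mulr_sumr -[leRHS]mulr1 ler_wpM2l ?powR_ge0// big_split/= -!mulr_sumr.
  have N (z : 'rV[R]_n) C : pnorm p z = C -> 0 < C ->
      \sum_(i < n) (`|z 0 i| / C) `^ p = 1.
    move=> <- zp; under eq_bigr do rewrite powRM ?invr_ge0 ?(ltW zp)//.
    rewrite -mulr_suml -pnorm_powR// -powRM ?pnorm_ge0 ?invr_ge0 ?pnorm_ge0//.
    by rewrite divff ?gt_eqF// powR1.
  by rewrite (N x A)// (N y B)// !mulr1 -mulrDl divff// gt_eqF.
rewrite [leLHS]pnormE; under eq_bigr do rewrite mxE.
rewrite -[leRHS]powRr1 ?(ltW ABp)// -(@divff _ p) ?gt_eqF// powRrM.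
by rewrite ge0_ler_powR ?nnegrE ?powR_ge0 ?invr_ge0 ?(ltW p0)// sumr_ge0// => i _; exact: powR_ge0.
Qed.

Lemma pnorm_sum (I : Type) (l : seq I) (P : pred I) (F : I -> 'rV[R]_n) p :
  1 <= p -> pnorm p (\sum_(i <- l | P i) F i) <= \sum_(i <- l | P i) pnorm p (F i).
Proof.
move=> p1; elim/big_rec2: _ => [|i a b _ H].
  by rewrite pnorm0// (lt_le_trans _ p1).
by rewrite (le_trans (pnormD _ _ p1))// lerD2l.
Qed.

Lemma coord_le_norm x i : `|x 0 i| <= `|x|.
Proof.
by rewrite [leRHS]/Num.norm/= mx_normrE; apply/bigmax_geP; right => /=; exists (0, i).
Qed.

Lemma norm_le_bound x (e : R) : 0 <= e -> (forall i, `|x 0 i| <= e) -> `|x| <= e.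
Proof.
move=> e0 H; rewrite [leLHS]/Num.norm/= mx_normrE; apply/bigmax_leP; split=> //=.
by move=> [i j] _ /=; rewrite ord1.
Qed.

(** The dimensional factor is harmless: it serves only to transfer continuity to and from the
    sup-norm topology. *)
Lemma pnorm_le_norm p x : 1 <= p -> pnorm p x <= n%:R * `|x|.
Proof.
move=> p1; rewrite (le_trans (pnorm_le _ _ p1))//.
rewrite !pnormE invr1 powRr1 ?sum_powR_ge0//.
apply: (@le_trans _ _ (\sum_(i < n) `|x|)).
  by apply: ler_sum => i _; rewrite powRr1// coord_le_norm.
by rewrite sumr_const card_ord mulr_natl.
Qed.

Lemma norm_le_pnorm p x : 0 < p -> `|x| <= pnorm p x.
Proof.
by move=> p0; rewrite norm_le_bound ?pnorm_ge0// => i; exact: coord_le_pnorm.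
Qed.

End LpNorm.

(** * One-variable calculus: mean value, quadratic bounds and odd powers *)

Section Calculus.
Context {R : realType}.

Lemma mvt01 (f df : R -> R) :
  (forall t : R, 0 <= t <= 1 -> is_derive t 1 f (df t)) ->
  exists2 c : R, 0 <= c <= 1 & f 1 - f 0 = df c.
Proof.
move=> fdf.
have [t||c] := @MVT R f df 0 1 ltr01.
- by rewrite in_itv/= => /andP[? ?]; apply: fdf; rewrite !ltW.
- apply: derivable_within_continuous => t; rewrite in_itv/= => t01.
  exact: (@ex_derive _ _ _ _ _ _ _ (fdf t t01)).
rewrite in_itv/= => /andP[c0 c1]; rewrite subr0 mulr1 => ->.
by exists c; rewrite ?(ltW c0) ?(ltW c1).
Qed.

(** Subtracting the quadratic model leaves a function with nonpositive derivative on [0, 1], so the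
    mean value theorem suffices and [df] is never integrated. *)
Lemma taylor1_ub (f df : R -> R) (M : R) :
  (forall t : R, 0 <= t <= 1 -> is_derive t 1 f (df t)) ->
  (forall t : R, 0 <= t <= 1 -> df t - df 0 <= M * t) ->
  f 1 <= f 0 + df 0 + M / 2.
Proof.
move=> fdf dfM.
pose G := f - (df 0 \*: id) - ((M / 2) \*: (id ^+ 2)).
have [t t01|c c01] := @mvt01 G (fun t => df t - df 0 - M * t).
  have := fdf _ t01 => Dt.
  apply: is_derive_eq.
  by rewrite /GRing.scale/= mulr1 expr1; field.
rewrite /G /GRing.scale_fun/= !fctE /GRing.scale/= => E.
have := dfM _ c01; rewrite -subr_le0 -E; lra.
Qed.

Lemma taylor1_bound (f df : R -> R) (M : R) :
  (forall t : R, 0 <= t <= 1 -> is_derive t 1 f (df t)) ->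
  (forall t : R, 0 <= t <= 1 -> `|df t - df 0| <= M * t) ->
  `|f 1 - f 0 - df 0| <= M / 2.
Proof.
move=> fdf dfM; rewrite ler_norml; apply/andP; split.
  have := @taylor1_ub (- f) (- df) M _ _; rewrite !fctE.
  have A (t : R) : 0 <= t <= 1 -> is_derive t 1 (- f) ((- df) t).
    by move=> t01; have := fdf _ t01 => ?; exact: is_deriveN.
  move=> /(_ A); have B (t : R) : 0 <= t <= 1 -> - df t - - df 0 <= M * t.
    by move=> /dfM; rewrite ler_norml => /andP[]; lra.
  by move=> /(_ B); lra.
have := taylor1_ub fdf (fun t t01 => le_trans (ler_norm _) (dfM t t01)); lra.
Qed.

(** The odd power sign(s) |s|^(r+1); with r = p - 2 it is the derivative of |s|^p / p. *)
Definition psgn (r s : R) : R := `|s| `^ r * s.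

(** Only for s > 0 does the derivative of [powR] apply directly. Negative s follows by oddness, and
    at 0 the difference quotient is |h|^r, which tends to 0 when r > 0; r = 0 is the identity. *)
Lemma psgn_derive (r s : R) : 0 <= r ->
  is_derive s 1 (psgn r) ((r + 1) * `|s| `^ r).
Proof.
move=> r0; have [->|rn0] := eqVneq r 0.
  have -> : psgn 0 = id by apply/funext => x; rewrite /psgn powRr0 mul1r.
  by rewrite add0r powRr0 mul1r; exact: is_derive_id.
have rp : 0 < r by rewrite lt_def rn0.
have [->|sn0] := eqVneq s 0.
  rewrite normr0 powR0// mulr0.
  have H : (fun h : R => h^-1 *: (psgn r (h *: 1 + 0) - psgn r 0)) @ 0^' --> (0 : R).
    apply/cvgrPdist_lt => e e0; near=> h.
    have hn0 : h != 0 by near: h; exact: nbhs_dnbhs_neq.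
    rewrite /psgn mulr0 subr0 addr0 /GRing.scale/= mulr1 mulrCA mulVf//.
    rewrite mulr1 sub0r normrN ger0_norm ?powR_ge0//.
    have he : `|h| < e `^ r^-1.
      near: h; apply: dnbhs0_lt.
      by rewrite powR_gt0.
    rewrite -[ltRHS]powRr1 ?(ltW e0)// -(@mulVf _ r)// powRrM.
    by rewrite gt0_ltr_powR// nnegrE ?powR_ge0.
  apply: DeriveDef; first by apply/cvg_ex; exists 0.
  exact/cvg_lim.
wlog sp : s sn0 / 0 < s => [H|].
  have [/H|] := ltP 0 s; first exact.
  rewrite le_eqVlt (negbTE sn0)/= -oppr_gt0 => sN.
  have HN : - s != 0 by rewrite oppr_eq0.
  have D := H _ HN sN.
  have -> : psgn r = - (psgn r \o -%R).
    by apply/funext => x; rewrite /psgn !fctE/= normrN mulrN opprK.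
  have D2 := @is_derive1_comp _ _ -%R s _ _ D (is_deriveNid _ _).
  by apply: is_derive_eq; rewrite normrN /GRing.scale/=; ring.
have D : is_derive s 1 (((powR (R:=R)) ^~ r : R -> R) * id) ((r + 1) * `|s| `^ r).
  have D1 := @is_derive1_powR R r s sp.
  apply: is_derive_eq; rewrite /GRing.scale/= mulr1 gtr0_norm// mulrCA mulr_powRB1 ?ltW//; ring.
apply: near_eq_is_derive D.
near=> x; rewrite /psgn !fctE gtr0_norm//; near: x.
exact: lt_nbhsr.
Unshelve. all: by end_near. Qed.

Lemma normr_powR_derive (p s : R) : 2 <= p ->
  is_derive s 1 (fun x => `|x| `^ p) (p * psgn (p - 2) s).
Proof.
move=> p2; have -> : (fun x : R => `|x| `^ p) = (psgn (p - 2) : R -> R) * id.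
  apply/funext => x; rewrite /psgn fctE/= -mulrA -expr2 -[x ^+ 2]ger0_norm ?sqr_ge0//.
  rewrite normrX -powR_mulrn//.
  have [->|x0] := eqVneq x 0; first by rewrite normr0 [X in _ = _ * X]powR0 ?pnatr_eq0// mulr0 powR0// gt_eqF// (lt_le_trans _ p2).
  by rewrite -powRD ?subrK// normr_eq0 x0 implybT.
have D1 : is_derive s 1 (psgn (p - 2)) ((p - 2 + 1) * `|s| `^ (p - 2)).
  by apply: psgn_derive; rewrite subr_ge0.
by apply: is_derive_eq; rewrite /GRing.scale/= mulr1 /psgn; ring.
Qed.

End Calculus.

(** * Quadratic upper bound for the squared p-norm *)

Section Smoothness.
Context {R : realType} {n : nat}.
Implicit Types (a z : 'rV[R]_n) (p : R).

(* Along a segment avoiding 0 the second derivative of the squared norm is at most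
   2 (p - 1) |z|_p^2 by Hoelder. *)
Lemma pnorm_sqr_smooth p a : 2 <= p ->
  exists j : 'rV[R]_n, forall z,
    pnorm p (a + z) ^+ 2 <= pnorm p a ^+ 2 + dotv j z + (p - 1) * pnorm p z ^+ 2.
Proof.
move=> p2; have p0 : 0 < p by apply: lt_le_trans p2.
have p1 : 1 <= p - 1 by lra.
have [a0|an0] := eqVneq (pnorm p a) 0.
  exists 0 => z; rewrite (pnorm_eq0 p0 a0) add0r pnorm0// dotv0l expr0n/= !add0r.
  by rewrite ler_peMl// sqr_ge0.
pose S (x : 'rV[R]_n) := \sum_(i < n) `|x 0 i| `^ p.
have S0 x : 0 <= S x by exact: sum_powR_ge0.
have SE x : pnorm p x ^+ 2 = S x `^ (2 / p).
  by rewrite -powR_mulrn ?pnorm_ge0// pnormE -powRrM mulrC.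
have Sgt0 x : x != 0 -> 0 < S x.
  move=> xn0; rewrite lt_def S0 andbT; apply: contra xn0 => /eqP Sx.
  have : pnorm p x ^+ 2 == 0.
    by rewrite SE Sx powR0// mulf_neq0// invr_neq0// gt_eqF.
  by rewrite expf_eq0/= => /eqP/(pnorm_eq0 p0) ->.
(* The gradient of the squared p-norm at [a], for [a] nonzero. *)
pose j : 'rV[R]_n := \row_i (2 * S a `^ (2 / p - 1) * psgn (p - 2) (a 0 i)).
have an : a != 0 by apply: contra an0 => /eqP ->; rewrite pnorm0.
have ja : dotv j a = 2 * pnorm p a ^+ 2.
  have -> : pnorm p a ^+ 2 = S a `^ (2 / p - 1) * S a.
    rewrite SE -[X in _ = _ * X]powRr1// -powRD ?subrK//.
    by apply/implyP => _; rewrite gt_eqF// Sgt0.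
  rewrite mulrA /S mulr_sumr; apply: eq_bigr => i _; rewrite mxE /psgn -/(S a).
  suff -> : `|a 0 i| `^ p = `|a 0 i| `^ (p - 2) * a 0 i * a 0 i by ring.
  rewrite -mulrA -expr2 -[a 0 i ^+ 2]ger0_norm ?sqr_ge0// normrX -powR_mulrn//.
  have [->|x0] := eqVneq (a 0 i) 0.
    by rewrite normr0 [X in _ = _ * X]powR0 ?pnatr_eq0// mulr0 powR0// gt_eqF.
  by rewrite -powRD ?subrK// normr_eq0 x0 implybT.
exists j => z.
(* A segment from [a] along a multiple of [a] may cross 0, where the second derivative fails to
   exist. There the claim is an identity in s, thanks to <j, a> = 2 |a|^2, up to the nonnegative
   term (p - 2) s^2 |a|^2. *)
have [[s zE]|zn] := pselect (exists s, z = s *: a).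
  rewrite zE -{1}(scale1r a) -scalerDl !pnormZ// dotvZr ja !exprMn !real_normK ?num_real//.
  have : 0 <= (p - 2) * s ^+ 2 * pnorm p a ^+ 2.
    by rewrite mulr_ge0 ?sqr_ge0// mulr_ge0 ?sqr_ge0// subr_ge0.
  lra.
pose x (t : R) : 'rV[R]_n := a + t *: z.
have xn0 t : x t != 0.
  apply/eqP => xt; apply: zn; have [t0|tn0] := eqVneq t 0.
    by move: xt; rewrite /x t0 scale0r addr0 => a0; rewrite a0 eqxx in an.
  exists (- t^-1); apply/eqP; rewrite scaleNr -addr_eq0 -(scalerK tn0 z) -scalerDr.
  by rewrite [t *: z + a]addrC -/(x t) xt scaler0.
have xD i (t : R) : is_derive t 1 (fun t => x t 0 i) (z 0 i).
  have -> : (fun t => x t 0 i) = cst (a 0 i) + (z 0 i \*: (id : R -> R)).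
    by apply/funext => u; rewrite !fctE /x !mxE /GRing.scale_fun/= /GRing.scale/= mulrC.
  by apply: is_derive_eq; rewrite add0r /GRing.scale/= mulr1.
pose k (t : R) : R := \sum_(i < n) psgn (p - 2) (x t 0 i) * z 0 i.
pose k' (t : R) : R := \sum_(i < n) `|x t 0 i| `^ (p - 2) * z 0 i ^+ 2.
have gD (t : R) : is_derive t 1 (S \o x) (p * k t).
  have -> : S \o x = \sum_(i < n) ((fun y => `|y| `^ p) \o (fun t => x t 0 i)).
    by apply/funext => u; rewrite fct_sumE.
  rewrite mulr_sumr; apply: is_derive_sum => i.
  have D1 := normr_powR_derive (x t 0 i) p2; have D2 := xD i t.
  by apply: is_derive_eq; rewrite mulrA.
have kD (t : R) : is_derive t 1 k ((p - 1) * k' t).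
  have -> : k = \sum_(i < n) (z 0 i \*: (psgn (p - 2) \o (fun t => x t 0 i))).
    apply/funext => u; rewrite fct_sumE; apply: eq_bigr => i _.
    by rewrite mulrC.
  rewrite mulr_sumr; apply: is_derive_sum => i.
  have p20 : 0 <= p - 2 by rewrite subr_ge0.
  have D1 := psgn_derive (x t 0 i) p20; have D2 := xD i t.
  by apply: is_derive_eq; rewrite /GRing.scale/=; ring.
have gpD (r t : R) : is_derive t 1 (fun t => S (x t) `^ r) (r * S (x t) `^ (r - 1) * (p * k t)).
  have D1 := is_derive1_powR r (Sgt0 _ (xn0 t)); have D2 := gD t.
  exact: (@is_derive1_comp _ _ (S \o x)).
pose f (t : R) : R := S (x t) `^ (2 / p).
pose df (t : R) : R := 2 * S (x t) `^ (2 / p - 1) * k t.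
have fD (t : R) : is_derive t 1 f (df t).
  have D := gpD (2 / p) t; apply: is_derive_eq; rewrite /df; field.
  by rewrite gt_eqF.
pose ddf (t : R) : R := 2 * (S (x t) `^ (2 / p - 1) * ((p - 1) * k' t) +
   k t * ((2 / p - 1) * S (x t) `^ (2 / p - 1 - 1) * (p * k t))).
have dfD (t : R) : is_derive t 1 df (ddf t).
  have -> : df = 2 \*: ((fun t => S (x t) `^ (2 / p - 1)) * k).
    by apply/funext => u; rewrite /df /GRing.scale_fun/= !fctE /GRing.scale/= mulrA.
  have D1 := gpD (2 / p - 1) t; have D2 := kD t.
  by apply: is_derive_eq; rewrite /GRing.scale/=.
have p1r : 2 / p <= 1 by rewrite ler_pdivrMr// mul1r.
have ddf_le t : ddf t <= 2 * (p - 1) * pnorm p z ^+ 2.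
  rewrite /ddf -[leRHS]mulrA ler_pM2l//.
  (* The discarded term carries the factor 2/p - 1 <= 0. What remains is Hoelder with weight 2/p,
     whose power of S cancels the one in front. *)
  apply: (@le_trans _ _ (S (x t) `^ (2 / p - 1) * ((p - 1) * k' t))).
    rewrite gerDl.
    have -> : k t * ((2 / p - 1) * S (x t) `^ (2 / p - 1 - 1) * (p * k t)) =
        - (1 - 2 / p) * (p * k t ^+ 2 * S (x t) `^ (2 / p - 1 - 1)) by ring.
    rewrite mulNr oppr_le0 mulr_ge0 ?subr_ge0// mulr_ge0 ?powR_ge0//.
    by rewrite mulr_ge0 ?sqr_ge0// ltW.
  rewrite mulrCA ler_wpM2l//; first by lra.
  have H : k' t <= S (x t) `^ (1 - 2 / p) * pnorm p z ^+ 2.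
    rewrite SE.
    have := @hoelder_sum R 'I_n (fun i => `|x t 0 i| `^ p) (fun i => `|z 0 i| `^ p) (2 / p).
    move=> /(_ (fun=> powR_ge0 _ _) (fun=> powR_ge0 _ _)).
    rewrite p1r divr_ge0 ?(ltW p0)// => /(_ isT); apply: le_trans.
    apply: ler_sum => i _; rewrite -!powRrM.
    have -> : p * (1 - 2 / p) = p - 2 by field; rewrite gt_eqF.
    have -> : p * (2 / p) = 2%:R by field; rewrite gt_eqF.
    by rewrite powR_mulrn// real_normK ?num_real.
  apply: (le_trans (ler_wpM2l (powR_ge0 _ _) H)).
  rewrite mulrA -powRD; last by apply/implyP => _; rewrite gt_eqF// Sgt0.
  by rewrite addrA subrK subrr powRr0 mul1r.
have := @taylor1_ub R f df (2 * (p - 1) * pnorm p z ^+ 2) (fun t _ => fD t).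
have -> : f 1 = pnorm p (a + z) ^+ 2 by rewrite /f /x scale1r SE.
have -> : f 0 = pnorm p a ^+ 2 by rewrite /f /x scale0r addr0 SE.
have df0 : df 0 = dotv j z.
  rewrite /df /x scale0r addr0 /k mulr_sumr; apply: eq_bigr => i _.
  by rewrite /x scale0r addr0 mxE mulrA.
rewrite df0; have -> (L : R) : 2 * (p - 1) * L / 2 = (p - 1) * L by field.
apply.
move=> t /andP[t0 t1]; have [->|tn0] := eqVneq t 0; first by rewrite df0 subrr mulr0.
(* The bound on [ddf] becomes the linear bound on the increment of [df] needed by [taylor1_ub], by
   the mean value theorem on [0, t] rescaled to [0, 1]. *)
have dtD (s : R) : 0 <= s <= 1 -> is_derive s 1 (df \o (t \*: id)) (t * ddf (t * s)).
  move=> _; have D1 := dfD (t * s).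
  have D2 : is_derive s 1 (t \*: (id : R -> R)) t.
    by apply: is_derive_eq; rewrite /GRing.scale/= mulr1.
  have := @is_derive1_comp _ df (t \*: id) s _ _ D1 D2.
  by rewrite mulrC.
have [c _] := mvt01 dtD.
rewrite -df0 /= /GRing.scale_fun/= /GRing.scale/= mulr0 mulr1 => ->.
by rewrite mulrC ler_wpM2r.
Qed.

End Smoothness.

(** * Continuity and gradients along lines *)

Section Continuity.
Context {R : realType} {n : nat}.
Implicit Types (x y : 'rV[R]_n) (p : R).

Lemma lipschitz_continuous (f : 'rV[R]_n -> R) (K : R) :
  (forall x y, `|f x - f y| <= K * `|x - y|) -> continuous f.
Proof.
move=> fK x; apply/(@cvgrPdist_lt R R 'rV[R]_n (nbhs x) _ f (f x)) => e e0; near=> y.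
have K1 : 0 < `|K| + 1 by rewrite ltr_wpDl.
apply: (le_lt_trans (fK _ _)).
apply: (@le_lt_trans _ _ ((`|K| + 1) * `|x - y|)).
  by rewrite ler_wpM2r// (le_trans (ler_norm _))// lerDl.
rewrite -ltr_pdivlMl// mulrC.
near: y; apply: cvgr_dist_lt => //; last exact: divr_gt0.
Unshelve. all: by end_near. Qed.

Lemma ler_dist_pnorm p x y : 1 <= p ->
  `|pnorm p x - pnorm p y| <= pnorm p (x - y).
Proof.
move=> p1; rewrite ler_norml; apply/andP; split.
  by rewrite lerNl opprB lerBlDr pnormBC; have := pnormD (y - x) x p1; rewrite subrK.
by rewrite lerBlDr; have := pnormD (x - y) y p1; rewrite subrK.
Qed.

Lemma pnorm_continuous p : 1 <= p -> continuous (pnorm p : 'rV[R]_n -> R).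
Proof.
move=> p1; apply: (@lipschitz_continuous _ n%:R) => x y.
by rewrite (le_trans (ler_dist_pnorm _ _ p1))// pnorm_le_norm.
Qed.

Lemma dotv_continuous w : continuous (dotv w : 'rV[R]_n -> R).
Proof.
apply: (@lipschitz_continuous _ (pnorm 2 w * n%:R)) => x y.
rewrite -dotvBr (le_trans (dotv_cauchy _ _))// -mulrA ler_wpM2l ?pnorm_ge0//.
by rewrite pnorm_le_norm// ler1n.
Qed.

Lemma convex_segment (X : set 'rV[R]_n) x y (t : R) :
  convex_set (X : set (convex_lmodType 'rV[R]_n)) -> X x -> X y -> 0 <= t <= 1 ->
  X (x + t *: (y - x)).
Proof.
move=> cX Xx Xy /andP[t0 t1].
have := cX y x (Itv01 t0 t1); rewrite !inE => /(_ Xy Xx).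
rewrite /conv/= /unstable.onem; congr (X _).
by rewrite scalerBl scale1r scalerBr addrCA addrA.
Qed.

End Continuity.

Section Gradients.
Context {R : realType} {n : nat}.
Implicit Types (f : 'rV[R]_n -> R) (x y v : 'rV[R]_n).

Lemma derive_grad f x v : differentiable f x -> 'D_v f x = dotv (grad f x) v.
Proof.
move=> df; rewrite deriveE// {1}(row_sum_delta v) linear_sum/=.
by apply: eq_bigr => i _; rewrite linearZ/= mxE deriveE// mulrC.
Qed.

Lemma line_derive f x v (t : R) : differentiable f (x + t *: v) ->
  is_derive t 1 (fun t => f (x + t *: v)) (dotv (grad f (x + t *: v)) v).
Proof.
move=> df; have E : (fun h : R => h^-1 *: (((fun t => f (x + t *: v)) \o shift t) (h *: 1) - f (x + t *: v)))
    = (fun h : R => h^-1 *: ((f \o shift (x + t *: v)) (h *: v) - f (x + t *: v))).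
  apply/funext => h /=; rewrite [h *: 1]mulr1; congr (_ *: (f _ - _)).
  by rewrite scalerDl addrCA.
apply: DeriveDef; rewrite ?/derivable /derive E.
  exact: diff_derivable.
exact: derive_grad.
Qed.

Lemma line_continuous x v : continuous (fun t : R => x + t *: v).
Proof.
by move=> t; apply: cvgD; [exact: cvg_cst|exact: scalel_continuous].
Qed.

Lemma derive_ge (f : R -> R) (df c : R) : is_derive (0 : R) 1 f df ->
  (forall t, 0 < t <= 1 -> c * t <= f t - f 0) -> c <= df.
Proof.
move=> [fd <-] fc.
have cv : (fun h : R => h^-1 *: (f (h *: 1 + 0) - f 0)) @ 0^' --> ('D_1 f 0 : R) by exact: fd.
apply: (cvgr_to_ge (cvg_dnbhs_at_right cv)).
near=> h.
have h0 : 0 < h by near: h; exact: nbhs_right_gt.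
have h1 : h <= 1 by near: h; exact: nbhs_right_le.
rewrite addr0 [h *: 1]mulr1 [_ *: _]mulrC ler_pdivlMr// fc// h0//.
Unshelve. all: by end_near. Qed.

(** In the direction g of the gradient itself the derivative is |g|^2, while the difference
    quotients are at most M |g|; openness of [O] keeps the points x + h g inside for small h. *)
Lemma grad_lipschitz_le (O : set 'rV[R]_n) f x (M : R) : open O -> O x ->
  differentiable f x -> 0 <= M ->
  (forall x y, O x -> O y -> `|f x - f y| <= M * pnorm 2 (x - y)) ->
  pnorm 2 (grad f x) <= M.
Proof.
move=> oO Ox df M0 fM; set g := grad f x.
have [->//|gn0] := eqVneq (pnorm 2 g) 0.
have gp : 0 < pnorm 2 g by rewrite lt_def gn0 pnorm_ge0.
rewrite -(ler_pM2r gp) -expr2 -dotvv.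
rewrite -(derive_grad g df).
have cv : (fun h : R => h^-1 *: (f (h *: g + x) - f x)) @ 0^' --> ('D_g f x : R).
  exact: (diff_derivable df).
apply: (cvgr_to_le cv).
have O0 : \forall h \near (0 : R), O (h *: g + x).
  have Ox0 : nbhs (x + 0 *: g) O by rewrite scale0r addr0; exact: open_nbhs_nbhs.
  by near=> h; rewrite addrC; near: h; exact: (@line_continuous x g 0 O Ox0).
near=> h.
have h0 : h != 0 by near: h; exact: nbhs_dnbhs_neq.
have Oh : O (h *: g + x) by near: h; exact: nbhs_dnbhs.
rewrite (le_trans (ler_norm _))// normrM normfV mulrC ler_pdivrMr ?normr_gt0//.
rewrite (le_trans (fM _ _ Oh Ox))// addrK pnormZ// [_ * pnorm _ _]mulrC mulrA //.
Unshelve. all: by end_near. Qed.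

End Gradients.

(** * Optimality of the mirror step and projection on the tangent cone *)

Section Argmin.
Context {R : realType} {n : nat}.
Implicit Types (X : set 'rV[R]_n) (h : 'rV[R]_n -> \bar R) (x y w : 'rV[R]_n).

(** Moving from [xp] towards [y], convexity bounds the increment of [h] linearly in t, so only [v]
    is differentiated. The conclusion says that the vector is a subgradient at [xp] of [h]
    restricted to [X]. *)
Lemma argmin_variational X h (v : 'rV[R]_n -> R) g xk xp (eta : R) :
  0 < eta -> convex_set (X : set (convex_lmodType 'rV[R]_n)) -> convex_ext h ->
  (forall x, X x -> h x \is a fin_num) -> differentiable v xp ->
  is_argmin X (fun y => ((dotv g y)%:E + h y + (eta^-1 * bregman v xk y)%:E)%E) xp ->
  forall y, X y ->
    dotv (- (g + eta^-1 *: (grad v xp - grad v xk))) (y - xp) <= fine (h y) - fine (h xp).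
Proof.
move=> eta0 cX ch hfin dv [Xp xpmin] y Xy.
pose z t : 'rV[R]_n := xp + t *: (y - xp).
pose phi t := eta^-1 * v (z t).
have D : is_derive (0 : R) 1 phi (eta^-1 * dotv (grad v xp) (y - xp)).
  have D0 : is_derive (0 : R) 1 (fun t => v (z t)) (dotv (grad v xp) (y - xp)).
    have := @line_derive _ _ v xp (y - xp) 0; rewrite scale0r addr0; exact.
  exact: (@is_deriveZ _ _ _ _ eta^-1).
(* The slope forced on [phi]: minimality of [xp] against [z t], with [h (z t)] replaced by its
   convex bound, gives [phi t - phi 0 >= c * t]. *)
set c := - (fine (h y) - fine (h xp) + dotv g (y - xp)
            - eta^-1 * dotv (grad v xk) (y - xp)).
have : c <= eta^-1 * dotv (grad v xp) (y - xp).
  apply: (derive_ge D) => t /andP[t0 t1].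
  have t01 : 0 <= t <= 1 by rewrite ltW.
  have Xz : X (z t) by exact: convex_segment.
  have zE : z t = t *: y + (1 - t) *: xp.
    by rewrite /z scalerBr scalerBl scale1r addrCA addrA.
  have := ch y xp t t01; rewrite -zE.
  have := xpmin _ Xz.
  rewrite -(fineK (hfin _ Xy)) -(fineK (hfin _ Xp)) -(fineK (hfin _ Xz)).
  rewrite -!EFinM -!EFinD !lee_fin /bregman /phi /z scale0r addr0 -/(z t).
  have -> : dotv g (z t) = dotv g xp + t * dotv g (y - xp) by rewrite [LHS]dotvDr dotvZr.
  have -> : dotv (grad v xk) (z t - xk) =
     dotv (grad v xk) (xp - xk) + t * dotv (grad v xk) (y - xp).
    by rewrite [z t - xk]addrAC [LHS]dotvDr dotvZr.
  rewrite /c; move: (fine _) (fine _) (fine _) (dotv _ _) (dotv _ _) (dotv _ _)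
    (dotv _ _) (v _) (v _) (v _) (eta^-1) => *.
  lra.
rewrite /c dotvNl dotvDl dotvZl dotvBl.
move: (fine _) (fine _) (dotv _ _) (dotv _ _) (dotv _ _) => *.
lra.
Qed.

(** If a were positive, r = a / (a + b) would lie in [0, 1] and give 2 (a + b) <= b. This turns
    minimality of a squared distance into its first-order condition. *)
Lemma le0_of_quadratic (a b : R) : 0 <= b ->
  (forall r, 0 <= r <= 1 -> 2 * r * a <= r ^+ 2 * b) -> a <= 0.
Proof.
move=> b0 H; rewrite leNgt; apply/negP => a0.
have ab : 0 < a + b by rewrite ltr_pwDl.
have r01 : 0 <= a / (a + b) <= 1.
  by rewrite divr_ge0 ?(ltW a0) ?(ltW ab)//= ler_pdivrMr// mul1r lerDl.
have rp : 0 < a / (a + b) by rewrite divr_gt0.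
have := H _ r01; rewrite mulrAC mulrC expr2 -[leRHS]mulrA ler_pM2l//.
rewrite mulrAC ler_pdivlMr//; apply/negP; rewrite -ltNge; nra.
Qed.

Lemma pnorm2_sqrB x y :
  pnorm 2 (x - y) ^+ 2 = pnorm 2 x ^+ 2 - 2 * dotv x y + pnorm 2 y ^+ 2.
Proof.
by rewrite -!dotvv dotvBl !dotvBr (dotvC y x); ring.
Qed.

Lemma closure_stable (C : set 'rV[R]_n) (phi : 'rV[R]_n -> 'rV[R]_n) z :
  continuous phi -> (forall x, C x -> C (phi x)) -> closure C z -> closure C (phi z).
Proof.
move=> cphi Cphi Cz B /cphi /Cz [x [Cx Bx]].
by exists (phi x); split => //; exact: Cphi.
Qed.

(* Project w on the closed tangent cone of X at xp: the residual is normal and,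
   by the hypothesis on w, the projection has norm at most M. *)
Lemma normal_cone_approx X xp w (M : R) :
  convex_set (X : set (convex_lmodType 'rV[R]_n)) -> X xp -> 0 <= M ->
  (forall y, X y -> dotv w (y - xp) <= M * pnorm 2 (y - xp)) ->
  exists2 zeta, normal_cone X xp zeta & pnorm 2 (w - zeta) <= M.
Proof.
move=> cX Xp M0 wM.
(* The cone generated by X - xp; its closure [T] is the tangent cone. *)
pose C : set 'rV[R]_n := [set z | exists s y, [/\ 0 <= s, X y & z = s *: (y - xp)]].
pose T := closure C.
have C0 : C 0 by exists 0, xp; split => //; rewrite scale0r.
have CZ z r : 0 <= r -> C z -> C (r *: z).
  by move=> r0 [s [y [s0 Xy ->]]]; exists (r * s), y; rewrite scalerA mulr_ge0.
have CD y r z : X y -> 0 <= r -> C z -> C (z + r *: (y - xp)).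
  move=> Xy r0 [s [y' [s0 Xy' ->]]].
  have [sr0|srn0] := eqVneq (s + r) 0.
    have [-> ->] : s = 0 /\ r = 0 by split; lra.
    by rewrite !scale0r addr0.
  have srp : 0 < s + r by rewrite lt_def srn0 addr_ge0.
  (* The convex combination of [y'] and [y] with weights s/(s+r) and r/(s+r): convexity of [X] is
     what makes [C] stable under adding a generator. *)
  exists (s + r), (y' + (r / (s + r)) *: (y - y')); split; rewrite ?addr_ge0//.
    apply: convex_segment => //.
    by rewrite divr_ge0 ?addr_ge0//= ler_pdivrMr// mul1r lerDr.
  have -> : y' + (r / (s + r)) *: (y - y') - xp = (y' - xp) + (r / (s + r)) *: (y - y').
    by rewrite addrAC.
  rewrite [RHS]scalerDr scalerA mulrCA divff// mulr1 scalerDl -addrA -scalerDr.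
  by congr (_ + _ *: _); rewrite [RHS]addrC subrKA.
have T0 : T 0 by exact: subset_closure.
have TZ z r : 0 <= r -> T z -> T (r *: z).
  move=> r0; apply: (closure_stable (phi := fun z => r *: z)); last by move=> x; exact: CZ.
  exact: scaler_continuous.
have TD y r z : X y -> 0 <= r -> T z -> T (z + r *: (y - xp)).
  move=> Xy r0; apply: (closure_stable (phi := fun z => z + r *: (y - xp))).
    by move=> x; apply: (@continuousD _ _ _ id (cst _) x); [exact: cvg_id|exact: cst_continuous].
  by move=> x; exact: CD.
have Tw z : T z -> dotv w z <= M * pnorm 2 z.
  have cl : closed [set z | dotv w z - M * pnorm 2 z <= 0].
    apply: (@closed_comp _ _ (fun z => dotv w z - M * pnorm 2 z) [set r | r <= 0]).
      move=> x _; apply: (@continuousB _ _ _ (dotv w) (fun z => M * pnorm 2 z)).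
        exact: dotv_continuous.
      apply: (@continuousM _ _ (cst M) (pnorm 2)); first exact: cst_continuous.
      by apply: pnorm_continuous; rewrite ler1n.
    exact: closed_le.
  move=> Tz; rewrite -subr_le0.
  apply: cl; apply: closureS Tz => _ [s [y [s0 Xy ->]]] /=.
  rewrite dotvZr pnormZ// ger0_norm// subr_le0 mulrCA ler_wpM2l//.
  exact: wM.
(* A compact truncation for the existence of a nearest point: beyond radius 2 |w| a point is no
   closer to [w] than 0, which lies in [T]. *)
pose A := T `&` [set z | pnorm 2 z <= 2 * pnorm 2 w].
have A0 : A 0 by split => //=; rewrite pnorm0// mulr_ge0 ?pnorm_ge0.
have cA : compact A.
  apply: bounded_closed_compact.
    exists (2 * pnorm 2 w); split; first exact: num_real.
    move=> K K2 z [_ /= zw]; rewrite (le_trans (@norm_le_pnorm _ _ 2 _ _))//.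
    by rewrite (le_trans zw)// ltW.
  apply: closedI; first exact: closed_closure.
  apply: (@closed_comp _ _ (pnorm 2) [set r | r <= 2 * pnorm 2 w]).
    by move=> x _; apply: pnorm_continuous; rewrite ler1n.
  exact: closed_le.
have cf : {within A, continuous (fun t => pnorm 2 (w - t))}.
  apply: continuous_subspaceT => x.
  apply: (@continuous_comp 'rV[R]_n 'rV[R]_n R (fun t => w - t) (pnorm 2) x).
    by apply: (@continuousB _ _ _ (cst w) id); [exact: cst_continuous|exact: cvg_id].
  by apply: pnorm_continuous; rewrite ler1n.
have [t0 /set_mem[Tt0 _] tmin] := EVT_min_rV (ex_intro _ 0 A0) cA cf.
have {}tmin t : T t -> pnorm 2 (w - t0) <= pnorm 2 (w - t).
  move=> Tt; case/orP: (le_total (pnorm 2 t) (2 * pnorm 2 w)) => tw.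
    by apply: (tmin t); apply: mem_set; split.
  apply: (le_trans (tmin 0 (mem_set A0))).
  rewrite subr0; have := @pnormD R n 2 (t - w) w; rewrite subrK ler1n => /(_ isT).
  rewrite pnormBC => H; move: (le_trans tw H).
  by rewrite mulr_natl mulr2n lerD2r.
have opt d : (forall r, 0 <= r <= 1 -> T (t0 + r *: d)) -> dotv (w - t0) d <= 0.
  move=> Td; apply: (@le0_of_quadratic _ (dotv d d)).
    by rewrite dotvv sqr_ge0.
  move=> r r01; have := @lerXn2r R 2 _ _ (pnorm_ge0 _ _) (pnorm_ge0 _ _) (tmin _ (Td _ r01)).
  have -> : w - (t0 + r *: d) = (w - t0) - r *: d by rewrite opprD addrA.
  rewrite (pnorm2_sqrB (w - t0)) dotvZr -!dotvv dotvZl dotvZr.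
  by move: (dotv _ _) (dotv _ _) (dotv _ _) => *; lra.
exists (w - t0).
  move=> y Xy; apply: opt => r /andP[r0 _]; exact: TD.
rewrite subKr.
(* Shrinking [t0] stays in the cone, so <w - t0, t0> >= 0. Hence |t0|^2 <= <w, t0> <= M |t0|, which
   bounds the projection by M. *)
have H : dotv (w - t0) (- t0) <= 0.
  apply: opt => r /andP[r0 r1]; rewrite scalerN -{1}(scale1r t0) -scalerBl.
  by apply: TZ; rewrite ?subr_ge0.
have := Tw _ Tt0; rewrite -{1}(subrK t0 w) dotvDl dotvv => H2.
have [->|tn0] := eqVneq (pnorm 2 t0) 0; first by [].
have tp : 0 < pnorm 2 t0 by rewrite lt_def tn0 pnorm_ge0.
rewrite -(ler_pM2r tp) -expr2; move: H; rewrite dotvNr oppr_le0; move: H2.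
by move: (dotv _ _) => *; lra.
Qed.

End Argmin.

(** * Pathwise descent and feasibility *)

Section SmoothOn.
Context {R : realType} {n : nat} (X : set 'rV[R]_n)
  (cX : convex_set (X : set (convex_lmodType 'rV[R]_n))).
Context (g : 'rV[R]_n -> R) (dg : forall x, X x -> differentiable g x).

Lemma smooth_on_bound (L : R) x y : X x -> X y ->
  (forall x y, X x -> X y -> pnorm 2 (grad g x - grad g y) <= L * pnorm 2 (x - y)) ->
  `|g y - g x - dotv (grad g x) (y - x)| <= L / 2 * pnorm 2 (y - x) ^+ 2.
Proof.
move=> Xx Xy gL.
have Xs t : 0 <= t <= 1 -> X (x + t *: (y - x)) by exact: convex_segment.
have := @taylor1_bound R (fun t => g (x + t *: (y - x)))
  (fun t => dotv (grad g (x + t *: (y - x))) (y - x)) (L * pnorm 2 (y - x) ^+ 2).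
have -> : x + 1 *: (y - x) = y by rewrite scale1r subrKC.
rewrite scale0r addr0 mulrAC; apply.
  by move=> t t01; apply/line_derive/dg/Xs.
move=> t t01; have /andP[t0 _] := t01.
rewrite -dotvBl (le_trans (dotv_cauchy _ _))//.
have := gL _ _ (Xs _ t01) Xx.
have -> : x + t *: (y - x) - x = t *: (y - x) by rewrite addrAC subrr add0r.
rewrite pnormZ// ger0_norm// => H.
apply: (le_trans (ler_wpM2r (pnorm_ge0 _ _) H)).
by rewrite le_eqVlt; apply/orP; left; apply/eqP; ring.
Qed.

Lemma lipschitz_on_bound (M : R) x y : X x -> X y ->
  (forall x, X x -> pnorm 2 (grad g x) <= M) ->
  `|g y - g x| <= M * pnorm 2 (y - x).
Proof.
move=> Xx Xy gM.
have Xs t : 0 <= t <= 1 -> X (x + t *: (y - x)) by exact: convex_segment.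
have [t t01|t t01] := @mvt01 R (fun t => g (x + t *: (y - x)))
  (fun t => dotv (grad g (x + t *: (y - x))) (y - x)).
  exact/line_derive/dg/Xs.
rewrite scale1r subrKC scale0r addr0 => ->.
rewrite (le_trans (dotv_cauchy _ _))// ler_wpM2r ?pnorm_ge0//.
exact/gM/Xs.
Qed.

End SmoothOn.

Lemma lpdist_le (R : realType) n (p : R) (a b : 'rV[R]_n) B :
  B b -> lpdist p a B <= pnorm p (a - b).
Proof.
move=> Bb; rewrite /lpdist lpnormE; apply: ge_inf; last by exists b.
by exists 0 => _ [y _ <-]; exact: pnorm_ge0.
Qed.

(** Weighted Cauchy-Schwarz: the reciprocals 1/8, 1/8, 1/8, 5/16, 5/32, 5/32 of the coefficients sum
    to 1. The squares listed below are the pairwise AM-GM inequalities for these weights. *)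
Lemma sqr_sum6_le (R : realType) (S x1 x2 x3 x4 x5 x6 : R) :
  0 <= S -> S <= x1 + x2 + x3 + x4 + x5 + x6 ->
  S ^+ 2 <= 8 * (x1 ^+ 2 + x2 ^+ 2 + x3 ^+ 2) + 16 / 5 * x4 ^+ 2
            + 32 / 5 * (x5 ^+ 2 + x6 ^+ 2).
Proof.
move=> S0 SE; have E0 := le_trans S0 SE.
apply: (@le_trans _ _ ((x1 + x2 + x3 + x4 + x5 + x6) ^+ 2)).
  by rewrite lerXn2r// nnegrE.
have H (w1 w2 a b : R) : 0 <= (w1 * a - w2 * b) ^+ 2 by exact: sqr_ge0.
have h12 := H 1 1 x1 x2; have h13 := H 1 1 x1 x3; have h23 := H 1 1 x2 x3.
have h14 := H 5 2 x1 x4; have h24 := H 5 2 x2 x4; have h34 := H 5 2 x3 x4.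
have h15 := H 5 4 x1 x5; have h25 := H 5 4 x2 x5; have h35 := H 5 4 x3 x5.
have h16 := H 5 4 x1 x6; have h26 := H 5 4 x2 x6; have h36 := H 5 4 x3 x6.
have h45 := H 1 2 x4 x5; have h46 := H 1 2 x4 x6; have h56 := H 1 1 x5 x6.
lra.
Qed.

Section Step.
Context {R : realType} {d m : nat} (p q : R) (hp : 2 <= p) (hpq : p^-1 + q^-1 = 1).
Context (f : 'rV[R]_d -> R) (h : 'rV[R]_d -> \bar R) (c : 'rV[R]_d -> 'rV[R]_m)
  (X : set 'rV[R]_d) (v : 'rV[R]_d -> R).
Context (cX : convex_set (X : set (convex_lmodType 'rV[R]_d))).
Context (Lf Mf Mh Mbc Mc Lc Lv : R) (mu eta rho beta : R).
Context (hLf : 0 < Lf) (hMf : 0 < Mf) (hMh : 0 < Mh) (hMbc : 0 < Mbc) (hMc : 0 < Mc) (hLc : 0 < Lc).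
Context (hmu : 0 < mu) (heta : 0 < eta) (hrho : 0 < rho) (hbeta : 0 < beta).
Context (df : forall x, X x -> differentiable f x)
  (dc : forall i x, X x -> differentiable (comp_fun c i) x)
  (dv : forall x, differentiable v x).
Context (fL : forall x y, X x -> X y -> pnorm 2 (grad f x - grad f y) <= Lf * pnorm 2 (x - y))
  (fM : forall x, X x -> pnorm 2 (grad f x) <= Mf)
  (cb : forall (i : 'I_m) x, X x -> `|c x 0 i| <= Mbc)
  (cg : forall (i : 'I_m) x, X x -> pnorm 2 (grad (comp_fun c i) x) <= Mc)
  (csm : forall (i : 'I_m) x y, X x -> X y ->
     pnorm 2 (grad (comp_fun c i) x - grad (comp_fun c i) y) <= Lc * pnorm 2 (x - y))
  (hfin : forall x, X x -> h x \is a fin_num)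
  (hh : forall x y, X x -> X y -> fine (h y) - fine (h x) <= Mh * pnorm 2 (y - x))
  (ch : convex_ext h)
  (vsm : forall x y, X x -> X y -> pnorm p (grad v x - grad v y) <= Lv * pnorm q (x - y)).

Let Lmu : R := Lf + m%:R * (mu * Mc ^+ 2 + mu * Mbc * Lc + rho * Mbc * Lc).
Context (hetaL : eta * Lmu <= 1 / 2).

Let p0 : 0 < p. Proof. by apply: lt_le_trans hp. Qed.
Let q0 : 0 < q.
Proof.
have := hpq; have : p^-1 <= 2^-1 by rewrite lef_pV2// posrE.
by move=> pi qE; rewrite -invr_gt0; lra.
Qed.
Let q2 : q <= 2.
Proof.
have := hpq; have : p^-1 <= 2^-1 by rewrite lef_pV2// posrE.
by move=> pi qE; rewrite -lef_pV2 ?posrE//; lra.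
Qed.
Let p1 : 1 <= p. Proof. by apply: le_trans hp; rewrite ler1n. Qed.

Let pnorm_p2 x : pnorm p x <= pnorm 2 (x : 'rV[R]_d). Proof. exact: pnorm_le. Qed.
Let pnorm_2q x : pnorm 2 x <= pnorm q (x : 'rV[R]_d). Proof. exact: pnorm_le. Qed.

Let Psi (lam : 'rV[R]_m) x := f x + dotv lam (c x) + mu / 2 * pnorm 2 (c x) ^+ 2.

Let dPsi (lam : 'rV[R]_m) x := grad f x + gradT c x (lam + mu *: c x).

Lemma auglag_smooth (lam : 'rV[R]_m) x y : X x -> X y ->
  (forall i, `|lam 0 i| <= rho * Mbc) ->
  Psi lam y - Psi lam x <= dotv (dPsi lam x) (y - x) + Lmu / 2 * pnorm 2 (y - x) ^+ 2.
Proof.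
move=> Xx Xy lamb; set N := pnorm 2 (y - x).
have N0 : 0 <= N by exact: pnorm_ge0.
have fB := smooth_on_bound cX df Xx Xy fL.
have {fB} := le_trans (ler_norm _) fB; rewrite -/N.
have S i : lam 0 i * c y 0 i + mu / 2 * c y 0 i ^+ 2 - (lam 0 i * c x 0 i + mu / 2 * c x 0 i ^+ 2)
   <= dotv ((lam 0 i + mu * c x 0 i) *: grad (comp_fun c i) x) (y - x)
      + (mu * Mc ^+ 2 + mu * Mbc * Lc + rho * Mbc * Lc) / 2 * N ^+ 2.
  have := smooth_on_bound cX (dc i) Xx Xy (csm i).
  have := lipschitz_on_bound cX (dc i) Xx Xy (cg i).
  rewrite dotvZl -/N /comp_fun; have := cb i Xx; have := lamb i.
  move: (dotv _ _) (c y 0 i) (c x 0 i) (lam 0 i) => G cy cx l lb cxb Db Tb.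
  have lcb : `|l + mu * cx| <= (rho + mu) * Mbc.
    by rewrite mulrDl (le_trans (ler_normD _ _))// lerD// normrM gtr0_norm// ler_wpM2l// (ltW hmu).
  have sq : (cy - cx) ^+ 2 <= Mc ^+ 2 * N ^+ 2.
    by rewrite -exprMn -real_normK ?num_real// lerXn2r// nnegrE mulr_ge0// ltW.
  have cr : (l + mu * cx) * (cy - cx - G) <= (rho + mu) * Mbc * (Lc / 2 * N ^+ 2).
    by rewrite (le_trans (ler_norm _))// normrM ler_pM.
  (* Exact expansion of the quadratic in [cy] around [cx], with the linear model [G] of the
     increment separated from its error. *)
  have E : l * cy + mu / 2 * cy ^+ 2 - (l * cx + mu / 2 * cx ^+ 2) =
     (l + mu * cx) * G + (l + mu * cx) * (cy - cx - G) + mu / 2 * (cy - cx) ^+ 2.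
    by field.
  rewrite E -addrA lerD2l.
  have := ler_wpM2l (ltW hmu) sq; lra.
have := ler_sum (index_enum 'I_m) (fun i (_ : true) => S i).
rewrite [leRHS]big_split/= -dotv_suml sumr_const card_ord.
have -> : \sum_(i < m) (lam 0 i + mu * c x 0 i) *: grad (comp_fun c i) x
    = gradT c x (lam + mu *: c x).
  by apply: eq_bigr => i _; rewrite !mxE.
have -> : \sum_(i < m) (lam 0 i * c y 0 i + mu / 2 * c y 0 i ^+ 2
     - (lam 0 i * c x 0 i + mu / 2 * c x 0 i ^+ 2)) =
   dotv lam (c y) + mu / 2 * pnorm 2 (c y) ^+ 2
   - (dotv lam (c x) + mu / 2 * pnorm 2 (c x) ^+ 2).
  by rewrite !pnorm2_sqr sumrB !big_split/= -!mulr_sumr.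
rewrite /dPsi dotvDl -[_ *+ m]mulr_natl /Psi /Lmu.
lra.
Qed.

(** Product rule for each constraint: the weight at y times the change of the gradient, plus the
    change of the weight times the gradient at x. It is needed because the mirror step uses the
    gradient at x^k while (A6) is read at x^(k+1). *)
Lemma gradT_lipschitz (lam : 'rV[R]_m) x y : X x -> X y ->
  (forall i, `|lam 0 i| <= rho * Mbc) ->
  pnorm 2 (dPsi lam y - dPsi lam x) <= Lmu * pnorm 2 (y - x).
Proof.
move=> Xx Xy lamb; set N := pnorm 2 (y - x).
have N0 : 0 <= N by exact: pnorm_ge0.
have S i : pnorm 2 ((lam + mu *: c y) 0 i *: grad (comp_fun c i) y
      - (lam + mu *: c x) 0 i *: grad (comp_fun c i) x)
   <= (mu * Mc ^+ 2 + mu * Mbc * Lc + rho * Mbc * Lc) * N.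
  have := csm i Xy Xx; rewrite -/N.
  have := lipschitz_on_bound cX (dc i) Xx Xy (cg i).
  rewrite -/N !mxE /comp_fun; have := cb i Xy; have := cg i Xx; have := lamb i.
  rewrite /comp_fun.
  move: (grad _ y) (grad _ x) (c y 0 i) (c x 0 i) (lam 0 i) => gy gx cy cx l lb gxb cyb Db gb.
  have -> : (l + mu * cy) *: gy - (l + mu * cx) *: gx
    = (l + mu * cy) *: (gy - gx) + (mu * (cy - cx)) *: gx.
    rewrite scalerBr -addrA; congr (_ + _).
    by rewrite addrC -scalerBl -scaleNr; congr (_ *: _); ring.
  have lcb : `|l + mu * cy| <= (rho + mu) * Mbc.
    by rewrite mulrDl (le_trans (ler_normD _ _))// lerD// normrM gtr0_norm// ler_wpM2l// (ltW hmu).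
  have H1 : `|l + mu * cy| * pnorm 2 (gy - gx) <= (rho + mu) * Mbc * (Lc * N).
    by rewrite ler_pM// pnorm_ge0.
  have H2 : `|mu * (cy - cx)| * pnorm 2 gx <= mu * (Mc * N) * Mc.
    by rewrite normrM gtr0_norm// ler_pM ?pnorm_ge0 ?mulr_ge0 ?(ltW hmu)// ler_wpM2l// (ltW hmu).
  have := pnormD ((l + mu * cy) *: (gy - gx)) ((mu * (cy - cx)) *: gx) (ler1n R 2).
  rewrite !pnormZ//.
  by move: H1 H2; move: (pnorm _ _) (pnorm _ _) (pnorm _ _) (`|_|) (`|_|) => *; lra.
have -> : dPsi lam y - dPsi lam x = (grad f y - grad f x) +
    \sum_(i < m) ((lam + mu *: c y) 0 i *: grad (comp_fun c i) y
      - (lam + mu *: c x) 0 i *: grad (comp_fun c i) x).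
  by rewrite sumrB /dPsi opprD addrACA.
rewrite (le_trans (pnormD _ _ _)) ?ler1n// /Lmu [leRHS]mulrDl lerD ?fL//.
rewrite (le_trans (pnorm_sum _ _ _ _)) ?ler1n//.
rewrite (le_trans (ler_sum _ (fun i _ => S i)))//.
by rewrite sumr_const card_ord -[_ *+ m]mulr_natl mulrA.
Qed.

Let step_g s lam xk : 'rV[R]_d := s + gradT c xk (lam + mu *: c xk).

(** The variational inequality is tested at [xk]. In units of D^2 / eta, strong convexity of [v]
    gains 1, smoothness costs 1/4 as eta Lmu <= 1/2, and Young's inequality on the gradient error
    costs 1/4, which leaves the 1/2 of the statement. *)
Lemma step_descent (lam : 'rV[R]_m) s xk xp : X xk ->
  (forall i, `|lam 0 i| <= rho * Mbc) ->
  is_argmin X (fun y => ((dotv (step_g s lam xk) y)%:E + h y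
    + (eta^-1 * bregman v xk y)%:E)%E) xp ->
  (forall x y, pnorm q (x - y) ^+ 2 <= dotv (x - y) (grad v x - grad v y)) ->
  Psi lam xp + fine (h xp) + pnorm q (xp - xk) ^+ 2 / (2 * eta)
   <= Psi lam xk + fine (h xk) + eta * pnorm p (s - grad f xk) ^+ 2.
Proof.
move=> Xk lamb am vmon; have Xp := am.1.
have VI := argmin_variational heta cX ch hfin (dv xp) am Xk.
have Sm := auglag_smooth Xk Xp lamb.
have M := vmon xp xk.
have HE : - dotv (s - grad f xk) (xp - xk) <= pnorm p (s - grad f xk) * pnorm q (xp - xk).
  by rewrite -dotvNl -(pnormN p) dotv_hoelder.
have N2 : pnorm 2 (xp - xk) ^+ 2 <= pnorm q (xp - xk) ^+ 2.
  by rewrite lerXn2r ?nnegrE ?pnorm_ge0.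
move: VI Sm M HE N2.
rewrite -(opprB xp xk) dotvNr -dotvNl opprK /step_g /dPsi (dotvC (xp - xk)).
rewrite !dotvDl dotvZl !dotvDl !dotvNl.
move: (pnorm_ge0 p (s - grad f xk)) (pnorm_ge0 q (xp - xk)).
move: (pnorm p _) (pnorm q _) (pnorm 2 _) (dotv s _) (dotv (gradT _ _ _) _)
  (dotv (grad f xk) _) (fine _) (fine _) (Psi _ _) (Psi _ _).
rewrite -dotvBl; move: (dotv _ _) => V e D N a b f1 h1 h2 P1 P2 e0 D0 VI Sm VD HE ND.
have ie : 0 < eta^-1 by rewrite invr_gt0.
have LN : Lmu / 2 * N ^+ 2 <= eta^-1 / 4 * D ^+ 2.
  have L0 : 0 <= Lmu.
    rewrite /Lmu addr_ge0 ?(ltW hLf)// mulr_ge0// !addr_ge0// !mulr_ge0 ?(ltW hmu) ?(ltW hMc) ?(ltW hLc) ?(ltW hMbc) ?(ltW hrho)//.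
  have L1 : Lmu / 2 <= eta^-1 / 4.
    have := ler_wpM2l (ltW ie) hetaL; rewrite mulKf ?gt_eqF//; lra.
  by rewrite ler_pM ?sqr_ge0// divr_ge0.
have VV : eta^-1 * D ^+ 2 <= eta^-1 * V by rewrite ler_wpM2l// ltW.
have eD : e * D <= eta * e ^+ 2 + eta^-1 / 4 * D ^+ 2.
  have := sqr_ge0 (eta * e - D / 2) => H.
  have := mulr_ge0 (ltW ie) H.
  have -> : eta^-1 * (eta * e - D / 2) ^+ 2 = eta * e ^+ 2 + eta^-1 / 4 * D ^+ 2 - e * D.
    by field; rewrite gt_eqF.
  by rewrite subr_ge0.
rewrite invfM; lra.
Qed.

(** The optimality residual at [xp], after projection of the part due to [h], expresses mu times
    (grad c^T c + a normal vector) through quantities that are bounded or small. *)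
Lemma step_feasibility (lam : 'rV[R]_m) s xk xp : X xk ->
  (forall i, `|lam 0 i| <= rho * Mbc) ->
  is_argmin X (fun y => ((dotv (step_g s lam xk) y)%:E + h y
    + (eta^-1 * bregman v xk y)%:E)%E) xp ->
  beta * pnorm p (c xp) <= lpdist p (gradT c xp (c xp)) [set - g | g in normal_cone X xp] ->
  beta ^+ 2 * mu ^+ 2 * pnorm p (c xp) ^+ 2 <=
    8 * (Mf ^+ 2 + Mh ^+ 2 + m%:R ^+ 2 * rho ^+ 2 * Mbc ^+ 2 * Mc ^+ 2)
    + 16 / 5 * pnorm p (s - grad f xk) ^+ 2
    + 32 / 5 * (1 / 4 + Lv ^+ 2) * (pnorm q (xp - xk) ^+ 2 / eta ^+ 2).
Proof.
move=> Xk lamb am reg; have Xp := am.1.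
have VI := argmin_variational heta cX ch hfin (dv xp) am.
set w := - _ in VI.
have [z Nz wz] : exists2 z, normal_cone X xp z & pnorm 2 (w - z) <= Mh.
  apply: normal_cone_approx => //; first exact: ltW.
  by move=> y Xy; rewrite (le_trans (VI y Xy))// hh.
(* The normal cone is stable under the factor 1/mu > 0, so -(z / mu) is a competitor in the distance
   of (A6). *)
have reg2 : beta * pnorm p (c xp) <= pnorm p (gradT c xp (c xp) + mu^-1 *: z).
  apply: (le_trans reg); rewrite -[X in pnorm p (_ + X)]opprK.
  apply: lpdist_le; exists (mu^-1 *: z) => // y Xy.
  by rewrite dotvZl mulr_ge0_le0 ?invr_ge0 ?(ltW hmu)//; exact: Nz.
set e := pnorm p (s - _); set D := pnorm q _.
have e0 : 0 <= e by exact: pnorm_ge0.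
have D0 : 0 <= D by exact: pnorm_ge0.
have gl : pnorm 2 (gradT c xp lam) <= m%:R * (rho * Mbc * Mc).
  have S i : pnorm 2 (lam 0 i *: grad (comp_fun c i) xp) <= rho * Mbc * Mc.
    by rewrite pnormZ// ler_pM ?pnorm_ge0// cg.
  rewrite /gradT (le_trans (pnorm_sum _ _ _ _)) ?ler1n//.
  by rewrite (le_trans (ler_sum _ (fun i _ => S i)))// sumr_const card_ord mulr_natl.
(* Six pieces: change of the smooth gradient, grad f, multiplier term, gradient error, mirror term,
   projection of the [h] part. Their bounds are the arguments of [sqr_sum6_le]. *)
have E : mu *: (gradT c xp (c xp) + mu^-1 *: z) =
   (dPsi lam xp - dPsi lam xk) - grad f xp - gradT c xp lam - (s - grad f xk)
   - eta^-1 *: (grad v xp - grad v xk) - (w - z).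
  have gD a : gradT c xp (lam + a *: c xp) = gradT c xp lam + a *: gradT c xp (c xp).
    rewrite /gradT scaler_sumr -big_split/=; apply: eq_bigr => i _.
    by rewrite !mxE scalerDl scalerA.
  rewrite /dPsi gD /w /step_g scalerDr scalerA divff ?gt_eqF// scale1r.
  move: (gradT _ _ _) (gradT _ _ _) (gradT _ _ _) (grad _ _) (grad _ _) (eta^-1 *: _) => a1 a2 a3 a4 a5 a6.
  apply/rowP => i; rewrite !mxE; ring.
have {}E : mu * pnorm p (gradT c xp (c xp) + mu^-1 *: z) <=
    Mf + Mh + m%:R * (rho * Mbc * Mc) + e + eta^-1 / 2 * D + eta^-1 * (Lv * D).
  rewrite -[X in X * _]gtr0_norm// -pnormZ// E.
  have T a b : pnorm p (a - b : 'rV[R]_d) <= pnorm p a + pnorm p b.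
    by rewrite (le_trans (pnormD _ _ p1))// pnormN.
  apply: (le_trans (T _ _)).
  apply: (le_trans (lerD (T _ _) (lexx _))).
  apply: (le_trans (lerD (lerD (T _ _) (lexx _)) (lexx _))).
  apply: (le_trans (lerD (lerD (lerD (T _ _) (lexx _)) (lexx _)) (lexx _))).
  apply: (le_trans (lerD (lerD (lerD (lerD (T _ _) (lexx _)) (lexx _)) (lexx _)) (lexx _))).
  have t1 : pnorm p (dPsi lam xp - dPsi lam xk) <= eta^-1 / 2 * D.
    rewrite (le_trans (pnorm_p2 _))// (le_trans (gradT_lipschitz Xk Xp lamb))//.
    apply: ler_pM; rewrite ?pnorm_ge0//.
      by rewrite /Lmu addr_ge0 ?(ltW hLf)// mulr_ge0// !addr_ge0// !mulr_ge0 ?(ltW hmu) ?(ltW hMc) ?(ltW hLc) ?(ltW hMbc) ?(ltW hrho).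
    by have := ler_wpM2l (ltW (etrans (invr_gt0 _) heta)) hetaL; rewrite mulKf ?gt_eqF// mul1r.
  have t2 := le_trans (pnorm_p2 _) (fM Xp).
  have t3 := le_trans (pnorm_p2 _) gl.
  have t5 : pnorm p (eta^-1 *: (grad v xp - grad v xk)) <= eta^-1 * (Lv * D).
    by rewrite pnormZ// gtr0_norm ?invr_gt0// ler_wpM2l ?invr_ge0 ?(ltW heta)// vsm.
  have t6 := le_trans (pnorm_p2 _) wz.
  rewrite -/e; lra.
have S0 : 0 <= mu * (beta * pnorm p (c xp)) by rewrite !mulr_ge0 ?pnorm_ge0// ltW.
have := sqr_sum6_le S0 (le_trans (ler_wpM2l (ltW hmu) reg2) E).
rewrite !exprMn exprVn; lra.
Qed.

(** Telescoping along one path. The bounds are linear in the error sum and the move sum, with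
    constants that do not depend on the path, so that expectations can be taken term by term. *)
Lemma run_bounds (K : nat) (x s gh : nat -> 'rV[R]_d) (lam : nat -> 'rV[R]_m)
    (b2 Phi_inf : R) :
  (0 < K)%N -> X (x 0) -> lam 0 = 0 ->
  (forall k, (k < K)%N -> is_argmin X (fun y => ((dotv (step_g (s k) (lam k) (x k)) y)%:E
     + h y + (eta^-1 * bregman v (x k) y)%:E)%E) (x k.+1)) ->
  (forall k, (k < K)%N -> lam k.+1 = lam k + (rho / K%:R) *: c (x k)) ->
  (forall x y, pnorm q (x - y) ^+ 2 <= dotv (x - y) (grad v x - grad v y)) ->
  (forall k, (k < K)%N -> pnorm 2 (gh k - grad f (x k)) ^+ 2 <= b2) ->
  (forall x, X x -> Phi_inf <= f x + fine (h x)) ->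
  (forall k, (k <= K)%N -> beta * pnorm p (c (x k))
     <= lpdist p (gradT c (x k) (c (x k))) [set - g | g in normal_cone X (x k)]) ->
  let Delta0 := f (x 0) + fine (h (x 0)) + mu / 2 * pnorm 2 (c (x 0)) ^+ 2 - Phi_inf
                + 2 * m%:R * rho * Mbc ^+ 2 in
  let SD := \sum_(k < K) pnorm q (x k.+1 - x k) ^+ 2 / eta ^+ 2 in
  let Se := \sum_(k < K) pnorm p (s k - gh k) ^+ 2 in
  0 <= Delta0 /\
  SD <= 2 * Delta0 / eta + 5 / 2 * Se + 10 * K%:R * b2 /\
  beta ^+ 2 * mu ^+ 2 * \sum_(k < K) pnorm p (c (x k)) ^+ 2 <=
    beta ^+ 2 * mu ^+ 2 * pnorm p (c (x 0)) ^+ 2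
    + 8 * K%:R * (Mf ^+ 2 + Mh ^+ 2 + m%:R ^+ 2 * rho ^+ 2 * Mbc ^+ 2 * Mc ^+ 2)
    + 16 / 5 * (5 / 4 * Se + 5 * K%:R * b2) + 32 / 5 * (1 / 4 + Lv ^+ 2) * SD.
Proof.
move=> K0 X0 lam0 am lamS vmon ghb hPhi reg Delta0 SD Se.
have Kp : 0 < K%:R :> R by rewrite ltr0n.
have Xk k : (k <= K)%N -> X (x k).
  by case: k => // k kK; exact: (am k kK).1.
(* Starting from 0 with K steps of weight rho / K, the multiplier stays below rho Mbc throughout:
   this is why the penalty increments are divided by K. *)
have lamk k : (k <= K)%N -> forall i, `|lam k 0 i| <= k%:R * (rho / K%:R * Mbc).
  elim: k => [_ i|k IH kK i]; first by rewrite lam0 mxE normr0 mul0r.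
  rewrite lamS// !mxE -natr1 mulrDl mul1r (le_trans (ler_normD _ _))// lerD ?IH 1?ltnW//.
  have rK : 0 < rho / K%:R by rewrite divr_gt0.
  by rewrite normrM gtr0_norm// ler_wpM2l ?(ltW rK)// (cb i (Xk _ (ltnW kK))).
have lamb k : (k <= K)%N -> forall i, `|lam k 0 i| <= rho * Mbc.
  move=> kK i; rewrite (le_trans (lamk k kK i))// mulrA ler_wpM2r ?(ltW hMbc)//.
  by rewrite mulrA ler_pdivrMr// mulrC ler_wpM2l ?(ltW hrho)// ler_nat.
have dlc k (l : 'rV[R]_m) B : (k <= K)%N -> (forall i, `|l 0 i| <= B) -> `|dotv l (c (x k))| <= m%:R * (B * Mbc).
  move=> kK lB; rewrite /dotv (le_trans (ler_norm_sum _ _ _))//.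
  have S i : `|l 0 i * c (x k) 0 i| <= B * Mbc by rewrite normrM ler_pM// (cb i (Xk _ kK)).
  by rewrite (le_trans (ler_sum _ (fun i _ => S i)))// sumr_const card_ord mulr_natl.
(* (a + b)^2 <= 5/4 a^2 + 5 b^2: the bias gets the large factor, so that the stochastic error keeps
   a coefficient close to 1. *)
have eps k : (k < K)%N ->
    pnorm p (s k - grad f (x k)) ^+ 2 <= 5 / 4 * pnorm p (s k - gh k) ^+ 2 + 5 * b2.
  move=> kK; have := ghb _ kK.
  have := pnormD (s k - gh k) (gh k - grad f (x k)) p1; rewrite subrKA.
  have := pnorm_p2 (gh k - grad f (x k)).
  have := pnorm_ge0 p (s k - grad f (x k)).
  have := pnorm_ge0 p (gh k - grad f (x k)); have := pnorm_ge0 p (s k - gh k).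
  move: (pnorm p _) (pnorm p _) (pnorm p _) (pnorm 2 _) => e b a B a0 b0 e0 bB eab Bb.
  have b2b : b ^+ 2 <= b2 by apply: le_trans Bb; rewrite lerXn2r// nnegrE (le_trans b0).
  have : e ^+ 2 <= (a + b) ^+ 2 by rewrite lerXn2r ?nnegrE ?addr_ge0.
  have := sqr_ge0 (a - 4 * b); lra.
set A := fun k => Psi (lam k) (x k) + fine (h (x k)).
(* Updating the multiplier adds (rho / K) <c(x^k), c(x^(k+1))>, at most m rho Mbc^2 / K. Over K
   steps this is one of the two copies of m rho Mbc^2 in [Delta0]. *)
have step k : (k < K)%N -> A k.+1 + eta / 2 * (pnorm q (x k.+1 - x k) ^+ 2 / eta ^+ 2)
    <= A k + (eta * (5 / 4 * pnorm p (s k - gh k) ^+ 2 + 5 * b2) + m%:R * rho * Mbc ^+ 2 / K%:R).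
  move=> kK.
  have := step_descent (Xk k (ltnW kK)) (lamb k (ltnW kK)) (am k kK) vmon.
  have := ler_wpM2l (ltW heta) (eps k kK).
  have -> : A k.+1 = Psi (lam k) (x k.+1) + fine (h (x k.+1)) + rho / K%:R * dotv (c (x k)) (c (x k.+1)).
    by rewrite /A /Psi lamS// dotvDl dotvZl; ring.
  have rK : 0 < rho / K%:R by rewrite divr_gt0.
  have cc := dlc k.+1 (c (x k)) Mbc kK (fun i => cb i (Xk k (ltnW kK))).
  have := ler_wpM2l (ltW rK) (le_trans (ler_norm _) cc).
  have -> : pnorm q (x k.+1 - x k) ^+ 2 / (2 * eta) =
       eta / 2 * (pnorm q (x k.+1 - x k) ^+ 2 / eta ^+ 2) by field; rewrite gt_eqF.
  have -> : rho / K%:R * (m%:R * (Mbc * Mbc)) = m%:R * rho * Mbc ^+ 2 / K%:R by ring.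
  rewrite -/(A k); move: (A k) (Psi _ _) (rho / K%:R * dotv _ _) => *; lra.
have sum n : (n <= K)%N -> A n + eta / 2 * \sum_(k < n) (pnorm q (x k.+1 - x k) ^+ 2 / eta ^+ 2)
    <= A 0 + (eta * (5 / 4 * \sum_(k < n) pnorm p (s k - gh k) ^+ 2 + 5 * n%:R * b2)
      + n%:R * (m%:R * rho * Mbc ^+ 2 / K%:R)).
  elim: n => [_|n IH nK]; first by rewrite !big_ord0; lra.
  have := step n nK; have := IH (ltnW nK); rewrite !big_ord_recr/= -natr1.
  move: (\sum_(_ < _) _) (\sum_(_ < _) _) (A _) (A _) (A _) (pnorm _ _) (pnorm _ _) => *; lra.
(* The second copy of m rho Mbc^2 in [Delta0]: the lower bound of the Lagrangian at the last
   multiplier. *)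
have AK : Phi_inf - m%:R * rho * Mbc ^+ 2 <= A K.
  have := hPhi _ (Xk K (leqnn _)).
  have := dlc K (lam K) (rho * Mbc) (leqnn _) (lamb K (leqnn _)).
  rewrite ler_norml => /andP[+ _]; rewrite /A /Psi.
  have : 0 <= mu / 2 * pnorm 2 (c (x K)) ^+ 2 by rewrite mulr_ge0 ?sqr_ge0// divr_ge0// ltW.
  move: (mu / 2 * _) => M; lra.
have A0E : A 0 = Delta0 + Phi_inf - 2 * m%:R * rho * Mbc ^+ 2.
  by rewrite /A /Psi lam0 dotv0l /Delta0; ring.
have SDle : SD <= 2 * Delta0 / eta + 5 / 2 * Se + 10 * K%:R * b2.
  have := sum K (leqnn _); rewrite -/SD -/Se A0E => H.
  have H2 : eta / 2 * SD <= Delta0 + eta * (5 / 4 * Se + 5 * K%:R * b2).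
    have KK : K%:R * (m%:R * rho * Mbc ^+ 2 / K%:R) = m%:R * rho * Mbc ^+ 2.
      by rewrite mulrCA divff ?gt_eqF// mulr1.
    by rewrite KK in H; move: H AK; lra.
  have e2 : 0 < 2 / eta by rewrite divr_gt0.
  have := ler_wpM2l (ltW e2) H2.
  have -> : 2 / eta * (eta / 2 * SD) = SD by field; rewrite gt_eqF.
  have -> : 2 / eta * (Delta0 + eta * (5 / 4 * Se + 5 * K%:R * b2)) =
     2 * Delta0 / eta + 5 / 2 * Se + 10 * K%:R * b2 by field; rewrite gt_eqF.
  by [].
split.
  rewrite /Delta0; have := hPhi _ X0.
  have : 0 <= mu / 2 * pnorm 2 (c (x 0)) ^+ 2 by rewrite mulr_ge0 ?sqr_ge0// divr_ge0// ltW.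
  have : 0 <= 2 * m%:R * rho * Mbc ^+ 2.
    by rewrite mulr_ge0 ?sqr_ge0// mulr_ge0 ?(ltW hrho)// mulr_ge0.
  move: (mu / 2 * _) (2 * _ * _ * _) => *; lra.
split => //.
have feas k : (k < K)%N -> beta ^+ 2 * mu ^+ 2 * pnorm p (c (x k.+1)) ^+ 2 <=
    8 * (Mf ^+ 2 + Mh ^+ 2 + m%:R ^+ 2 * rho ^+ 2 * Mbc ^+ 2 * Mc ^+ 2)
    + 16 / 5 * (5 / 4 * pnorm p (s k - gh k) ^+ 2 + 5 * b2)
    + 32 / 5 * (1 / 4 + Lv ^+ 2) * (pnorm q (x k.+1 - x k) ^+ 2 / eta ^+ 2).
  move=> kK.
  have := step_feasibility (Xk k (ltnW kK)) (lamb k (ltnW kK)) (am k kK) (reg k.+1 kK).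
  have := eps k kK; move: (pnorm q _ ^+ 2 / _) => *; lra.
set C := Mf ^+ 2 + _ + _ in feas *.
have fsum n : (n <= K)%N -> beta ^+ 2 * mu ^+ 2 * \sum_(k < n) pnorm p (c (x k.+1)) ^+ 2 <=
    8 * n%:R * C + 16 / 5 * (5 / 4 * \sum_(k < n) pnorm p (s k - gh k) ^+ 2 + 5 * n%:R * b2)
    + 32 / 5 * (1 / 4 + Lv ^+ 2) * \sum_(k < n) (pnorm q (x k.+1 - x k) ^+ 2 / eta ^+ 2).
  elim: n => [_|n IH nK]; first by rewrite !big_ord0; lra.
  have := feas n nK; have := IH (ltnW nK); rewrite !big_ord_recr/= -natr1.
  move: (\sum_(_ < _) _) (\sum_(_ < _) _) (\sum_(_ < _) _) (pnorm q _ ^+ 2 / _) (pnorm _ _) (pnorm _ _) => *; lra.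
have bm : 0 <= beta ^+ 2 * mu ^+ 2 by rewrite mulr_ge0 ?sqr_ge0.
(* Feasibility is known at x^1, ..., x^K; adding x^0 covers the indices 0, ..., K-1 over which the
   output is drawn. *)
apply: (@le_trans _ _ (beta ^+ 2 * mu ^+ 2 * (pnorm p (c (x 0)) ^+ 2 + \sum_(k < K) pnorm p (c (x k.+1)) ^+ 2))).
  rewrite ler_wpM2l//.
  have -> : pnorm p (c (x 0)) ^+ 2 + \sum_(k < K) pnorm p (c (x k.+1)) ^+ 2 =
     \sum_(k < K.+1) pnorm p (c (x k)) ^+ 2 by rewrite big_ord_recl.
  by rewrite big_ord_recr/= lerDl sqr_ge0.
by have := fsum K (leqnn _); rewrite -/SD -/Se mulrDl; lra.
Qed.

End Step.

(** * Measurability and freezing *)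

Section MeasurableVectors.
Context {d} {T : measurableType d} {R : realType} {n : nat}.
Implicit Types (Y : T -> 'rV[R]_n).

Lemma continuous_borelRV (f : 'rV[R]_n -> R) : continuous f ->
  measurable_fun [set: borelRV R n] f.
Proof.
move=> cf; apply: (measurability _ (measurable_realfun.RGenOpens.measurableE R)) => _ [_ [a [b ->] <-]].
rewrite setTI; apply: sub_sigma_algebra.
by apply: open_comp => // y _; exact: cf.
Qed.

(** Stated by coordinates so that vector operations reduce to real ones; [mvecP] is the equivalence
    with Borel measurability. *)
Definition mvec Y := forall i, measurable_fun [set: T] (fun w => Y w 0 i).

(** Rational cubes form a countable base of the topology. This reduces Borel measurability to
    coordinates, and later shows that the support of a law has full measure. *)
Lemma rV_rational_box (U : set 'rV[R]_n) x : open U -> U x ->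
  exists a : 'rV[rat]_n * nat,
    (forall i, `|ratr (a.1 0 i) - x 0 i| < a.2.+1%:R^-1) /\
    (forall y : 'rV[R]_n, (forall i, `|ratr (a.1 0 i) - y 0 i| < a.2.+1%:R^-1) -> U y).
Proof.
move=> oU Ux; have /nbhs_ballP[e /= e0 eU] : nbhs x U by exact: open_nbhs_nbhs.
have [k ke] : exists k, k.+1%:R^-1 < e / 2.
  have [k] := @ltr_add_invr R 0 (e / 2) (divr_gt0 e0 (ltr0n _ 2)).
  by rewrite add0r; exists k.
have k0 : 0 < k.+1%:R^-1 :> R by rewrite invr_gt0.
have qP i : exists r : rat, `|ratr r - x 0 i| < k.+1%:R^-1 :> R.
  have /rat_in_itvoo[r] : x 0 i - k.+1%:R^-1 < x 0 i + k.+1%:R^-1.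
    by rewrite ltrD2l gtrN.
  rewrite in_itv/= => /andP[r1 r2]; exists r.
  by rewrite ltr_norml ltrBrDr ltrBlDr [- _ + _]addrC [_^-1 + _]addrC r1.
pose r : 'rV[rat]_n := \row_i projT1 (cid (qP i)).
exists (r, k); split => /=.
  by move=> i; rewrite mxE; exact: (projT2 (cid (qP i))).
move=> y ry; apply: eU; rewrite -ball_normE/=.
apply: (@le_lt_trans _ _ (k.+1%:R^-1 + k.+1%:R^-1)); last first.
  by move: ke; move: (k.+1%:R^-1) => z; lra.
apply: norm_le_bound; first by rewrite addr_ge0// ltW.
move=> i; rewrite !mxE; have := ry i.
rewrite mxE => ryi; have := projT2 (cid (qP i)); move: ryi.
move: (projT1 _) => r0; move: (ratr _) (k.+1%:R^-1) => rr z; rewrite !ltr_norml ler_norml => /andP[? ?] /andP[? ?].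
by apply/andP; split; lra.
Qed.

Lemma mvecP Y : mvec Y <-> measurable_fun [set: T] (Y : T -> borelRV R n).
Proof.
split => [mY|mY i].
  apply: (@measurability _ _ T (borelRV R n) setT Y (@open 'rV[R]_n)) => // _ [U oU <-].
  rewrite setTI.
  pose box (a : 'rV[rat]_n * nat) : set 'rV[R]_n :=
    [set y | forall i, `|ratr (a.1 0 i) - y 0 i| < a.2.+1%:R^-1].
  have -> : Y @^-1` U = \bigcup_(a in [set a | box a `<=` U]) (Y @^-1` box a).
    apply/seteqP; split => [w /= Uw|w [a /= aU] /= aw]; last exact: aU.
    by have [a [a1 a2]] := rV_rational_box oU Uw; exists a.
  rewrite bigcup_mkcond; apply: countable_bigcupT_measurable => [|a].
    exact: countableP.
  case: ifPn => // _.
  have -> : Y @^-1` box a = \bigcap_(i : 'I_n) [set w | `|ratr (a.1 0 i) - Y w 0 i| < a.2.+1%:R^-1].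
    by apply/seteqP; split => [w /= H i _|w /= H i]; exact: H.
  apply: fin_bigcap_measurable => // i _.
  rewrite -[X in measurable X]setTI.
  have mf : measurable_fun [set: T] (fun w => `|ratr (a.1 0 i) - Y w 0 i|).
    by apply: measurableT_comp => //; exact: measurable_funB.
  have := mf measurableT _ (@measurable_itv R `]-oo, a.2.+1%:R^-1[).
  by congr measurable; apply/seteqP; split => w /=; rewrite in_itv.
have mc : measurable_fun [set: borelRV R n] (fun y : 'rV[R]_n => y 0 i : R).
  apply: continuous_borelRV => y.
  exact: coord_continuous.
exact: (measurableT_comp mc mY).
Qed.

Lemma mvec_cst (a : 'rV[R]_n) : mvec (cst a).
Proof. by move=> i; exact: measurable_cst. Qed.

Lemma mvecD Y Z : mvec Y -> mvec Z -> mvec (fun w => Y w + Z w).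
Proof.
by move=> mY mZ i; under eq_fun do rewrite mxE; exact: measurable_funD.
Qed.

Lemma mvecZ (a : T -> R) Y : measurable_fun [set: T] a -> mvec Y ->
  mvec (fun w => a w *: Y w).
Proof.
by move=> ma mY i; under eq_fun do rewrite mxE; exact: measurable_funM.
Qed.

Lemma mvecZl (a : R) Y : mvec Y -> mvec (fun w => a *: Y w).
Proof. by apply: mvecZ; exact: measurable_cst. Qed.

Lemma mvecN Y : mvec Y -> mvec (fun w => - Y w).
Proof.
by move=> mY i; under eq_fun do rewrite mxE; exact: measurableT_comp.
Qed.

Lemma mvecB Y Z : mvec Y -> mvec Z -> mvec (fun w => Y w - Z w).
Proof. by move=> mY mZ; apply: mvecD => //; exact: mvecN. Qed.

Lemma mvec_sum (I : Type) (l : seq I) (F : I -> T -> 'rV[R]_n) :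
  (forall i, mvec (F i)) -> mvec (fun w => \sum_(i <- l) F i w).
Proof.
move=> mF; elim: l => [|i l IH].
  by under eq_fun do rewrite big_nil; exact: mvec_cst.
by under eq_fun do rewrite big_cons; exact: mvecD.
Qed.

Lemma measurable_dotv Y Z : mvec Y -> mvec Z ->
  measurable_fun [set: T] (fun w => dotv (Y w) (Z w)).
Proof.
by move=> mY mZ; apply: measurable_sum => i; exact: measurable_funM.
Qed.

Lemma measurable_pnorm p Y : mvec Y -> measurable_fun [set: T] (fun w => pnorm p (Y w)).
Proof.
move=> mY; under eq_fun do rewrite pnormE.
apply: (measurableT_comp (measurable_powR _)).
apply: measurable_sum => i.
by apply: (measurableT_comp (measurable_powR _)); exact: measurableT_comp.
Qed.

End MeasurableVectors.

Section MeasurableComposition.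
Context {d} {T : measurableType d} {R : realType} {n k : nat}.

(** [S] can be any set, such as the data for which a prox point exists, and [phi] is controlled only
    on it. The open set [V] replaces the preimage of [U] under [phi]: it has the same trace on [S],
    where [Y] takes its values. *)
Lemma mvec_comp_within (S : set 'rV[R]_n) (phi : 'rV[R]_n -> 'rV[R]_k) (Y : T -> 'rV[R]_n) :
  mvec Y -> (forall w, S (Y w)) ->
  (forall x e, S x -> 0 < e -> exists2 r, 0 < r &
     forall y, S y -> `|x - y| < r -> `|phi x - phi y| < e) ->
  mvec (phi \o Y).
Proof.
move=> /mvecP mY SY cphi; apply/mvecP.
apply: (@measurability _ _ T (borelRV R k) setT (phi \o Y) (@open 'rV[R]_k)) => // _ [U oU <-].
rewrite setTI.
pose V : set 'rV[R]_n := \bigcup_(b in [set b : 'rV[R]_n * R |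
  S b.1 /\ (forall y, S y -> ball b.1 b.2 y -> U (phi y))]) (ball b.1 b.2)^°.
have oV : open V by apply: bigcup_open => b _; exact: open_interior.
have mV : @measurable _ (borelRV R n) V by exact: sub_sigma_algebra.
have := mY measurableT V mV; rewrite setTI; congr measurable.
apply/seteqP; split => [w [[x r] /= [Sx xr] /interior_subset bw]|w /= Uw].
  exact: xr.
have /nbhs_ballP[e /= e0 eU] : nbhs (phi (Y w)) U by exact: open_nbhs_nbhs.
have [r r0 H] := cphi (Y w) e (SY w) e0.
exists (Y w, r) => /=; last first.
  by apply: nbhs_singleton; apply: nbhs_interior; exact: nbhsx_ballx.
split => // y Sy; rewrite -ball_normE/= => yr.
by apply: eU; rewrite -ball_normE/=; exact: H.
Qed.

Lemma mvec_comp_lipschitz (S : set 'rV[R]_n) (phi : 'rV[R]_n -> 'rV[R]_k) (L p q : R)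
    (Y : T -> 'rV[R]_n) :
  mvec Y -> (forall w, S (Y w)) -> 0 < p -> 1 <= q ->
  (forall x y, S x -> S y -> pnorm p (phi x - phi y) <= L * pnorm q (x - y)) ->
  mvec (phi \o Y).
Proof.
move=> mY SY p0 q1 phiL; apply: (mvec_comp_within mY SY) => x e Sx e0.
pose K := `|L| * n%:R + 1.
have K0 : 0 < K by rewrite ltr_wpDl// mulr_ge0.
exists (e / K); first exact: divr_gt0.
move=> y Sy xy; apply: (le_lt_trans (norm_le_pnorm _ p0)).
apply: (le_lt_trans (phiL _ _ Sx Sy)).
apply: (@le_lt_trans _ _ (K * `|x - y|)); last by rewrite -ltr_pdivlMl// mulrC.
apply: (@le_trans _ _ (`|L| * (n%:R * `|x - y|))).
  apply: (le_trans (ler_wpM2r (pnorm_ge0 _ _) (ler_norm L))).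
  by rewrite ler_wpM2l// pnorm_le_norm.
by rewrite mulrA ler_wpM2r// lerDl.
Qed.

End MeasurableComposition.

Section Caratheodory.
Context {d d'} {T : measurableType d} {Xi : measurableType d'} {R : realType} {n : nat}.

Lemma measurable_real_continuous_comp (f : 'rV[R]_n -> R) (Y : T -> 'rV[R]_n) :
  continuous f -> mvec Y -> measurable_fun [set: T] (f \o Y).
Proof.
by move=> cf /mvecP mY; exact: (measurableT_comp (continuous_borelRV cf) mY).
Qed.

(* F is approximated by its values on the grid Z^n / (k + 1). *)
Lemma measurable_caratheodory_fun (F : 'rV[R]_n -> Xi -> R) (Y : T -> 'rV[R]_n) (Z : T -> Xi) :
  (forall z, continuous (F ^~ z)) -> (forall x, measurable_fun [set: Xi] (F x)) ->
  mvec Y -> measurable_fun [set: T] Z ->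
  measurable_fun [set: T] (fun w => F (Y w) (Z w)).
Proof.
move=> cF mF mY mZ.
pose fl k (x : 'rV[R]_n) : 'rV[int]_n := \row_i Num.floor (x 0 i * k.+1%:R).
pose gr k (a : 'rV[int]_n) : 'rV[R]_n := \row_i ((a 0 i)%:~R / k.+1%:R).
apply: (@measurable_fun_cvg _ _ _ setT (fun k w => F (gr k (fl k (Y w))) (Z w))).
  move=> k mT B mB; rewrite setTI.
  (* The rounded point takes countably many values, and for each of them [F] is evaluated at a
     constant point. *)
  have -> : (fun w => F (gr k (fl k (Y w))) (Z w)) @^-1` B =
     \bigcup_a ((fun w => fl k (Y w)) @^-1` [set a] `&` (F (gr k a) \o Z) @^-1` B).
    apply/seteqP; split => [w /= Bw|w [a _ [/= <-]]//].
    by exists (fl k (Y w)).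
  apply: countable_bigcupT_measurable => [|a]; first exact: countableP.
  apply: measurableI; last first.
    rewrite -[X in measurable X]setTI.
    by have := measurableT_comp (mF (gr k a)) mZ; exact.
  have -> : (fun w => fl k (Y w)) @^-1` [set a] =
     \bigcap_(i : 'I_n) [set w | (a 0 i)%:~R <= Y w 0 i * k.+1%:R < (a 0 i + 1)%:~R].
    apply/seteqP; split => [w /= <- i _ /=|w /= H].
      by rewrite mxE floor_le_tmp floorD1_gt.
    by apply/rowP => i; rewrite mxE; apply: floor_def; exact: H.
  apply: fin_bigcap_measurable => // i _.
  have mf : measurable_fun [set: T] (fun w => Y w 0 i * k.+1%:R).
    by apply: measurable_funM => //; exact: measurable_cst.
  have := mf mT _ (@measurable_itv R `[(a 0 i)%:~R, (a 0 i + 1)%:~R[); rewrite setTI.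
  by congr measurable; apply/seteqP; split => w /=; rewrite in_itv.
move=> w _; set x := Y w; set z := Z w.
apply: (@cvg_comp _ _ _ (fun k => gr k (fl k x)) (F ^~ z) _ (nbhs x)); last exact: cF.
apply/(@cvgrPdist_le R 'rV[R]_n nat \oo _ (fun k => gr k (fl k x)) x) => e e0.
near=> k.
have ke : k.+1%:R^-1 <= e by near: k; apply: filterS (near_infty_natSinv_lt (PosNum e0)) => k /ltW.
apply: le_trans ke; apply: norm_le_bound; first by rewrite invr_ge0.
move=> i; rewrite !mxE.
have H (y fl0 K : R) : 0 < K -> fl0 <= y * K < fl0 + 1 -> `|y - fl0 / K| <= K^-1.
  move=> K0 /andP[f1 f2].
  have -> : y - fl0 / K = (y * K - fl0) / K by field; rewrite gt_eqF.
  rewrite normrM normfV (gtr0_norm K0) ler_piMl ?invr_ge0 ?(ltW K0)// ler_norml.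
  by apply/andP; split; lra.
apply: H; first by rewrite ltr0n.
by have := floor_itv (x 0 i * k.+1%:R); rewrite intrD.
Unshelve. all: by end_near. Qed.

End Caratheodory.

(** * Independence of a fresh source from the past *)

Section Independence.
Context {R : realType} {d} {Omega : measurableType d} (Pr : probability Omega R).
Context {I : choiceType} (D : set I) (G : I -> set (set Omega)).
Context (Gm : forall i, D i -> G i `<=` measurable)
  (GI : forall i, D i -> setI_closed (G i)) (GT : forall i, D i -> G i setT).
Context (ind : mutually_independent Pr D G).

Definition sigma_of (A : set I) : set (set Omega) := \bigcup_(i in A) G i.

Let cyl (A : set I) : set (set Omega) := [set E | exists (J : {fset I}) (F : I -> set Omega),
  [/\ (forall i, i \in J -> A i), (forall i, i \in J -> G i (F i)) &
      E = \bigcap_(i in [set` J]) F i]].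

(** The finite measures E -> P(E & B) and E -> P(E) P(B) agree on finite intersections of events
    from the sources in [A]. These form a pi-system generating the sigma-algebra of [A], so
    uniqueness of measures applies. *)
Lemma indep_sigma_of (A : set I) i0 E B : A `<=` D -> D i0 -> ~ A i0 ->
  <<s sigma_of A >> E -> G i0 B -> (Pr (E `&` B) = Pr E * Pr B)%E.
Proof.
move=> AD Di0 nAi0 sE GB.
have mB : measurable B by exact: (Gm Di0).
have cylm : cyl A `<=` measurable.
  move=> _ [J [F [JA GF ->]]]; apply: fin_bigcap_measurable => [|i /= iJ].
    exact: finite_fset.
  exact: (Gm (AD _ (JA _ iJ)) (GF _ iJ)).
pose r : {nonneg R} := NngNum (fine_ge0 (measure_ge0 Pr B)).
have rE : (r%:num%:E = Pr B)%E by rewrite /= fineK// fin_num_measure.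
have := @g_sigma_algebra_measure_unique _ R Omega (cyl A) cylm (fun=> setT) _ _
  (mrestr Pr mB) (mscale r Pr).
have H : (mrestr Pr mB E = mscale r Pr E)%E -> (Pr (E `&` B) = Pr E * Pr B)%E.
  by rewrite muleC -rE.
move=> U; apply: H; apply: U.
- move=> _; exists fset0, (fun=> setT); split => //.
  by apply/seteqP; split.
- by rewrite bigcup_const.
- move=> _ _ [J1 [F1 [J1A GF1 ->]]] [J2 [F2 [J2A GF2 ->]]].
  (* Over the union of the index sets, a source missing from one family is filled in with the full
     event. *)
  exists (J1 `|` J2)%fset, (fun i => (if i \in J1 then F1 i else setT) `&`
    (if i \in J2 then F2 i else setT)); split.
  + by move=> i; rewrite inE => /orP[/J1A|/J2A].
  + move=> i; rewrite inE => iJ.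
    have Di : D i by apply: AD; case/orP: iJ => [/J1A|/J2A].
    apply: GI => //; case: ifPn => [iJ'|_].
    - exact: GF1.
    - exact: GT.
    - exact: GF2.
    - exact: GT.
  + apply/seteqP; split => [w [w1 w2] i /= iJ|w wJ].
      by split; case: ifPn => // iJ'; [exact: w1|exact: w2].
    split => i /= iJ.
      by have := wJ i; rewrite /= inE iJ => /(_ isT) [].
    by have := wJ i; rewrite /= inE iJ orbT => /(_ isT) [].
- move=> _ [J [F [JA GF ->]]].
  have i0J : i0 \notin J by apply/negP => /JA.
  change (Pr (\bigcap_(i in [set` J]) F i `&` B) = r%:num%:E * Pr (\bigcap_(i in [set` J]) F i))%E.
  rewrite rE.
  have -> : \bigcap_(i in [set` J]) F i `&` B =
      \bigcap_(i in [set` (i0 |` J)%fset]) (if i == i0 then B else F i).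
    apply/seteqP; split => [w [wF wB] i /=|w H].
      by rewrite !inE => /orP[/eqP ->|iJ]; rewrite ?eqxx//; case: eqP => // _; exact: wF.
    split => [i /= iJ|].
      have := H i; rewrite /= !inE iJ orbT => /(_ isT).
      by case: eqP => // ii0; move: i0J; rewrite -ii0 iJ.
    by have := H i0; rewrite /= !inE eqxx; exact.
  rewrite (ind (J := (i0 |` J)%fset)).
    rewrite (ind (J := J)); last by move=> i iJ; split; [exact/AD/JA|exact: GF].
    rewrite big_fsetU1//= eqxx EFinM fineK ?fin_num_measure//.
    congr (_ * (_)%:E)%E; apply: eq_big_seq => i iJ.
    by case: eqP => // ii0; move: i0J; rewrite -ii0 iJ.
  move=> i; rewrite !inE => /orP[/eqP ->|iJ]; first by rewrite eqxx.
  case: eqP => [->//|_]; split; [exact/AD/JA|exact: GF].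
- by move=> k; change (Pr (setT `&` B) < +oo)%E; rewrite setTI ltey_eq fin_num_measure.
- move: E sE; apply: smallest_sub; first exact: smallest_sigma_algebra.
  move=> E [i Ai GE]; apply: sub_sigma_algebra.
  exists [fset i]%fset, (fun=> E); split.
  + by move=> j; rewrite inE => /eqP ->.
  + by move=> j; rewrite inE => /eqP ->.
  + apply/seteqP; split => [w Ew j //|w]; apply.
    by rewrite /= inE.
Qed.

End Independence.

Section Freeze.
Context {R : realType} {d} {Omega : measurableType d} (Pr : probability Omega R).
Context (GA : set (set Omega)) (GAm : GA `<=` measurable).
Context {d'} {T' : measurableType d'} (Y : Omega -> T') (mY : measurable_fun [set: Omega] Y)
  (Q : probability T' R).
Context (indep : forall E B, <<s GA >> E -> measurable B ->
  (Pr (E `&` Y @^-1` B) = Pr E * Q B)%E).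

Notation OA := (g_sigma_algebraType GA).

Lemma sub_sigma_measurable E : <<s GA >> E -> measurable E.
Proof. exact: (smallest_sub (@sigma_algebra_measurable _ Omega) GAm). Qed.

Lemma measurable_fun_sub {d2} {T2 : measurableType d2} (f : Omega -> T2) :
  measurable_fun [set: OA] f -> measurable_fun [set: Omega] f.
Proof. by move=> mf _ B mB; apply: sub_sigma_measurable; exact: mf. Qed.

(** The identity onto the coarser sigma-algebra: its distribution is [Pr] restricted to the past,
    the first factor of the product measure in [freeze]. *)
Let idA : Omega -> OA := id.
Let midA : measurable_fun [set: Omega] idA.
Proof. by move=> _ B mB; rewrite setTI; exact: sub_sigma_measurable. Qed.
Let idA_mixin := isMeasurableFun.Build _ _ _ _ _ midA.
Let idA_pack : {mfun Omega >-> OA} := HB.pack idA idA_mixin.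

Let joint (w : Omega) : OA * T' := (idA w, Y w).
Let mjoint : measurable_fun [set: Omega] joint.
Proof. exact: measurable_fun_pair. Qed.
Let joint_mixin := isMeasurableFun.Build _ _ _ _ _ mjoint.
Let joint_pack : {mfun Omega >-> (OA * T')%type} := HB.pack joint joint_mixin.

(* Conditioning on <<s GA>> in integral form: the fresh variable Y is integrated out
   with the past frozen. *)
Lemma freeze (g : OA * T' -> \bar R) : measurable_fun setT g -> (forall z, 0 <= g z)%E ->
  (\int[Pr]_w g (w, Y w) = \int[Pr]_w \int[Q]_y g (w, y))%E.
Proof.
move=> mg g0.
have -> : (\int[Pr]_w g (w, Y w) = \int[distribution Pr joint_pack]_z g z)%E.
  by rewrite ge0_integral_distribution.
have -> : (\int[distribution Pr joint_pack]_z g z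
   = \int[distribution Pr idA_pack \x Q]_z g z)%E.
  (* Independence is agreement of the joint law with the product on rectangles, which determines
     it. *)
  apply/esym/eq_measure_integral => B mB _.
  by apply: product_measure_unique => // E C; exact: indep.
rewrite fubini_tonelli1// /fubini_F.
rewrite ge0_integral_distribution//.
- exact: measurable_fun_fubini_tonelli_F.
- by move=> w; exact: integral_ge0.
Qed.

End Freeze.

(** * Moments *)

Section RealExpectation.
Context {R : realType} {d} {T : measurableType d} (mu : {measure set T -> \bar R}).
Context (mu1 : mu [set: T] = 1%E).
Implicit Types (f g : T -> R).

Definition intg f := mu.-integrable [set: T] (EFin \o f).
Definition Ex f : R := \int[mu]_x f x.

Lemma intg_measurable f : intg f -> measurable_fun [set: T] f.
Proof. by move=> /measurable_int /measurable_EFinP. Qed.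

Lemma intg_cst (r : R) : intg (cst r).
Proof.
apply/integrableP; split; first exact/measurable_EFinP/measurable_cst.
rewrite (_ : (fun x => _) = cst `|r|%:E)//.
by rewrite integral_cst ?measurableT// mu1 mule1 ltry.
Qed.

Lemma intgD f g : intg f -> intg g -> intg (fun x => f x + g x).
Proof. by move=> If Ig; exact: (integrableD measurableT If Ig). Qed.

Lemma intgB f g : intg f -> intg g -> intg (fun x => f x - g x).
Proof. by move=> If Ig; exact: (integrableB measurableT If Ig). Qed.

Lemma intgZ (r : R) f : intg f -> intg (fun x => r * f x).
Proof. by move=> If; exact: (integrableZl measurableT r If). Qed.

Lemma intg_sum (I : Type) (s : seq I) (F : I -> T -> R) :
  (forall i, intg (F i)) -> intg (fun x => \sum_(i <- s) F i x).
Proof.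
move=> IF; elim: s => [|i s IH].
  by under eq_fun do rewrite big_nil; exact: intg_cst.
by under eq_fun do rewrite big_cons; exact: intgD.
Qed.

Lemma ExD f g : intg f -> intg g -> Ex (fun x => f x + g x) = Ex f + Ex g.
Proof. by move=> If Ig; exact: RintegralD. Qed.

Lemma ExB f g : intg f -> intg g -> Ex (fun x => f x - g x) = Ex f - Ex g.
Proof. by move=> If Ig; exact: RintegralB. Qed.

Lemma ExZ (r : R) f : intg f -> Ex (fun x => r * f x) = r * Ex f.
Proof. by move=> If; exact: RintegralZl. Qed.

Lemma Ex_cst (r : R) : Ex (cst r) = r.
Proof. by rewrite /Ex Rintegral_cst ?measurableT// mu1 mulr1. Qed.

Lemma Ex_sum (I : Type) (s : seq I) (F : I -> T -> R) :
  (forall i, intg (F i)) -> Ex (fun x => \sum_(i <- s) F i x) = \sum_(i <- s) Ex (F i).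
Proof.
move=> IF; elim: s => [|i s IH].
  by under [X in Ex X]eq_fun do rewrite big_nil; rewrite big_nil Ex_cst.
under [X in Ex X]eq_fun do rewrite big_cons; rewrite big_cons ExD// ?IH//.
exact: intg_sum.
Qed.

Lemma Ex_le f g : intg f -> intg g -> (forall x, f x <= g x) -> Ex f <= Ex g.
Proof. by move=> If Ig fg; exact: le_Rintegral. Qed.

Lemma EFin_Ex f : intg f -> (\int[mu]_x (f x)%:E = (Ex f)%:E)%E.
Proof. by move=> If; rewrite /Ex /Rintegral fineK//; exact: integrable_fin_num. Qed.

Lemma intg_ge0 f (B : R) : measurable_fun [set: T] f -> (forall x, 0 <= f x) ->
  (\int[mu]_x (f x)%:E <= B%:E)%E -> intg f /\ Ex f <= B.
Proof.
move=> mf f0 fB; have If : intg f.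
  apply/integrableP; split; first exact/measurable_EFinP.
  apply: (@le_lt_trans _ _ B%:E); last exact: ltry.
  by apply: le_trans fB; rewrite le_eqVlt; apply/orP; left; apply/eqP; apply: eq_integral => x _ /=; rewrite ger0_norm.
by split => //; rewrite -lee_fin -EFin_Ex.
Qed.

Lemma intg_le f g : measurable_fun [set: T] f -> intg g -> (forall x, `|f x| <= g x) -> intg f.
Proof.
move=> mf Ig fg; apply: (le_integrable measurableT _ _ Ig); first exact/measurable_EFinP.
by move=> x _ /=; rewrite lee_fin (le_trans (fg x))// ler_norm.
Qed.

Lemma intg_mul f g : measurable_fun [set: T] f -> measurable_fun [set: T] g ->
  intg (fun x => f x ^+ 2) -> intg (fun x => g x ^+ 2) -> intg (fun x => f x * g x).
Proof.
move=> mf mg If Ig; apply: (intg_le _ (intgD If Ig)); first exact: measurable_funM.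
move=> x; rewrite ler_norml; apply/andP; split.
  have := sqr_ge0 (f x + g x); have := sqr_ge0 (f x); have := sqr_ge0 (g x); lra.
have := sqr_ge0 (f x - g x); have := sqr_ge0 (f x); have := sqr_ge0 (g x); lra.
Qed.

Lemma intg_of_sqr f : measurable_fun [set: T] f -> intg (fun x => f x ^+ 2) -> intg f.
Proof.
move=> mf If; have I1 := intgD (intg_cst 1) If.
apply: (intg_le mf I1) => x /=; rewrite ler_norml; apply/andP; split.
  have := sqr_ge0 (f x + 1); have := sqr_ge0 (f x); lra.
have := sqr_ge0 (f x - 1); have := sqr_ge0 (f x); lra.
Qed.

Context {n : nat}.
Implicit Types (Z : T -> 'rV[R]_n).

Definition Exv Z : 'rV[R]_n := \row_i Ex (fun x => Z x 0 i).

Lemma intg_coord_sqr p Z : 0 < p -> mvec Z -> intg (fun x => pnorm p (Z x) ^+ 2) ->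
  forall i, intg (fun x => Z x 0 i ^+ 2).
Proof.
move=> p0 mZ IZ i; apply: (intg_le _ IZ).
  exact: measurable_funX.
move=> x; rewrite ger0_norm ?sqr_ge0// -real_normK ?num_real// lerXn2r ?nnegrE ?pnorm_ge0//.
exact: coord_le_pnorm.
Qed.

Lemma intg_coord p Z : 0 < p -> mvec Z -> intg (fun x => pnorm p (Z x) ^+ 2) ->
  forall i, intg (fun x => Z x 0 i).
Proof.
by move=> p0 mZ IZ i; apply: intg_of_sqr => //; exact: (intg_coord_sqr p0 mZ IZ).
Qed.

Lemma intg_dotv (a : 'rV[R]_n) Z : (forall i, intg (fun x => Z x 0 i)) ->
  intg (fun x => dotv a (Z x)) /\ Ex (fun x => dotv a (Z x)) = dotv a (Exv Z).
Proof.
move=> IZ; split; first by apply: intg_sum => i; exact: intgZ.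
rewrite /dotv Ex_sum; last by move=> i; exact: intgZ.
by apply: eq_bigr => i _; rewrite ExZ// mxE.
Qed.

(** All three parts come from E|Z - EZ|^2 = E|Z|^2 - |EZ|^2; the last one, Jensen's inequality, is
    the nonnegativity of the left side. *)
Lemma variance_le Z : mvec Z -> intg (fun x => pnorm 2 (Z x) ^+ 2) ->
  [/\ intg (fun x => pnorm 2 (Z x - Exv Z) ^+ 2),
      Ex (fun x => pnorm 2 (Z x - Exv Z) ^+ 2) <= Ex (fun x => pnorm 2 (Z x) ^+ 2) &
      pnorm 2 (Exv Z) ^+ 2 <= Ex (fun x => pnorm 2 (Z x) ^+ 2)].
Proof.
move=> mZ IZ; have IZi := intg_coord (ltr0n R 2) mZ IZ.
have [Id Ed] := intg_dotv (Exv Z) IZi.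
have E : (fun x => pnorm 2 (Z x - Exv Z) ^+ 2) = (fun x => pnorm 2 (Z x) ^+ 2
    - 2 * dotv (Exv Z) (Z x) + pnorm 2 (Exv Z) ^+ 2).
  by apply/funext => x; rewrite -!dotvv dotvBl !dotvBr (dotvC (Z x) (Exv Z)); ring.
have I1 := intgB IZ (intgZ 2 Id).
have I2 := intgD I1 (intg_cst (pnorm 2 (Exv Z) ^+ 2)).
have EE : Ex (fun x => pnorm 2 (Z x - Exv Z) ^+ 2) =
    Ex (fun x => pnorm 2 (Z x) ^+ 2) - pnorm 2 (Exv Z) ^+ 2.
  rewrite E ExD//; last exact: intg_cst.
  by rewrite ExB//; [rewrite ExZ// Ed Ex_cst dotvv; ring | exact: intgZ].
have V0 : 0 <= Ex (fun x => pnorm 2 (Z x - Exv Z) ^+ 2).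
  by apply: Rintegral_ge0 => x _; exact: sqr_ge0.
split; first by rewrite E.
  by rewrite EE gerBl sqr_ge0.
by rewrite -subr_ge0 -EE.
Qed.

(** The quadratic upper bound at [a] is integrated: its linear term vanishes because [Z] is centred.
    An extended integral on the left lets the bound itself prove finiteness later. *)
Lemma centred_step p (a : 'rV[R]_n) (t B : R) Z : 2 <= p -> mvec Z ->
  (forall i, intg (fun x => Z x 0 i)) -> Exv Z = 0 ->
  intg (fun x => pnorm p (Z x) ^+ 2) -> Ex (fun x => pnorm p (Z x) ^+ 2) <= B ->
  (\int[mu]_x (pnorm p (a + t *: Z x) ^+ 2)%:E
    <= (pnorm p a ^+ 2 + (p - 1) * t ^+ 2 * B)%:E)%E.
Proof.
move=> p2 mZ IZi EZ IZ ZB; have p0 : 0 < p by apply: lt_le_trans p2.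
have [j jP] := pnorm_sqr_smooth a p2.
have [Id Ed] := intg_dotv j IZi.
have I1 := intgD (intg_cst (pnorm p a ^+ 2)) (intgZ t Id).
have I2 := intgD I1 (intgZ ((p - 1) * t ^+ 2) IZ).
have H x : pnorm p (a + t *: Z x) ^+ 2 <=
    pnorm p a ^+ 2 + t * dotv j (Z x) + (p - 1) * t ^+ 2 * pnorm p (Z x) ^+ 2.
  apply: (le_trans (jP (t *: Z x))).
  by rewrite dotvZr pnormZ// exprMn real_normK ?num_real// mulrA.
apply: (@le_trans _ _ (\int[mu]_x (pnorm p a ^+ 2 + t * dotv j (Z x) +
     (p - 1) * t ^+ 2 * pnorm p (Z x) ^+ 2)%:E)%E).
  apply: ge0_le_integral => //.
  - by move=> x _; rewrite lee_fin sqr_ge0.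
  - apply/measurable_EFinP/measurable_funX/measurable_pnorm.
    by apply: mvecD; [exact: mvec_cst|exact: mvecZl].
  - exact: (measurable_int _ I2).
  - by move=> x _; rewrite lee_fin.
rewrite (EFin_Ex I2) lee_fin (ExD I1 (intgZ _ IZ)) (ExD (intg_cst _) (intgZ t Id)).
rewrite (ExZ t Id) Ed EZ dotv0r mulr0 addr0 (ExZ _ IZ) Ex_cst lerD2l ler_wpM2l//.
by rewrite mulr_ge0 ?sqr_ge0// subr_ge0 (le_trans _ p2)// ler1n.
Qed.

End RealExpectation.

(** * Mean-square Taylor remainder through Riemann sums *)

Section RiemannSums.
Context {R : realType}.

Lemma uniform_continuity01 (g : R -> R) (e : R) : continuous g -> 0 < e ->
  \forall N \near \oo, forall t, 0 <= t <= 1 -> forall s, `|s - t| <= N.+1%:R^-1 ->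
    `|g s - g t| <= e.
Proof.
move=> cg e0.
have /compact_near_coveringP cpt := @segment_compact R 0 1.
have := cpt nat \oo (fun N t => forall s, `|s - t| <= N.+1%:R^-1 -> `|g s - g t| <= e) _.
move=> H; have {}H : \forall N \near \oo, `[0, 1]%classic `<=`
    (fun t => forall s, `|s - t| <= N.+1%:R^-1 -> `|g s - g t| <= e).
  apply: H => t0 _.
  have e2 : 0 < e / 2 by rewrite divr_gt0.
  have /cvgrPdist_lt/(_ _ e2)/nbhs_ballP[r /= r0 rg] := cg t0.
  have r2 : 0 < r / 2 by rewrite divr_gt0.
  exists (ball t0 (r / 2), [set N | N.+1%:R^-1 < r / 2]) => /=.
    split; first exact: nbhsx_ballx.
    exact: (near_infty_natSinv_lt (PosNum r2)).
  move=> [t N] [/= tb Nr] s st; have {Nr}st := le_lt_trans st Nr.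
  have tt0 : `|t0 - t| < r / 2 by exact: tb.
  have h1 := rg t; have h2 := rg s.
  have {}h1 : `|g t0 - g t| < e / 2 by apply: h1; rewrite -ball_normE/=; lra.
  have {}h2 : `|g t0 - g s| < e / 2.
    apply: h2; rewrite -ball_normE/=.
    have -> : t0 - s = (t0 - t) - (s - t) by ring.
    by rewrite (le_lt_trans (ler_normB _ _))//; lra.
  have -> : g s - g t = (g t0 - g t) - (g t0 - g s) by ring.
  by rewrite (le_trans (ler_normB _ _))//; lra.
apply: filterS H => N H t t01; apply: H.
by rewrite /= in_itv.
Qed.

(** On each cell the increment of [phi] is a value of [g] times the mesh, by the mean value theorem,
    and uniform continuity replaces that value by the one at the left end. *)
Lemma riemann_sum_cvg (phi g : R -> R) : continuous g ->
  (forall t : R, 0 <= t <= 1 -> is_derive t 1 phi (g t)) ->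
  (fun N => \sum_(i < N.+1) g (i%:R / N.+1%:R) / N.+1%:R) @ \oo --> phi 1 - phi 0.
Proof.
move=> cg phig; apply/cvgrPdist_le => e e0.
apply: filterS (uniform_continuity01 cg e0) => N gN.
set M := N.+1%:R : R; have M0 : 0 < M by rewrite ltr0n.
have -> : phi 1 - phi 0 = \sum_(i < N.+1) (phi (i.+1%:R / M) - phi (i%:R / M)).
  rewrite -(big_mkord xpredT (fun i => phi (i.+1%:R / M) - phi (i%:R / M))).
  by rewrite telescope_sumr// mul0r divff// gt_eqF.
rewrite -sumrB (le_trans (ler_norm_sum _ _ _))//.
have S (i : 'I_N.+1) : `|phi (i.+1%:R / M) - phi (i%:R / M) - g (i%:R / M) / M| <= e / M.
  set a := i%:R / M.
  have a0 : 0 <= a by rewrite divr_ge0.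
  have aM : a + M^-1 <= 1.
    by rewrite /a -{2}(mul1r M^-1) -mulrDl natr1 ler_pdivrMr// mul1r ler_nat.
  have Mi : 0 < M^-1 by rewrite invr_gt0.
  have -> : i.+1%:R / M = a + M^-1 by rewrite -natr1 mulrDl mul1r.
  have [t t01|t t01] := @mvt01 R (fun t => phi (a + t * M^-1)) (fun t => g (a + t * M^-1) * M^-1).
    have D1 : is_derive (a + t * M^-1) 1 phi (g (a + t * M^-1)).
      apply: phig; move: t01 => /andP[t0 t1]; apply/andP; split.
        by rewrite addr_ge0// mulr_ge0// ltW.
      by rewrite (le_trans _ aM)// lerD2l ler_piMl// ltW.
    have D2 : is_derive t 1 (fun t : R => a + t * M^-1) (M^-1).
      have -> : (fun t : R => a + t * M^-1) = cst a + M^-1 \*: (id : R -> R).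
        by apply/funext => u; rewrite !fctE /GRing.scale_fun/= /GRing.scale/= mulrC.
      by apply: is_derive_eq; rewrite add0r /GRing.scale/= mulr1.
    exact: (@is_derive1_comp _ phi (fun t => a + t * M^-1)).
  rewrite mul1r mul0r addr0 => ->.
  rewrite -mulrBl normrM (gtr0_norm Mi) ler_wpM2r ?(ltW Mi)//.
  apply: gN.
    by rewrite a0/= (le_trans _ aM)// lerDl ltW.
  move: t01 => /andP[t0 t1].
  by rewrite [a + _]addrC addrK normrM (gtr0_norm Mi) ger0_norm// ler_piMl// ltW.
rewrite (le_trans (ler_sum _ (fun i _ => S i)))// sumr_const card_ord.
by rewrite -[_ *+ N.+1]mulr_natl -/M mulrCA divff ?gt_eqF// mulr1.
Qed.

End RiemannSums.

Section L2.
Context {R : realType} {d} {T : measurableType d} (mu : {measure set T -> \bar R}).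
Context (mu1 : mu [set: T] = 1%E).

(** Minkowski's inequality in L^2, reduced to E(XY) <= a b. AM-GM with weights needs positive
    bounds, so a and b are first enlarged by t > 0. *)
Lemma Ex_sqrD (X Y : T -> R) a b :
  measurable_fun [set: T] X -> measurable_fun [set: T] Y -> 0 <= a -> 0 <= b ->
  intg mu (fun x => X x ^+ 2) -> intg mu (fun x => Y x ^+ 2) ->
  Ex mu (fun x => X x ^+ 2) <= a ^+ 2 -> Ex mu (fun x => Y x ^+ 2) <= b ^+ 2 ->
  intg mu (fun x => (X x + Y x) ^+ 2) /\ Ex mu (fun x => (X x + Y x) ^+ 2) <= (a + b) ^+ 2.
Proof.
move=> mX mY a0 b0 IX IY EX EY.
have IXY := intg_mul mX mY IX IY.
have E : (fun x => (X x + Y x) ^+ 2) = (fun x => X x ^+ 2 + 2 * (X x * Y x) + Y x ^+ 2).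
  by apply/funext => x; ring.
have I1 := intgD IX (intgZ 2 IXY); have I2 := intgD I1 IY.
split; rewrite E//.
rewrite (ExD I1 IY) (ExD IX (intgZ 2 IXY)) (ExZ 2 IXY).
suff H : Ex mu (fun x => X x * Y x) <= a * b by lra.
have K (al be : R) : 0 < al -> 0 < be -> a <= al -> b <= be ->
    Ex mu (fun x => X x * Y x) <= al * be.
  move=> al0 be0 aal bbe.
  have I3 := intgZ (be / al / 2) IX; have I4 := intgZ (al / be / 2) IY.
  apply: (le_trans (Ex_le IXY (intgD I3 I4) _)).
    move=> x; have := mulr_ge0 (ltW (divr_gt0 ltr01 (mulr_gt0 al0 be0))) (sqr_ge0 (be * X x - al * Y x)).
    have -> : 1 / (al * be) * (be * X x - al * Y x) ^+ 2 =
      2 * (be / al / 2 * X x ^+ 2 + al / be / 2 * Y x ^+ 2 - X x * Y x).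
      by field; rewrite !gt_eqF.
    by rewrite pmulr_rge0// subr_ge0.
  rewrite (ExD I3 I4) (ExZ _ IX) (ExZ _ IY).
  have -> : al * be = be / al / 2 * al ^+ 2 + al / be / 2 * be ^+ 2 by field; rewrite !gt_eqF.
  apply: lerD; rewrite ler_wpM2l ?divr_ge0 ?(ltW al0) ?(ltW be0)//.
    by rewrite (le_trans EX)// lerXn2r// nnegrE (le_trans a0).
  by rewrite (le_trans EY)// lerXn2r// nnegrE (le_trans b0).
apply/ler_addgt0Pr => e e0.
(* As t <= 1, (a + t)(b + t) <= a b + t (a + b + 1) <= a b + e. *)
pose t := Num.min 1 (e / (a + b + 1)).
have ab1 : 0 < a + b + 1 by rewrite ltr_wpDl// addr_ge0.
have t0 : 0 < t by rewrite lt_min ltr01 divr_gt0.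
have t1 : t <= 1 by rewrite ge_min lexx.
have te : t * (a + b + 1) <= e by rewrite -ler_pdivlMr// ge_min lexx orbT.
apply: (le_trans (K (a + t) (b + t) _ _ _ _)); rewrite ?lerDl ?(ltW t0) ?ltr_wpDl//.
have : t * t <= t * 1 by rewrite ler_wpM2l// ltW.
by move: te; lra.
Qed.

Lemma Ex_sqr_sum (N : nat) (X : nat -> T -> R) (a : nat -> R) :
  (forall i, (i < N)%N -> [/\ measurable_fun [set: T] (X i), 0 <= a i,
     intg mu (fun x => X i x ^+ 2) & Ex mu (fun x => X i x ^+ 2) <= a i ^+ 2]) ->
  intg mu (fun x => (\sum_(i < N) X i x) ^+ 2) /\
  Ex mu (fun x => (\sum_(i < N) X i x) ^+ 2) <= (\sum_(i < N) a i) ^+ 2.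
Proof.
elim: N => [_|N IH H].
  have -> : (fun x : T => (\sum_(i < 0) X i x) ^+ 2) = cst 0.
    by apply/funext => x; rewrite big_ord0 expr0n.
  by rewrite big_ord0 expr0n/= Ex_cst//; split=> //; exact: intg_cst.
have [IN EN] := IH (fun i iN => H i (ltnW iN)).
have [mN aN IX EX] := H N (ltnSn N).
have := Ex_sqrD _ mN _ aN IN IX EN EX.
have -> : (fun x : T => (\sum_(i < N) X i x + X N x) ^+ 2) =
   (fun x => (\sum_(i < N.+1) X i x) ^+ 2).
  by apply/funext => x; rewrite big_ord_recr.
rewrite big_ord_recr/=; apply.
  by apply: measurable_sum => i; have [] := H i (ltnW (ltn_ord i)).
by apply: sumr_ge0 => i _; have [] := H i (ltnW (ltn_ord i)).
Qed.

(* Fatou along Riemann sums replaces the exchange of E with the integral over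
   the segment [x, x + w]. *)
Lemma taylor_remainder_L2 {n : nat} (F : 'rV[R]_n -> T -> R) (x w : 'rV[R]_n) (L : R) :
  0 <= L -> (forall z, cont_diff (F ^~ z)) -> (forall x, measurable_fun [set: T] (F x)) ->
  (forall t : R, 0 <= t <= 1 -> mvec (fun z => grad (F ^~ z) (x + t *: w))) ->
  (forall t : R, 0 <= t <= 1 ->
    (\int[mu]_z (pnorm 2 (grad (F ^~ z) (x + t *: w) - grad (F ^~ z) x) ^+ 2)%:E
      <= ((L * (t * pnorm 2 w)) ^+ 2)%:E)%E) ->
  (\int[mu]_z ((F (x + w) z - F x z - dotv (grad (F ^~ z) x) w) ^+ 2)%:E
    <= ((L / 2 * pnorm 2 w ^+ 2) ^+ 2)%:E)%E.
Proof.
move=> L0 FC mF mg gL.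
have m0 : mvec (fun z => grad (F ^~ z) x).
  by have := mg 0; rewrite scale0r addr0; apply; rewrite lexx ler01.
pose g (t : R) z : R := dotv (grad (F ^~ z) (x + t *: w) - grad (F ^~ z) x) w.
pose S N z := \sum_(i < N.+1) g (i%:R / N.+1%:R) z / N.+1%:R.
have M0 N : 0 < N.+1%:R :> R by rewrite ltr0n.
have iN01 N i : (i < N.+1)%N -> 0 <= (i%:R / N.+1%:R : R) <= 1.
  by move=> iN; rewrite divr_ge0//= ler_pdivrMr// mul1r ler_nat ltnW.
have mgt t : 0 <= t <= 1 -> measurable_fun [set: T] (g t).
  move=> t01; apply: measurable_dotv; last exact: mvec_cst.
  by apply: mvecB => //; exact: mg.
have cvgS z : (S ^~ z) @ \oo --> F (x + w) z - F x z - dotv (grad (F ^~ z) x) w.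
  have D (t : R) : is_derive t 1 (fun t => F (x + t *: w) z - t * dotv (grad (F ^~ z) x) w) (g t z).
    have D1 := @line_derive _ _ (F ^~ z) x w t ((FC z).1 _).
    have -> : (fun t => F (x + t *: w) z - t * dotv (grad (F ^~ z) x) w) =
      (fun t : R => F (x + t *: w) z) - dotv (grad (F ^~ z) x) w \*: (id : R -> R).
      by apply/funext => u; rewrite !fctE /GRing.scale_fun/= /GRing.scale/= mulrC.
    by apply: is_derive_eq; rewrite /g dotvBl /GRing.scale/= mulr1.
  have cg : continuous (g ^~ z).
    have c1 : continuous (fun t : R => dotv w (grad (F ^~ z) (x + t *: w))).
      move=> t; apply: (@continuous_comp R 'rV[R]_n R (fun t => grad (F ^~ z) (x + t *: w)) (dotv w) t).
        apply: (@continuous_comp R 'rV[R]_n 'rV[R]_n (fun t => x + t *: w) (grad (F ^~ z)) t).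
          exact: line_continuous.
        exact: (FC z).2.
      exact: dotv_continuous.
    have -> : g ^~ z = (fun t => dotv w (grad (F ^~ z) (x + t *: w)) - dotv (grad (F ^~ z) x) w).
      by apply/funext => u; rewrite /g dotvBl dotvC.
    by move=> t; apply: cvgB; [exact: c1|exact: cvg_cst].
  have := riemann_sum_cvg cg (fun t _ => D t).
  by rewrite scale1r scale0r addr0 mul1r mul0r subr0 addrAC.
have bS N : (\int[mu]_z (S N z ^+ 2)%:E <= ((L / 2 * pnorm 2 w ^+ 2) ^+ 2)%:E)%E.
  (* Bound on the L^2 norm of the i-th summand: the Lipschitz bound at t = i / (N + 1), times |w|
     from Cauchy-Schwarz, times the mesh. *)
  pose a (i : nat) := L * (i%:R / N.+1%:R * pnorm 2 w) * pnorm 2 w / N.+1%:R.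
  have a0 i : 0 <= a i.
    by rewrite /a !mulr_ge0 ?pnorm_ge0 ?invr_ge0 ?(ltW (M0 N)).
  have [|IS ES] := @Ex_sqr_sum N.+1 (fun i z => g (i%:R / N.+1%:R) z / N.+1%:R) a.
    move=> i iN; have i01 := iN01 N i iN.
    have mgi : measurable_fun [set: T] (fun z => g (i%:R / N.+1%:R) z / N.+1%:R).
      by apply: measurable_funM; [exact: mgt|exact: measurable_cst].
    have [Ig Eg] : intg mu (fun z => pnorm 2 (grad (F ^~ z) (x + (i%:R / N.+1%:R) *: w) - grad (F ^~ z) x) ^+ 2) /\
      Ex mu (fun z => pnorm 2 (grad (F ^~ z) (x + (i%:R / N.+1%:R) *: w) - grad (F ^~ z) x) ^+ 2) <=
        (L * (i%:R / N.+1%:R * pnorm 2 w)) ^+ 2.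
      apply: intg_ge0; last exact: gL.
        by apply/measurable_funX/measurable_pnorm/mvecB => //; exact: mg.
      by move=> z; exact: sqr_ge0.
    have I2 := intgZ ((pnorm 2 w / N.+1%:R) ^+ 2) Ig.
    have le z : (g (i%:R / N.+1%:R) z / N.+1%:R) ^+ 2 <=
       (pnorm 2 w / N.+1%:R) ^+ 2 * pnorm 2 (grad (F ^~ z) (x + (i%:R / N.+1%:R) *: w) - grad (F ^~ z) x) ^+ 2.
      rewrite [_ ^+ 2 * _]mulrC -exprMn mulrA [leRHS]exprMn [leLHS]exprMn ler_wpM2r ?sqr_ge0//.
      by rewrite -real_normK ?num_real// lerXn2r ?nnegrE ?mulr_ge0 ?pnorm_ge0// dotv_cauchy.
    have IX : intg mu (fun z => (g (i%:R / N.+1%:R) z / N.+1%:R) ^+ 2).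
      apply: (intg_le _ I2); first exact: measurable_funX.
      by move=> z; rewrite ger0_norm ?sqr_ge0.
    split => //; apply: (le_trans (Ex_le IX I2 le)); rewrite (ExZ _ Ig).
    apply: (le_trans (ler_wpM2l (sqr_ge0 _) Eg)).
    by rewrite /a -exprMn le_eqVlt; apply/orP; left; apply/eqP; congr (_ ^+ 2); ring.
  rewrite (EFin_Ex IS) lee_fin (le_trans ES)// lerXn2r ?nnegrE//.
  - by apply: sumr_ge0.
  - by rewrite mulr_ge0 ?sqr_ge0// divr_ge0.
  have -> : \sum_(i < N.+1) a i = L * pnorm 2 w ^+ 2 * (\sum_(i < N.+1) i%:R) / N.+1%:R ^+ 2.
    rewrite mulr_sumr mulr_suml; apply: eq_bigr => i _; rewrite /a; field.
    by rewrite gt_eqF.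
  (* Left Riemann sums of t stay below 1/2, so L / 2 bounds every sum and not just the limit, as
     Fatou requires. *)
  have -> : \sum_(i < N.+1) i%:R = N.+1%:R * N%:R / 2 :> R.
    elim: N {a a0 IS ES} => [|N IH]; first by rewrite big_ord1 mulr0 mul0r.
    by rewrite big_ord_recr/= IH -!natr1; field.
  have -> : L * pnorm 2 w ^+ 2 * (N.+1%:R * N%:R / 2) / N.+1%:R ^+ 2 =
     (L / 2 * pnorm 2 w ^+ 2) * (N%:R / N.+1%:R) by field; rewrite gt_eqF.
  rewrite ler_piMr//; first by rewrite mulr_ge0 ?sqr_ge0// divr_ge0.
  by rewrite ler_pdivrMr// mul1r ler_nat.
have mS N : measurable_fun [set: T] (S N).
  apply: measurable_sum => i.
  by apply: measurable_funM; [exact/mgt/iN01|exact: measurable_cst].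
have := @fatou _ T R mu setT measurableT (fun N z => (S N z ^+ 2)%:E) _ _.
have -> : (\int[mu]_z limn_einf (fun N => (S N z ^+ 2)%:E) =
   \int[mu]_z ((F (x + w) z - F x z - dotv (grad (F ^~ z) x) w) ^+ 2)%:E)%E.
  apply: eq_integral => z _; apply: (cvg_limn_einf_sup _).1.
  apply/cvg_EFin; first by apply: nearW.
  apply: (@cvg_comp _ _ _ (S ^~ z) (fun r : R => r ^+ 2)); first exact: cvgS.
  exact: exprn_continuous.
move=> H; apply: (le_trans (H _ _)).
- by move=> N; apply/measurable_EFinP/measurable_funX.
- by move=> N z _; rewrite lee_fin sqr_ge0.
rewrite limn_einf_lim; apply: lime_le; first exact: is_cvg_einfs.
apply: nearW => N; apply: le_trans (bS N).
by apply: ereal_inf_lbound; exists N => /=.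
Qed.

End L2.

(** * The topological support of the direction law *)

Section Support.
Context {R : realType} {n : nat} (Pu : probability (borelRV R n) R).

(** A point outside the support has a null open neighbourhood, hence lies in a rational box
    contained in a null open set, and there are countably many such boxes. *)
Lemma msupport_ae : {ae Pu, forall u, msupport Pu (u : 'rV[R]_n)}.
Proof.
pose box (a : 'rV[rat]_n * nat) : set 'rV[R]_n :=
  [set y | forall i, `|ratr (a.1 0 i) - y 0 i| < a.2.+1%:R^-1].
pose C := [set a | exists U : set 'rV[R]_n, [/\ open U, (Pu U <= 0)%E & box a `<=` U]].
pose N k : set (borelRV R n) := if (choice.unpickle k : option ('rV[rat]_n * nat)) is Some a then (if a \in C then box a else set0) else set0.
have : Pu.-negligible (\bigcup_k N k).
  apply: negligible_bigcup => k; rewrite /N; case: choice.unpickle => [a|]; last exact: negligible_set0.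
  case: ifPn => [/set_mem[U [oU PU aU]]|_]; last exact: negligible_set0.
  exists U; split => //; first exact: sub_sigma_algebra.
  by apply/eqP; rewrite eq_le PU measure_ge0.
apply: negligibleS => u /= nu.
have [U [oU Uu PU]] : exists U : set 'rV[R]_n, [/\ open U, U u & (Pu U <= 0)%E].
  apply: contrapT => nex; apply: nu => U oU Uu; rewrite ltNge; apply/negP => PU.
  by apply: nex; exists U.
have [a [ua aU]] := rV_rational_box oU Uu.
exists (choice.pickle a) => //; rewrite /N choice.pickleK mem_set//.
by exists U.
Qed.

(** The smoothing domain contains [X] only through some admissible direction taken with t = 0. *)
Lemma msupport_nonempty : exists u, msupport Pu u.
Proof.
apply: contrapT => nex; have [B [mB B0 sB]] := msupport_ae.
have BT : B = setT by apply/seteqP; split => // u _; apply: sB => /= su; apply: nex; exists u.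
by move: B0; rewrite BT probability_setT => /eqP; rewrite eqe oner_eq0.
Qed.

End Support.

Lemma product_probability_setT {R : realType} {d1 d2} {T1 : measurableType d1} {T2 : measurableType d2}
  (Q1 : probability T1 R) (Q2 : probability T2 R) :
  ((Q1 \x Q2) [set: (T1 * T2)%type] = 1)%E.
Proof. exact: (@probability_setT _ _ _ ((Q1 \x Q2)%E : probability _ R)). Qed.

Section Moments.
Context {R : realType} {d : nat} (p : R) (hp : 2 <= p).
Context {dX : measure_display} {Xi : measurableType dX} (P : probability Xi R).
Context (Pu : probability (borelRV R d) R).
Context (Sp : R) (hSp : 1 <= Sp)
  (hSpE : forall g : 'rV[R]_d,
     ('E_Pu[fun u : borelRV R d => (pnorm p (dotv g (u : 'rV[R]_d) *: (u : 'rV[R]_d)) ^+ 2)%R]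
        <= (Sp * pnorm 2 g ^+ 2)%R%:E)%E)
  (hcov : forall i j : 'I_d,
     ('E_Pu[fun u : borelRV R d => ((u : 'rV[R]_d) 0 i * (u : 'rV[R]_d) 0 j)%R]
       = ((i == j)%:R)%R%:E)%E)
  (hu6 : ('E_Pu[fun u : borelRV R d => (pnorm 2 (u : 'rV[R]_d) ^+ 6)%R] < +oo)%E).

Let mu := (Pu \x P)%E.
Let T : measurableType _ := (borelRV R d * Xi)%type.

Let mu_u : mvec (fun t : T => (t.1 : 'rV[R]_d)).
Proof. by apply/mvecP; exact: measurable_fst. Qed.

Let m_u : mvec (fun u : borelRV R d => (u : 'rV[R]_d)).
Proof. by apply/mvecP; exact: measurable_id. Qed.

Let noise (G : Xi -> 'rV[R]_d) (t : T) : 'rV[R]_d := dotv (G t.2) t.1 *: (t.1 : 'rV[R]_d).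

Lemma mvec_noise G : mvec G -> mvec (noise G).
Proof.
move=> mG; have mG2 : mvec (fun t : T => G t.2).
  by move=> i; exact: (measurableT_comp (mG i) measurable_snd).
by apply: mvecZ => //; exact: measurable_dotv.
Qed.

(** The direction is integrated first, with [z] and hence the vector [G z] fixed, so that the moment
    condition of (A4) applies to it. *)
Lemma noise_moment G (B : R) : mvec G ->
  (\int[P]_z (pnorm 2 (G z) ^+ 2)%:E <= B%:E)%E ->
  intg mu (fun t => pnorm p (noise G t) ^+ 2) /\
  Ex mu (fun t => pnorm p (noise G t) ^+ 2) <= Sp * B.
Proof.
move=> mG GB; have mN := mvec_noise mG.
have Sp0 : 0 <= Sp by rewrite (le_trans _ hSp).
apply: intg_ge0.
- exact/measurable_funX/measurable_pnorm.
- by move=> t; exact: sqr_ge0.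
rewrite /mu fubini_tonelli1//=; last 2 first.
  - exact/measurable_EFinP/measurable_funX/measurable_pnorm.
  - by move=> t; rewrite lee_fin sqr_ge0.
rewrite fubini_tonelli//=; last 2 first.
  - exact/measurable_EFinP/measurable_funX/measurable_pnorm.
  - by move=> t; rewrite lee_fin sqr_ge0.
rewrite /fubini_G /=.
apply: (@le_trans _ _ (\int[P]_z (Sp%:E * (pnorm 2 (G z) ^+ 2)%:E))%E).
  apply: ge0_le_integral => //.
  - by move=> z _; apply: integral_ge0 => u _; rewrite lee_fin sqr_ge0.
  - apply: (@measurable_fun_fubini_tonelli_G _ _ _ _ _ Pu (fun t => (pnorm p (noise G t) ^+ 2)%:E)).
      exact/measurable_EFinP/measurable_funX/measurable_pnorm.
    by move=> t; rewrite lee_fin sqr_ge0.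
  - apply/measurable_EFinP/measurable_funM; first exact: measurable_cst.
    exact/measurable_funX/measurable_pnorm.
  - move=> z _; have := hSpE (G z); rewrite unlock /=.
    by rewrite -EFinM.
rewrite ge0_integralZl_EFin//=.
- by rewrite EFinM lee_wpmul2l// lee_fin.
- by move=> z _; rewrite lee_fin sqr_ge0.
- exact/measurable_EFinP/measurable_funX/measurable_pnorm.
Qed.

(** A value of an expectation does not by itself give integrability. On the diagonal the integrand
    is nonnegative with finite integral, and the other products are dominated by squares. *)
Lemma intg_uu i j : intg Pu (fun u : borelRV R d => (u : 'rV[R]_d) 0 i * (u : 'rV[R]_d) 0 j) /\
  Ex Pu (fun u : borelRV R d => (u : 'rV[R]_d) 0 i * (u : 'rV[R]_d) 0 j) = (i == j)%:R.
Proof.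
have Ii k : intg Pu (fun u : borelRV R d => ((u : 'rV[R]_d) 0 k) ^+ 2).
  have [] // := @intg_ge0 _ _ _ Pu (fun u : borelRV R d => ((u : 'rV[R]_d) 0 k) ^+ 2) 1.
  - exact/measurable_funX.
  - by move=> u; exact: sqr_ge0.
  - by have := hcov k k; rewrite eqxx unlock => <-.
have Iij : intg Pu (fun u : borelRV R d => (u : 'rV[R]_d) 0 i * (u : 'rV[R]_d) 0 j).
  exact: (intg_mul (m_u i) (m_u j) (Ii i) (Ii j)).
split => //; apply: EFin_inj; rewrite -EFin_Ex//.
by have := hcov i j; rewrite unlock.
Qed.

(** For fixed [z], the mean of <G, u> u is E[u u^T] G = G; the double integral is then taken in that
    order. *)
Lemma noise_mean G : mvec G -> (forall i, intg P (fun z => G z 0 i)) ->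
  (forall i, intg mu (fun t => noise G t 0 i)) ->
  Exv mu (noise G) = Exv P G.
Proof.
move=> mG IG IN; apply/rowP => i; rewrite !mxE.
apply: EFin_inj; rewrite -(EFin_Ex (IN i)) -(EFin_Ex (IG i)).
rewrite -(integral21_prod_meas1 (IN i)) /fubini_G.
apply: eq_integral => z _ /=.
have -> : (fun u : borelRV R d => (noise G (u, z) 0 i)%:E) = (fun u : borelRV R d =>
    (\sum_(l <- index_enum 'I_d) G z 0 l * ((u : 'rV[R]_d) 0 l * (u : 'rV[R]_d) 0 i))%:E).
  apply/funext => u; congr EFin; rewrite mxE /= /dotv mulr_suml.
  by apply: eq_bigr => l _; rewrite mulrA.
have Pu1 := @probability_setT _ _ _ Pu.
have IS l : intg Pu (fun u : borelRV R d => G z 0 l * ((u : 'rV[R]_d) 0 l * (u : 'rV[R]_d) 0 i)).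
  exact: intgZ (intg_uu l i).1.
rewrite (EFin_Ex (intg_sum Pu1 _ IS)) (Ex_sum Pu1 _ IS); congr EFin.
rewrite (bigD1 i)//= big1 ?addr0.
  by rewrite (ExZ _ (intg_uu i i).1) (intg_uu i i).2 eqxx mulr1.
by move=> l li; rewrite (ExZ _ (intg_uu l i).1) (intg_uu l i).2 (negbTE li) mulr0.
Qed.

End Moments.

(** * The stochastic recursion *)

Section Filtration.
Context {d} {Omega : measurableType d} {I : choiceType} (G : I -> set (set Omega)).
Implicit Types A B : set I.

Notation OA A := (g_sigma_algebraType (sigma_of G A)).

Lemma sigma_of_sub A B E : A `<=` B -> <<s sigma_of G A >> E -> <<s sigma_of G B >> E.
Proof.
move=> AB; move: E; apply: smallest_sub; first exact: smallest_sigma_algebra.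
by move=> F [i Ai GF]; apply: sub_sigma_algebra; exists i => //; exact: AB.
Qed.

Lemma measurable_fun_sigma_of A B {d'} {T' : measurableType d'} (f : Omega -> T') :
  A `<=` B -> measurable_fun [set: OA A] f -> measurable_fun [set: OA B] f.
Proof.
by move=> AB mf mT E mE; apply: (sigma_of_sub AB); exact: mf.
Qed.

Lemma mvec_sigma_of A B {R : realType} {n} (f : Omega -> 'rV[R]_n) :
  A `<=` B -> @mvec _ (OA A) R n f -> @mvec _ (OA B) R n f.
Proof. by move=> AB mf i; exact: (measurable_fun_sigma_of AB). Qed.

Lemma measurable_source A i {d'} {T' : measurableType d'} (f : Omega -> T') :
  A i -> (forall C, measurable C -> G i (f @^-1` C)) -> measurable_fun [set: OA A] f.
Proof.
move=> Ai Gf _ B mB; rewrite setTI; apply: sub_sigma_algebra.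
by exists i => //; exact: Gf.
Qed.

End Filtration.

(** * Integrating out a batch of fresh direction-sample pairs *)

Section FreshPair.
Context {R : realType} {d} {Omega : measurableType d} (Pr : probability Omega R).
Context {I : choiceType} (D : set I) (G : I -> set (set Omega)).
Context (Gm : forall i, D i -> G i `<=` measurable)
  (GI : forall i, D i -> setI_closed (G i)) (GT : forall i, D i -> G i setT).
Context (ind : mutually_independent Pr D G).
Context {d1 d2} {T1 : measurableType d1} {T2 : measurableType d2}
  (Q1 : probability T1 R) (Q2 : probability T2 R).

Notation OA A := (g_sigma_algebraType (sigma_of G A)).

Lemma sigma_of_measurable A : A `<=` D -> sigma_of G A `<=` measurable.
Proof. by move=> AD E [i /AD Di]; exact: Gm. Qed.

(** [freeze] is used twice: the second variable is integrated out with the first one counted in the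
    past, then the first one; Fubini recombines the two integrals. *)
Lemma freeze_pair A i1 i2 (Y1 : Omega -> T1) (Y2 : Omega -> T2)
    (g : OA A * (T1 * T2) -> \bar R) :
  A `<=` D -> D i1 -> D i2 -> ~ A i1 -> ~ A i2 -> i1 != i2 ->
  (forall B, measurable B -> G i1 (Y1 @^-1` B)) ->
  (forall B, measurable B -> G i2 (Y2 @^-1` B)) ->
  has_law Pr Y1 Q1 -> has_law Pr Y2 Q2 ->
  measurable_fun setT g -> (forall z, 0 <= g z)%E ->
  (\int[Pr]_w g (w, (Y1 w, Y2 w)) = \int[Pr]_w \int[(Q1 \x Q2)%E]_t g (w, t))%E.
Proof.
move=> AD D1 D2 nA1 nA2 i12 G1 G2 [mY1 law1] [mY2 law2] mg g0.
pose A' := A `|` [set i1].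
have A'D : A' `<=` D by move=> i [/AD//|/= ->].
have nA'2 : ~ A' i2 by move=> [//|/= i21]; move: i12; rewrite i21 eqxx.
have AA' : A `<=` A' by move=> i; left.
have ind2 E B : <<s sigma_of G A' >> E -> measurable B ->
    (Pr (E `&` Y2 @^-1` B) = Pr E * Q2 B)%E.
  move=> sE mB; rewrite (indep_sigma_of Gm GI GT ind A'D D2 nA'2 sE (G2 _ mB)).
  by rewrite law2.
have ind1 E B : <<s sigma_of G A >> E -> measurable B ->
    (Pr (E `&` Y1 @^-1` B) = Pr E * Q1 B)%E.
  move=> sE mB; rewrite (indep_sigma_of Gm GI GT ind AD D1 nA1 sE (G1 _ mB)).
  by rewrite law1.
have mY1' : measurable_fun [set: OA A'] Y1 by apply: (measurable_source (i := i1)) => //; right.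
pose g2 (z : OA A' * T2) : \bar R := g (z.1, (Y1 z.1, z.2)).
have mg2 : measurable_fun setT g2.
  apply: (measurableT_comp mg).
  apply: measurable_fun_pair; last apply: measurable_fun_pair.
  - have mid : measurable_fun [set: OA A'] (id : OA A' -> OA A).
      by move=> _ E mE; rewrite setTI; exact: (sigma_of_sub AA').
    exact: (measurableT_comp mid measurable_fst).
  - exact: (measurableT_comp mY1' measurable_fst).
  - exact: measurable_snd.
rewrite (freeze (sigma_of_measurable A'D) mY2 ind2 mg2 (fun z => g0 _)).
pose f1 (z : (OA A * T1) * T2) : \bar R := g (z.1.1, (z.1.2, z.2)).
have mf1 : measurable_fun setT f1.
  apply: (measurableT_comp mg).
  apply: measurable_fun_pair; last apply: measurable_fun_pair.
  - exact: (measurableT_comp measurable_fst measurable_fst).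
  - exact: (measurableT_comp measurable_snd measurable_fst).
  - exact: measurable_snd.
pose g1 := fubini_F Q2 f1.
have mg1 : measurable_fun setT g1 by apply: measurable_fun_fubini_tonelli_F => // z; exact: g0.
rewrite (freeze (sigma_of_measurable AD) mY1 ind1 (g := g1) mg1); last first.
  by move=> z; apply: integral_ge0 => t _; exact: g0.
apply: eq_integral => w _.
rewrite fubini_tonelli1//; first exact: (measurableT_comp mg (pair1_measurable _)).
Qed.

Context (p : R) (hp : 2 <= p) {n : nat}.
Context (N : nat) (i1 i2 : nat -> I) (Y1 : nat -> Omega -> T1) (Y2 : nat -> Omega -> T2).
Context (A : set I) (AD : A `<=` D).
Context (D1 : forall j, (j < N)%N -> D (i1 j)) (D2 : forall j, (j < N)%N -> D (i2 j)).
Context (nA1 : forall j, (j < N)%N -> ~ A (i1 j)) (nA2 : forall j, (j < N)%N -> ~ A (i2 j)).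
Context (inj1 : injective i1) (inj2 : injective i2) (i12 : forall j l, i1 j != i2 l).
Context (G1 : forall j C, (j < N)%N -> measurable C -> G (i1 j) (Y1 j @^-1` C))
  (G2 : forall j C, (j < N)%N -> measurable C -> G (i2 j) (Y2 j @^-1` C)).
Context (law1 : forall j, (j < N)%N -> has_law Pr (Y1 j) Q1)
  (law2 : forall j, (j < N)%N -> has_law Pr (Y2 j) Q2).

Definition sources_upto j : set I :=
  A `|` [set i | exists2 l, (l < j)%N & i = i1 l \/ i = i2 l].

Lemma sources_uptoD j : (j <= N)%N -> sources_upto j `<=` D.
Proof.
move=> jN i [/AD//|[l lj [->|->]]]; [apply: D1|apply: D2]; exact: leq_trans jN.
Qed.

Context (Z : Omega -> T1 * T2 -> 'rV[R]_n) (B : Omega -> R) (e : Omega -> 'rV[R]_n) (t : R).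
Context (mZ : @mvec _ (OA A * (T1 * T2))%type R n (fun z => Z z.1 z.2)).
Context (me : @mvec _ (OA A) R n e).
Context (IZ : forall w i, intg (Q1 \x Q2)%E (fun y => Z w y 0 i))
  (EZ : forall w, Exv (Q1 \x Q2)%E (Z w) = 0)
  (IZ2 : forall w, intg (Q1 \x Q2)%E (fun y => pnorm p (Z w y) ^+ 2))
  (EZ2 : forall w, Ex (Q1 \x Q2)%E (fun y => pnorm p (Z w y) ^+ 2) <= B w).
Context (B0 : forall w, 0 <= B w) (mB : measurable_fun [set: OA A] B).

Let Q12 : probability (T1 * T2)%type R := (Q1 \x Q2)%E.

Let part j w := e w + t *: \sum_(l < j) Z w (Y1 l w, Y2 l w).

Lemma mvec_partial_sum j : (j <= N)%N -> @mvec _ (OA (sources_upto j)) R n (part j).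
Proof.
move=> jN; have Asub : A `<=` sources_upto j by move=> i; left.
apply: mvecD; first exact: (mvec_sigma_of Asub).
apply: mvecZl.
rewrite (_ : (fun w => _) = (fun w => \sum_(l <- index_enum 'I_j) Z w (Y1 l w, Y2 l w)))//.
apply: mvec_sum => l i.
have lN : (l < N)%N by exact: leq_trans jN.
suff mp : measurable_fun [set: OA (sources_upto j)] (fun w => ((w : OA A), (Y1 l w, Y2 l w))).
  exact: (measurableT_comp (mZ i) mp).
apply: measurable_fun_pair.
  by move=> _ E mE; rewrite setTI; exact: (sigma_of_sub Asub).
apply: measurable_fun_pair.
  apply: (measurable_source (i := i1 l)); first by right; exists l => //; left.
  by move=> C; exact: G1.
apply: (measurable_source (i := i2 l)); first by right; exists l => //; right.
by move=> C; exact: G2.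
Qed.

(* The samples of a batch are added one at a time, so that the earlier ones belong to
   the past of the next one. *)
Lemma partial_sum_moment j : (j <= N)%N ->
  (\int[Pr]_w (pnorm p (part j w) ^+ 2)%:E <= \int[Pr]_w (pnorm p (e w) ^+ 2)%:E +
    (j%:R * (p - 1) * t ^+ 2)%:E * \int[Pr]_w (B w)%:E)%E.
Proof.
have mBr : measurable_fun [set: Omega] (EFin \o B).
  apply/measurable_EFinP; exact: (measurable_fun_sub (sigma_of_measurable AD) mB).
have IB0 : (0 <= \int[Pr]_w (B w)%:E)%E by apply: integral_ge0 => w _; rewrite lee_fin.
have c0 k : (0 <= (k%:R * (p - 1) * t ^+ 2)%:E)%E.
  by rewrite lee_fin mulr_ge0 ?sqr_ge0// mulr_ge0// subr_ge0 (le_trans _ hp)// ler1n.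
elim: j => [_|j IH jN].
  rewrite !mul0r mul0e adde0 le_eqVlt; apply/orP; left; apply/eqP.
  by apply: eq_integral => w _; rewrite /part big_ord0 scaler0 addr0.
have jN' := ltnW jN; have {}IH := IH jN'.
pose A' := sources_upto j.
have A'D : A' `<=` D by exact: sources_uptoD.
have AA' : A `<=` A' by move=> i; left.
pose g (z : OA A' * (T1 * T2)) : \bar R := (pnorm p (part j z.1 + t *: Z z.1 z.2) ^+ 2)%:E.
have mg : measurable_fun setT g.
  apply/measurable_EFinP/measurable_funX/measurable_pnorm; apply: mvecD.
    by move=> i; exact: (measurableT_comp (mvec_partial_sum jN' i) measurable_fst).
  apply: mvecZl => i.
  have mid : measurable_fun [set: OA A'] (id : OA A' -> OA A).
    by move=> _ E mE; rewrite setTI; exact: (sigma_of_sub AA').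
  suff mp : measurable_fun setT (fun z : OA A' * (T1 * T2) => ((z.1 : OA A), z.2)).
    exact: (measurableT_comp (mZ i) mp).
  apply: measurable_fun_pair; last exact: measurable_snd.
  exact: (measurableT_comp mid measurable_fst).
have g0 z : (0 <= g z)%E by rewrite lee_fin sqr_ge0.
have nA'1 : ~ A' (i1 j).
  move=> [|[l lj [/inj1 jl|/eqP]]]; first exact: nA1.
    by move: lj; rewrite jl ltnn.
  by rewrite (negbTE (i12 _ _)).
have nA'2 : ~ A' (i2 j).
  move=> [|[l lj [/esym/eqP|/inj2 jl]]]; first exact: nA2.
    by rewrite (negbTE (i12 _ _)).
  by move: lj; rewrite jl ltnn.
(* With the first j pairs in the past, pair j is centred and adds only (p - 1) t^2 B to the mean
   square. *)
have := freeze_pair A'D (D1 jN) (D2 jN) nA'1 nA'2 (i12 j j)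
  (fun C => @G1 j C jN) (fun C => @G2 j C jN) (law1 jN) (law2 jN) mg g0.
have -> : (\int[Pr]_w g (w, (Y1 j w, Y2 j w)) = \int[Pr]_w (pnorm p (part j.+1 w) ^+ 2)%:E)%E.
  by apply: eq_integral => w _; rewrite /g /part /= big_ord_recr /= scalerDr addrA.
move=> ->.
apply: (@le_trans _ _ (\int[Pr]_w ((pnorm p (part j w) ^+ 2)%:E + ((p - 1) * t ^+ 2)%:E * (B w)%:E))%E).
  apply: ge0_le_integral => //.
  - by move=> w _; apply: integral_ge0.
  - have mF := @measurable_fun_fubini_tonelli_F _ _ _ _ _ Q12 g mg g0.
    exact: (measurable_fun_sub (sigma_of_measurable A'D) mF).
  - apply: emeasurable_funD; last first.
      by apply: emeasurable_funM => //; exact: measurable_cst.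
    apply/measurable_EFinP/measurable_funX/measurable_pnorm => i.
    exact: (measurable_fun_sub (sigma_of_measurable A'D) (mvec_partial_sum jN' i)).
  - move=> w _; rewrite -EFinM -EFinD.
    have Z1 : mvec (Z w).
      by move=> i; exact: (measurableT_comp (mZ i) (pair1_measurable (w : OA A))).
    exact: (centred_step (product_probability_setT Q1 Q2) (part j w) t hp Z1 (IZ w) (EZ w) (IZ2 w) (EZ2 w)).
rewrite ge0_integralD//; last 4 first.
- by move=> w _; rewrite lee_fin sqr_ge0.
- apply/measurable_EFinP/measurable_funX/measurable_pnorm => i.
  exact: (measurable_fun_sub (sigma_of_measurable A'D) (mvec_partial_sum jN' i)).
- move=> w _; rewrite -EFinM lee_fin mulr_ge0// mulr_ge0 ?sqr_ge0// subr_ge0 (le_trans _ hp)//.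
  by rewrite ler1n.
- by apply: emeasurable_funM => //; exact: measurable_cst.
have p1 : 0 <= (p - 1) * t ^+ 2.
  by rewrite mulr_ge0 ?sqr_ge0// subr_ge0 (le_trans _ hp)// ler1n.
rewrite ge0_integralZl_EFin//; last by move=> w _; rewrite lee_fin.
have -> : ((j.+1%:R * (p - 1) * t ^+ 2)%:E =
    (j%:R * (p - 1) * t ^+ 2)%:E + ((p - 1) * t ^+ 2)%:E)%E.
  by rewrite -EFinD -natr1; congr EFin; ring.
by apply: (le_trans (leeD2r _ IH)); rewrite -addeA leeD2l// -ge0_muleDl.
Qed.

End FreshPair.

Lemma mvec_two_point {R : realType} {n : nat} {d d'} {T : measurableType d}
    {Xi : measurableType d'} (F : 'rV[R]_n -> Xi -> R) (nu : R)
    (X U : T -> 'rV[R]_n) (Z : T -> Xi) :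
  (forall z, continuous (F ^~ z)) -> (forall x, measurable_fun [set: Xi] (F x)) ->
  mvec X -> mvec U -> measurable_fun [set: T] Z ->
  mvec (fun w => two_point F nu (X w) (U w) (Z w)).
Proof.
move=> cF mF mX mU mZ; apply: mvecZ => //.
apply: measurable_funM; last exact: measurable_cst.
apply: measurable_funB; last exact: (@measurable_caratheodory_fun _ _ _ _ _ _ F X Z).
apply: (@measurable_caratheodory_fun _ _ _ _ _ _ F (fun w => X w + nu *: U w) Z) => //.
by apply: mvecD => //; exact: mvecZl.
Qed.

Lemma sqr_of_poweR_half {R : realType} (E : \bar R) (c : R) : (0 <= E)%E ->
  (E `^ 2^-1 <= c%:E)%E -> (E <= (c ^+ 2)%:E)%E.
Proof.
case: E => [r||//]; last by rewrite poweRyr ?invr_neq0 ?pnatr_eq0.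
rewrite poweR_EFin !lee_fin => r0; rewrite powR12_sqrt// => rc.
by rewrite -[r]sqr_sqrtr// lerXn2r ?nnegrE ?sqrtr_ge0// (le_trans _ rc) ?sqrtr_ge0.
Qed.

(** * Splittings of squares and their expectations *)

Lemma sqr_add_le {R : realType} (a b c : R) : 0 <= a -> a <= b + c ->
  a ^+ 2 <= 2 * b ^+ 2 + 2 * c ^+ 2.
Proof.
move=> a0 abc; have : a ^+ 2 <= (b + c) ^+ 2 by rewrite lerXn2r// nnegrE (le_trans a0).
by have := sqr_ge0 (b - c); lra.
Qed.

(** Cauchy-Schwarz with weights 1/4 + 1/4 + 1/2 = 1; the weight 1/2 goes to the bound of the
    deterministic mean and produces the term 2 Mf^2. *)
Lemma sqr_sum3_le {R : realType} (S N M B B2 NM : R) : 0 <= S -> M <= B ->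
  NM <= N + M -> S <= NM + B2 -> S ^+ 2 <= 4 * N ^+ 2 + 4 * B2 ^+ 2 + 2 * B ^+ 2.
Proof.
move=> S0 MB H1 H2; have H : S <= N + B + B2 by lra.
have : S ^+ 2 <= (N + B + B2) ^+ 2 by rewrite lerXn2r// nnegrE (le_trans _ H).
have := sqr_ge0 (2 * N - B); have := sqr_ge0 (2 * B2 - B); have := sqr_ge0 (N - B2); lra.
Qed.

(** Cauchy-Schwarz with weights 1/8, 1/4, 1/4, 1/4, 1/8, which sum to 1; the two weights 1/8 belong
    to a N and s. *)
Lemma sqr_sum5_le {R : realType} (S a N M D L s : R) : 0 <= S ->
  S <= a * N + a * M + D + L + s ->
  S ^+ 2 <= 8 * a ^+ 2 * N ^+ 2 + 4 * D ^+ 2 + 8 * s ^+ 2 + (4 * a ^+ 2 * M ^+ 2 + 4 * L ^+ 2).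
Proof.
move=> S0 H; have : S ^+ 2 <= (a * N + a * M + D + L + s) ^+ 2.
  by rewrite lerXn2r// nnegrE (le_trans _ H).
have Q (w1 w2 y z : R) : 0 <= (w1 * y - w2 * z) ^+ 2 by exact: sqr_ge0.
have := Q 2 1 (a * N) (a * M); have := Q 2 1 (a * N) D.
have := Q 2 1 (a * N) L; have := Q 1 1 (a * N) s.
have := Q 1 1 (a * M) D; have := Q 1 1 (a * M) L; have := Q 2 1 s (a * M).
have := Q 1 1 D L; have := Q 2 1 s D; have := Q 2 1 s L.
lra.
Qed.

(** Here n is the first-order estimator, r its finite-difference remainder, g and e their means, at
    two points. The three groups have different orders: alpha, the distance of the two points, and
    nu. *)
Lemma momentum_split {R : realType} {n} (a : R) (n1 n2 r1 r2 g1 g2 e1 e2 : 'rV[R]_n) :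
  n1 + r1 - (g1 + e1) - (1 - a) *: (n2 + r2 - (g2 + e2)) =
  a *: n1 - a *: g1 + ((1 - a) *: (n1 - n2) - (1 - a) *: (g1 - g2))
    + (r1 - (1 - a) *: r2 - (e1 - (1 - a) *: e2)).
Proof. by apply/rowP => i; rewrite !mxE; ring. Qed.

Section Combinations.
Context {R : realType} {d} {T : measurableType d} (mu : {measure set T -> \bar R}).
Context (mu1 : mu [set: T] = 1%E).

Lemma intg_comb2 (f g : T -> R) (a b c B : R) : intg mu f -> intg mu g ->
  a * Ex mu f + b * Ex mu g + c <= B ->
  intg mu (fun t => a * f t + b * g t + c) /\
  Ex mu (fun t => a * f t + b * g t + c) <= B.
Proof.
move=> If Ig H; have I1 := intgD (intgZ a If) (intgZ b Ig).
have I2 := intgD I1 (intg_cst mu1 c); split => //; apply: le_trans H.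
by rewrite (ExD I1 (intg_cst mu1 c)) (Ex_cst mu1 c) (ExD (intgZ a If) (intgZ b Ig)) (ExZ a If) (ExZ b Ig).
Qed.

Lemma intg_comb3 (f g h : T -> R) (a b e c B : R) : intg mu f -> intg mu g -> intg mu h ->
  a * Ex mu f + b * Ex mu g + e * Ex mu h + c <= B ->
  intg mu (fun t => a * f t + b * g t + e * h t + c) /\
  Ex mu (fun t => a * f t + b * g t + e * h t + c) <= B.
Proof.
move=> If Ig Ih H; have I1 := intgD (intgZ a If) (intgZ b Ig).
have I2 := intgD I1 (intgZ e Ih); have I3 := intgD I2 (intg_cst mu1 c).
split => //; apply: le_trans H.
by rewrite (ExD I2 (intg_cst mu1 c)) (Ex_cst mu1 c) (ExD I1 (intgZ e Ih)) (ExD (intgZ a If) (intgZ b Ig)) (ExZ a If) (ExZ b Ig) (ExZ e Ih).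
Qed.

Lemma intg_dominated (f g : T -> R) (B : R) : measurable_fun [set: T] f ->
  (forall t, 0 <= f t) -> (forall t, f t <= g t) -> intg mu g -> Ex mu g <= B ->
  intg mu f /\ Ex mu f <= B.
Proof.
move=> mf f0 fg Ig gB; have If : intg mu f.
  by apply: (intg_le mf Ig) => t; rewrite ger0_norm.
by split => //; exact: (le_trans (Ex_le If Ig fg)).
Qed.

End Combinations.

(** The terms in s^2 + M^2 and M^2 match exactly, the last one giving 4 = 2 * 2. The two terms in (L
    D2)^2, of weight 4 each, merge into 8 Sp because Sp >= 1. *)
Lemma momentum_budget {R : realType} (Sp E6 s M L D2 N DN V a nu : R) :
  1 <= Sp -> 0 <= E6 -> N <= Sp * (s ^+ 2 + M ^+ 2) -> DN <= Sp * (L * D2) ^+ 2 ->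
  V <= 4 * (nu ^+ 2 * L ^+ 2 * E6 / 4) ->
  8 * a ^+ 2 * N + 4 * DN + 8 * V + (4 * a ^+ 2 * M ^+ 2 + 4 * (L * D2) ^+ 2) <=
  2 * a ^+ 2 * (nu ^+ 2 * L ^+ 2 * E6 + 4 * Sp * (s ^+ 2 + M ^+ 2) + 2 * M ^+ 2)
    + 8 * Sp * L ^+ 2 * D2 ^+ 2 + 8 * nu ^+ 2 * L ^+ 2 * E6.
Proof.
move=> Sp1 E60 NB DB VB.
have H1 := ler_wpM2l (mulr_ge0 (ler0n R 8) (sqr_ge0 a)) NB.
have H2 : (L * D2) ^+ 2 <= Sp * (L * D2) ^+ 2 by rewrite ler_peMl// sqr_ge0.
have H3 : 0 <= a ^+ 2 * (nu ^+ 2 * L ^+ 2 * E6).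
  by rewrite mulr_ge0 ?sqr_ge0// mulr_ge0// mulr_ge0 ?sqr_ge0.
by move: DB H2; rewrite exprMn => *; lra.
Qed.

Lemma two_budget {R : realType} (a b c : R) : a <= c -> b <= c -> 2 * a + 2 * b + 0 <= 4 * c.
Proof. by move=> *; lra. Qed.

(** * Measurability of the mirror step *)

Section ArgminLipschitz.
Context {R : realType} {d : nat} (p q : R) (hp : 0 < p) (hq : 0 < q) (hpq : p^-1 + q^-1 = 1).
Context (X : set 'rV[R]_d) (phi v : 'rV[R]_d -> R) (eta : R) (heta : 0 < eta).
Context (vmon : forall x y, pnorm q (x - y) ^+ 2 <= dotv (x - y) (grad v x - grad v y)).

(* x^(k+1) is the prox point of a = g - grad v (x^k) / eta; it is Lipschitz in a, hence
   measurable, although a need not range over all of R^d. *)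
Definition prox_point (a z : 'rV[R]_d) : Prop := X z /\ forall y, X y ->
  dotv (- (a + eta^-1 *: grad v z)) (y - z) <= phi y - phi z.

(** Adding the two variational inequalities, each tested at the other point, cancels [phi]; strong
    monotonicity leaves |z - w|^2 / eta <= <b - a, z - w>, and Hoelder concludes. With a = b it is
    uniqueness. *)
Lemma prox_point_lipschitz a b z w : prox_point a z -> prox_point b w ->
  pnorm q (z - w) <= eta * pnorm p (a - b).
Proof.
move=> [Xz Hz] [Xw Hw]; have := Hz _ Xw; have := Hw _ Xz; have := vmon z w.
have HE := dotv_hoelder (- (a - b)) (z - w) hp hq hpq; move: HE; rewrite pnormN.
rewrite -(opprB z w) [dotv (z - w) (_ - _)]dotvC !dotvNl !dotvNr opprK !dotvBl !dotvDl !dotvZl.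
have N0 := pnorm_ge0 q (z - w); have e0 : 0 < eta^-1 by rewrite invr_gt0.
set N := pnorm q _ in N0 *; set M := pnorm p _.
move: (dotv _ _) (dotv _ _) (dotv _ _) (dotv _ _) => va vb gz gw H1 H2 H3 H4.
rewrite leNgt; apply/negP => lt.
have : eta^-1 * N ^+ 2 <= M * N by nra.
have Np : 0 < N by apply: le_lt_trans lt; rewrite mulr_ge0 ?(ltW heta)// pnorm_ge0.
by rewrite expr2 mulrA ler_pM2r// ler_pdivrMl// leNgt lt.
Qed.

End ArgminLipschitz.

(** The iterate is the prox point of a measurable datum [a]. Uniqueness identifies it with the
    composite of [a] and a solution map that is Lipschitz on its domain. *)
Lemma mvec_argmin {R : realType} {d : nat} (p q : R) (hp : 1 <= p) (hq : 0 < q)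
    (hpq : p^-1 + q^-1 = 1) (X : set 'rV[R]_d) (h : 'rV[R]_d -> \bar R) (v : 'rV[R]_d -> R)
    (eta Lv : R) {dT} {T : measurableType dT} (g xk xp : T -> 'rV[R]_d) :
  0 < eta -> convex_set (X : set (convex_lmodType 'rV[R]_d)) -> convex_ext h ->
  (forall x, X x -> h x \is a fin_num) -> (forall x, differentiable v x) ->
  (forall x y, pnorm q (x - y) ^+ 2 <= dotv (x - y) (grad v x - grad v y)) ->
  (forall x y, X x -> X y -> pnorm p (grad v x - grad v y) <= Lv * pnorm q (x - y)) ->
  mvec g -> mvec xk -> (forall w, X (xk w)) ->
  (forall w, is_argmin X (fun y => ((dotv (g w) y)%:E + h y
      + (eta^-1 * bregman v (xk w) y)%:E)%E) (xp w)) ->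
  1 <= q -> mvec xp.
Proof.
move=> eta0 cX ch hfin dv vmon vsm mg mx Xx am q1.
have p0 : 0 < p by apply: lt_le_trans hp.
pose prox := prox_point X (fine \o h) v eta.
pose a w := g w - eta^-1 *: grad v (xk w).
have pr w : prox (a w) (xp w).
  split; first exact: (am w).1.
  move=> y Xy; have := argmin_variational eta0 cX ch hfin (dv _) (am w) Xy.
  by rewrite /a scalerBr addrA addrAC.
pose S : set 'rV[R]_d := [set b | exists z, prox b z].
(* A solution map by choice on [S]; the default 0 outside [S] is never reached, since every [a w]
   belongs to [S]. *)
pose F (b : 'rV[R]_d) : 'rV[R]_d := if pselect (S b) is left e then projT1 (cid e) else 0.
have FP b : S b -> prox b (F b).
  by move=> Sb; rewrite /F; case: pselect => // e; exact: (projT2 (cid e)).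
have lip b b' z z' : prox b z -> prox b' z' -> pnorm q (z - z') <= eta * pnorm p (b - b').
  exact: (prox_point_lipschitz p0 hq hpq eta0 vmon).
have Sa w : S (a w) by exists (xp w).
have -> : xp = F \o a.
  apply/funext => w /=; apply/eqP; rewrite -subr_eq0; apply/eqP.
  apply: (pnorm_eq0 hq); apply/eqP; rewrite eq_le pnorm_ge0 andbT.
  have := lip _ _ _ _ (pr w) (FP _ (Sa w)).
  by rewrite subrr pnorm0 ?mulr0.
apply: (mvec_comp_lipschitz (S := S) (L := eta) (p := q) (q := p)) => //.
- apply: mvecB => //; apply: mvecZl.
  exact: (mvec_comp_lipschitz (S := X) (phi := grad v) (L := Lv) (p := p) (q := q)).
- by move=> b b' Sb Sb'; apply: lip; exact: FP.
Qed.

(** As (1 - al)^2 <= 1 - al, the recursion gives al a_k <= a_k - a_(k+1) + b_k, which telescopes. *)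
Lemma momentum_sum {R : realType} (a b : nat -> R) (al A0 : R) K : 0 < al <= 1 ->
  (forall k, 0 <= a k) -> (forall k, 0 <= b k) -> a 0%N <= A0 -> (0 < K)%N ->
  (forall k, (k.+1 < K)%N -> a k.+1 <= (1 - al) ^+ 2 * a k + b k) ->
  al * (\sum_(k < K) a k) <= A0 + \sum_(k < K) b k.
Proof.
move=> /andP[al0 al1] a0 b0 aA0 K0 rec.
have inv j : (j < K)%N -> al * (\sum_(k < j) a k) + a j <= A0 + \sum_(k < j) b k.
  elim: j => [_|j IH jK]; first by rewrite !big_ord0 mulr0 add0r addr0.
  have := IH (ltnW jK); have := rec j jK; have := a0 j.
  have : (1 - al) ^+ 2 * a j <= (1 - al) * a j.
    by rewrite ler_wpM2r// expr2 ler_piMl ?subr_ge0// gerBl ltW.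
  by rewrite !big_ord_recr /=; move: (\sum_(i < j) a i) (\sum_(i < j) b i) => *; lra.
case: K K0 rec inv => // K _ _ /(_ _ (ltnSn K)).
rewrite !big_ord_recr /= => H.
(* The recursion stops one step before the end, so the last term is absorbed by the a_K left over
   from the telescoping. *)
have : al * a K <= a K by rewrite ler_piMl.
by have := b0 K; move: H; move: (\sum_(i < K) a i) (\sum_(i < K) b i) => *; lra.
Qed.

(** The batch size enters here, as Sp y <= alpha / 96. Both leftover terms carry the factor 8,
    whence the two twelfths; the one in nu needs only y <= alpha / 96. *)
Lemma error_budget {R : realType} (p Sp eta Lf alpha nu E6 sig n0 n K SA SD : R) :
  0 <= p - 1 -> 1 <= Sp -> 0 < eta -> 0 < alpha -> 0 <= E6 -> 0 < n0 -> 0 < n -> 0 < K ->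
  0 <= SD -> 96 * (p - 1) * Sp * eta ^+ 2 * Lf ^+ 2 / alpha <= n ->
  alpha * SA <= (p - 1) / n0 * sig + (p - 1) / n * (2 * alpha ^+ 2 * sig * K
     + 8 * Sp * Lf ^+ 2 * (eta ^+ 2 * SD) + 8 * nu ^+ 2 * Lf ^+ 2 * E6 * K) ->
  SA <= K * (p - 1) * sig * (1 / (n0 * alpha * K) + 2 * alpha / n) + SD / 12
        + K * (nu ^+ 2 * E6 / eta ^+ 2) / 12.
Proof.
move=> p1 Sp1 eta0 al0 E60 n00 n_0 K0 SD0 nb H.
pose y := (p - 1) * eta ^+ 2 * Lf ^+ 2 / n; pose W := nu ^+ 2 * E6 / eta ^+ 2.
have W0 : 0 <= W by rewrite divr_ge0 ?sqr_ge0// mulr_ge0// sqr_ge0.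
have y0 : 0 <= y by rewrite divr_ge0 ?(ltW n_0)// mulr_ge0 ?sqr_ge0// mulr_ge0 ?sqr_ge0.
have yS : Sp * y <= alpha / 96.
  rewrite /y; move: nb; rewrite ler_pdivrMr// => nb.
  rewrite mulrA ler_pdivrMr//; lra.
have y1 : y <= alpha / 96 by apply: le_trans yS; rewrite ler_peMl.
rewrite -(ler_pM2l al0); apply: (le_trans H).
have -> : (p - 1) / n0 * sig + (p - 1) / n * (2 * alpha ^+ 2 * sig * K
     + 8 * Sp * Lf ^+ 2 * (eta ^+ 2 * SD) + 8 * nu ^+ 2 * Lf ^+ 2 * E6 * K) =
  alpha * (K * (p - 1) * sig * (1 / (n0 * alpha * K) + 2 * alpha / n))
    + 8 * (Sp * y * SD) + 8 * (y * (K * W)).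
  by rewrite /y /W; field; rewrite !gt_eqF.
rewrite -/W.
have H1 := ler_wpM2r SD0 yS.
have H2 := ler_wpM2r (mulr_ge0 (ltW K0) W0) y1.
move: H1 H2; move: (K * W) (Sp * y * SD) (_ * (1 / _ + _)) => KW z1 z2 H1 H2.
move: (y * KW) H2 => z3 H2; lra.
Qed.

(** Two linear inequalities in SA and SD are solved and inserted in the third. The stated constants
    leave slack; the least is in the nu term, where 64/19 is compared with 4. *)
Lemma final_budget {R : realType} (beta mu eta Lf Lv nu E6 b2 K C0 Cst Sc SA SD D0 T : R) :
  0 < beta -> 0 < mu -> 0 < eta -> 0 <= Lf -> 0 <= E6 -> 0 < K -> 0 <= D0 -> 0 <= T ->
  eta * Lf <= 1 / 2 -> b2 = nu ^+ 2 * Lf ^+ 2 * E6 / 4 ->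
  SA <= T + SD / 12 + K * (nu ^+ 2 * E6 / eta ^+ 2) / 12 ->
  SD <= 2 * D0 / eta + 5 / 2 * SA + 10 * K * b2 ->
  beta ^+ 2 * mu ^+ 2 * Sc <= beta ^+ 2 * mu ^+ 2 * C0 + 8 * K * Cst
    + 16 / 5 * (5 / 4 * SA + 5 * K * b2) + 32 / 5 * (1 / 4 + Lv ^+ 2) * SD ->
  K^-1 * Sc <= C0 / K + 8 * Cst / (beta ^+ 2 * mu ^+ 2)
    + 8 * (8 * Lv ^+ 2 + 3) * D0 / (beta ^+ 2 * mu ^+ 2 * eta * K)
    + 4 * (2 * Lv ^+ 2 + 1) * nu ^+ 2 * E6 / (beta ^+ 2 * mu ^+ 2 * eta ^+ 2)
    + 32 * (2 * Lv ^+ 2 + 1) / (beta ^+ 2 * mu ^+ 2) * (T / K).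
Proof.
move=> be0 mu0 eta0 Lf0 E60 K0 D00 T0 eL b2E HA HD HC.
pose W := nu ^+ 2 * E6 / eta ^+ 2; pose B := beta ^+ 2 * mu ^+ 2; pose D := D0 / eta.
have B0 : 0 < B by rewrite mulr_gt0 ?exprn_gt0.
have W0 : 0 <= W by rewrite divr_ge0 ?sqr_ge0// mulr_ge0// sqr_ge0.
have D_0 : 0 <= D by rewrite divr_ge0 ?(ltW eta0).
(* The squared bias is (eta Lf)^2 W / 4, and eta Lf <= 1/2. *)
have bW : b2 <= W / 16.
  have -> : b2 = (eta * Lf) ^+ 2 * W / 4 by rewrite b2E /W; field; rewrite gt_eqF.
  have : (eta * Lf) ^+ 2 * W <= (1 / 2) ^+ 2 * W.
    by rewrite ler_wpM2r// lerXn2r ?nnegrE ?mulr_ge0 ?(ltW eta0)// divr_ge0.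
  by move: (_ * W) => z; lra.
have KW0 : 0 <= K * W by rewrite mulr_ge0 ?(ltW K0).
have Kb : K * b2 <= K * W / 16 by rewrite -mulrA ler_pM2l.
have -> : C0 / K + 8 * Cst / (beta ^+ 2 * mu ^+ 2)
    + 8 * (8 * Lv ^+ 2 + 3) * D0 / (beta ^+ 2 * mu ^+ 2 * eta * K)
    + 4 * (2 * Lv ^+ 2 + 1) * nu ^+ 2 * E6 / (beta ^+ 2 * mu ^+ 2 * eta ^+ 2)
    + 32 * (2 * Lv ^+ 2 + 1) / (beta ^+ 2 * mu ^+ 2) * (T / K) =
  (K * B)^-1 * (B * C0 + 8 * K * Cst + 8 * (8 * Lv ^+ 2 + 3) * D
    + 4 * (2 * Lv ^+ 2 + 1) * (K * W) + 32 * (2 * Lv ^+ 2 + 1) * T).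
  by rewrite /B /W /D; field; rewrite !gt_eqF.
have -> : K^-1 * Sc = (K * B)^-1 * (B * Sc) by field; rewrite !gt_eqF.
rewrite ler_pM2l ?invr_gt0 ?mulr_gt0//; apply: (le_trans HC).
rewrite -/B -!addrA lerD2l lerD2l -(mulrA 5 K b2).
have HD' : SD <= 2 * D + 5 / 2 * SA + 5 / 8 * (K * W).
  have : SD <= 2 * D + 5 / 2 * SA + 10 * (K * b2) by rewrite /D !mulrA.
  by move: Kb; move: (K * W) (K * b2) => *; lra.
have HA' : SA <= T + SD / 12 + K * W / 12 by [].
have L0 : 0 <= Lv ^+ 2 by exact: sqr_ge0.
(* Substituting [HD'] in [HA'] leaves SA with the factor 1 - 5/24 = 19/24; the next line inserts the
   result back. *)
have SAB : SA <= 24 / 19 * T + 4 / 19 * D + 13 / 76 * (K * W) by lra.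
have SDB : SD <= 60 / 19 * T + 48 / 19 * D + 20 / 19 * (K * W) by lra.
have H := ler_wpM2l L0 SDB.
have n1 : 0 <= Lv ^+ 2 * T by rewrite mulr_ge0.
have n2 : 0 <= Lv ^+ 2 * D by rewrite mulr_ge0.
have n3 : 0 <= Lv ^+ 2 * (K * W) by rewrite mulr_ge0.
move: H n1 n2 n3 SAB SDB KW0 Kb; clear -T0 D_0.
move: (K * W) (K * b2) => KW Kb; move: (Lv ^+ 2) => L H n1 n2 n3 SAB SDB KW0 KbW; lra.
Qed.

Lemma preimage_system_setI {T T' : Type} (f : T -> T') (B : set (set T')) :
  setI_closed B -> setI_closed (preimage_set_system [set: T] f B).
Proof.
move=> BI _ _ [U BU <-] [V BV <-]; exists (U `&` V); first exact: BI.
by rewrite !setTI preimage_setI.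
Qed.

(** * The algorithm when smoothness of F and (A6) hold everywhere *)

Section ReducedAlgorithm.
Context {R : realType} {d m : nat} (p q : R) (hp : 2 <= p) (hpq : p^-1 + q^-1 = 1).
Context {dX : measure_display} {Xi : measurableType dX} (P : probability Xi R).
Context (Pu : probability (borelRV R d) R).
Context (F : 'rV[R]_d -> Xi -> R) (f : 'rV[R]_d -> R) (h : 'rV[R]_d -> \bar R)
  (c : 'rV[R]_d -> 'rV[R]_m) (X : set 'rV[R]_d) (v : 'rV[R]_d -> R).
Context (FC : forall z, cont_diff (F ^~ z)) (mF : forall x, measurable_fun [set: Xi] (F x)).
Context (df : forall x, differentiable f x) (cC : forall i, cont_diff (comp_fun c i)).
Context (cX : convex_set (X : set (convex_lmodType 'rV[R]_d))) (ch : convex_ext h)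
  (hfin : forall x, X x -> h x \is a fin_num).
Context (DX Lf Mf Mh Mbc Mc Lc Lv Phi_inf sigma : R).
Context (hLf : 0 < Lf) (hMf : 0 < Mf) (hMh : 0 < Mh) (hMbc : 0 < Mbc) (hMc : 0 < Mc)
  (hLc : 0 < Lc).
Context (Xbnd : forall x, X x -> pnorm q x <= DX).
Context (fM : forall x, X x -> pnorm 2 (grad f x) <= Mf)
  (fL : forall x y, X x -> X y -> pnorm 2 (grad f x - grad f y) <= Lf * pnorm 2 (x - y))
  (cb : forall (i : 'I_m) x, X x -> `|c x 0 i| <= Mbc)
  (cg : forall (i : 'I_m) x, X x -> pnorm 2 (grad (comp_fun c i) x) <= Mc)
  (csm : forall (i : 'I_m) x y, X x -> X y ->
     pnorm 2 (grad (comp_fun c i) x - grad (comp_fun c i) y) <= Lc * pnorm 2 (x - y))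
  (hh : forall x y, X x -> X y -> fine (h y) - fine (h x) <= Mh * pnorm 2 (y - x))
  (hPhi : forall x, X x -> Phi_inf <= f x + fine (h x)).
Context (dv : forall x, differentiable v x)
  (vmon : forall x y, pnorm q (x - y) ^+ 2 <= dotv (x - y) (grad v x - grad v y))
  (vsm : forall x y, X x -> X y -> pnorm p (grad v x - grad v y) <= Lv * pnorm q (x - y)).
Context (Sp : R) (hSp : 1 <= Sp)
  (hSpE : forall g : 'rV[R]_d,
     ('E_Pu[fun u : borelRV R d => (pnorm p (dotv g (u : 'rV[R]_d) *: (u : 'rV[R]_d)) ^+ 2)%R]
        <= (Sp * pnorm 2 g ^+ 2)%R%:E)%E)
  (hcov : forall i j : 'I_d,
     ('E_Pu[fun u : borelRV R d => ((u : 'rV[R]_d) 0 i * (u : 'rV[R]_d) 0 j)%R]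
       = ((i == j)%:R)%R%:E)%E)
  (hu6 : ('E_Pu[fun u : borelRV R d => (pnorm 2 (u : 'rV[R]_d) ^+ 6)%R] < +oo)%E).
Context (nu : R) (hnu : 0 < nu) (O : set 'rV[R]_d) (hXO : smoothing_domain X Pu nu `<=` O).
Context (hmean : forall x, O x -> has_mean P (fun z => grad (F ^~ z) x) (grad f x))
  (hvar : forall x, O x ->
     ('E_P[fun z => (pnorm 2 (grad (F ^~ z) x - grad f x) ^+ 2)%R] <= (sigma ^+ 2)%R%:E)%E)
  (hms : forall x y, O x -> O y ->
     ('E_P[fun z => (pnorm 2 (grad (F ^~ z) x - grad (F ^~ z) y) ^+ 2)%R] `^ (2^-1)%R
        <= (Lf * pnorm 2 (x - y))%R%:E)%E).

Let p0 : 0 < p. Proof. by apply: lt_le_trans hp. Qed.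
Let p1 : 1 <= p. Proof. by apply: le_trans hp; rewrite ler1n. Qed.
Let pi2 : p^-1 <= 2^-1. Proof. by rewrite lef_pV2// posrE. Qed.
Let q0 : 0 < q. Proof. by rewrite -invr_gt0; have := hpq; have := pi2; move=> *; lra. Qed.
Let q2 : q <= 2.
Proof. by rewrite -lef_pV2 ?posrE//; have := hpq; have := pi2; move=> *; lra. Qed.
Let q1 : 1 <= q.
Proof.
have pi0 : 0 < p^-1 by rewrite invr_gt0.
rewrite -[q]invrK -[leLHS]invr1 lef_pV2 ?posrE ?invr_gt0//.
by have := hpq; move=> *; lra.
Qed.

Let PuP := (Pu \x P)%E.
Let UX : measurableType _ := (borelRV R d * Xi)%type.
Let PuP1 : PuP [set: UX] = 1%E := product_probability_setT Pu P.
Let P_1 : P [set: Xi] = 1%E := probability_setT P.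
Let Pu1 : Pu [set: borelRV R d] = 1%E := probability_setT Pu.

Definition moment6 : R := fine ('E_Pu[fun u : borelRV R d => (pnorm 2 (u : 'rV[R]_d) ^+ 6)%R])%E.
Let b2 : R := nu ^+ 2 * Lf ^+ 2 * moment6 / 4.

Let cF z : continuous (F ^~ z).
Proof. by move=> x; apply: differentiable_continuous; exact: (FC z).1. Qed.

Let m_fst : mvec (fun t : UX => (t.1 : 'rV[R]_d)).
Proof. by apply/mvecP; exact: measurable_fst. Qed.

Let m_u : mvec (fun u : borelRV R d => (u : 'rV[R]_d)).
Proof. by apply/mvecP; exact: measurable_id. Qed.

Let segO x u t : X x -> msupport Pu u -> 0 <= t <= 1 -> O (x + t *: (nu *: u)).
Proof.
by move=> Xx su t01; apply: hXO; exists x, t, u; rewrite scalerA.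
Qed.

Let XO x : X x -> O x.
Proof.
move=> Xx; have [u su] := msupport_nonempty Pu.
by have := segO Xx su (t := 0); rewrite scale0r addr0; apply; rewrite lexx ler01.
Qed.

Let mgrad x : O x -> mvec (fun z => grad (F ^~ z) x).
Proof. by move=> Ox i; have [+ _] := hmean Ox i; exact: intg_measurable. Qed.

Let msbound x y : O x -> O y ->
  (\int[P]_z (pnorm 2 (grad (F ^~ z) x - grad (F ^~ z) y) ^+ 2)%:E
     <= ((Lf * pnorm 2 (x - y)) ^+ 2)%:E)%E.
Proof.
move=> Ox Oy; have := hms Ox Oy; rewrite unlock; apply: sqr_of_poweR_half.
by apply: integral_ge0 => z _; rewrite lee_fin sqr_ge0.
Qed.

Let grad_mean x : O x -> (forall i, intg P (fun z => grad (F ^~ z) x 0 i)) /\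
  Exv P (fun z => grad (F ^~ z) x) = grad f x.
Proof.
move=> Ox; have I i := (hmean Ox i).1; split=> //.
apply/rowP => i; rewrite mxE; apply: EFin_inj; rewrite -(EFin_Ex (I i)).
by have := (hmean Ox i).2; rewrite unlock.
Qed.

(** Expanding around the mean: the variance adds at most sigma^2 and the squared gradient of [f] at
    most Mf^2. *)
Let grad_moment x : X x ->
  (\int[P]_z (pnorm 2 (grad (F ^~ z) x) ^+ 2)%:E <= (sigma ^+ 2 + Mf ^+ 2)%:E)%E.
Proof.
move=> Xx; have Ox := XO Xx; have mG := mgrad Ox.
have [I E] := grad_mean Ox.
have mD : mvec (fun z => grad (F ^~ z) x - grad f x) by apply: mvecB => //; exact: mvec_cst.
have [IV EV] : intg P (fun z => pnorm 2 (grad (F ^~ z) x - grad f x) ^+ 2) /\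
    Ex P (fun z => pnorm 2 (grad (F ^~ z) x - grad f x) ^+ 2) <= sigma ^+ 2.
  apply: intg_ge0; first exact/measurable_funX/measurable_pnorm.
    by move=> z; exact: sqr_ge0.
  by have := hvar Ox; rewrite unlock.
have [Id Ed] := intg_dotv P_1 (grad f x) I.
have E2 : (fun z => pnorm 2 (grad (F ^~ z) x) ^+ 2) = (fun z =>
   pnorm 2 (grad (F ^~ z) x - grad f x) ^+ 2 + 2 * dotv (grad f x) (grad (F ^~ z) x)
   - pnorm 2 (grad f x) ^+ 2).
  by apply/funext => z; rewrite -!dotvv dotvBl !dotvBr (dotvC (grad (F ^~ z) x) (grad f x)); ring.
have I1 := intgD IV (intgZ 2 Id); have I2 := intgB I1 (intg_cst P_1 (pnorm 2 (grad f x) ^+ 2)).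
have I3 : intg P (fun z => pnorm 2 (grad (F ^~ z) x) ^+ 2) by rewrite E2.
rewrite (EFin_Ex I3) lee_fin E2 (ExB I1 (intg_cst P_1 (pnorm 2 (grad f x) ^+ 2))) (ExD IV (intgZ 2 Id)) (ExZ _ Id).
rewrite Ed E dotvv (Ex_cst P_1 (pnorm 2 (grad f x) ^+ 2)).
have : pnorm 2 (grad f x) ^+ 2 <= Mf ^+ 2.
  by rewrite lerXn2r ?nnegrE ?pnorm_ge0 ?(ltW hMf)// fM.
lra.
Qed.

Let rem x (t : UX) : 'rV[R]_d :=
  two_point F nu x t.1 t.2 - dotv (grad (F ^~ t.2) x) t.1 *: (t.1 : 'rV[R]_d).

Let mtp x : mvec (fun t : UX => two_point F nu x t.1 t.2).
Proof. by apply: mvec_two_point. Qed.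

(** The first-order estimator <grad F, u> u, unbiased for grad f; the two-point estimator is this
    plus [rem]. *)
Let noise x (t : UX) : 'rV[R]_d := dotv (grad (F ^~ t.2) x) t.1 *: (t.1 : 'rV[R]_d).

Let mnoise x : O x -> mvec (noise x).
Proof. by move=> Ox; exact: (mvec_noise (mgrad Ox)). Qed.

Let mrem x : O x -> mvec (rem x).
Proof. by move=> Ox; apply: mvecB => //; exact: mnoise. Qed.

(** [rem] is |u| / nu times the Taylor remainder over nu u, whose mean square is at most (Lf nu^2
    |u|^2 / 2)^2. The product is nu^2 Lf^2 |u|^6 / 4, the origin of the sixth moment. *)
Let rem_moment x : X x ->
  intg PuP (fun t => pnorm 2 (rem x t) ^+ 2) /\ Ex PuP (fun t => pnorm 2 (rem x t) ^+ 2) <= b2.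
Proof.
move=> Xx; have Ox := XO Xx; have mR := mrem Ox.
have m2 : measurable_fun [set: UX] (fun t => pnorm 2 (rem x t) ^+ 2).
  exact/measurable_funX/measurable_pnorm.
apply: intg_ge0 => //; first by move=> t; exact: sqr_ge0.
rewrite /PuP fubini_tonelli1//=; last 2 first.
  - exact/measurable_EFinP.
  - by move=> t; rewrite lee_fin sqr_ge0.
have m6 : measurable_fun [set: borelRV R d] (fun u : borelRV R d => pnorm 2 (u : 'rV[R]_d) ^+ 6).
  exact/measurable_funX/measurable_pnorm.
apply: (@le_trans _ _ (\int[Pu]_u ((nu ^+ 2 * Lf ^+ 2 / 4)%:E * (pnorm 2 (u : 'rV[R]_d) ^+ 6)%:E))%E).
  apply: ae_ge0_le_integral => //.
  - by move=> u _; apply: integral_ge0 => z _; rewrite lee_fin sqr_ge0.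
  - apply: (@measurable_fun_fubini_tonelli_F _ _ _ _ _ P (fun t => (pnorm 2 (rem x t) ^+ 2)%:E)).
      exact/measurable_EFinP.
    by move=> t; rewrite lee_fin sqr_ge0.
  - by move=> u _; rewrite mule_ge0// lee_fin ?exprn_even_ge0// divr_ge0// mulr_ge0 ?sqr_ge0.
  - by apply/measurable_EFinP/measurable_funM => //; exact: measurable_cst.
  (* The segment from x to x + nu u lies in [O] only for u in the support, so the inner bound holds
     for almost every u. *)
  have [B [mB B0 sB]] := msupport_ae Pu.
  exists B; split => // u nu0; apply: sB => su; apply: nu0 => _ {B mB B0}.
  rewrite /fubini_F /=.
  have remE z : pnorm 2 (rem x (u, z)) ^+ 2 = (pnorm 2 (u : 'rV[R]_d) / nu) ^+ 2 *
      (F (x + nu *: (u : 'rV[R]_d)) z - F x z - dotv (grad (F ^~ z) x) (nu *: (u : 'rV[R]_d))) ^+ 2.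
    rewrite /rem /two_point /= -scalerBl pnormZ// exprMn real_normK ?num_real//.
    rewrite dotvZr -!exprMn; congr (_ ^+ 2).
    by field; rewrite gt_eqF.
  have := @taylor_remainder_L2 _ _ _ P P_1 _ F x (nu *: (u : 'rV[R]_d)) Lf (ltW hLf) FC mF _ _.
  have A1 t : 0 <= t <= 1 -> mvec (fun z => grad (F ^~ z) (x + t *: (nu *: (u : 'rV[R]_d)))).
    by move=> t01; apply/mgrad/segO.
  have A2 t : 0 <= t <= 1 -> (\int[P]_z (pnorm 2 (grad (F ^~ z) (x + t *: (nu *: (u : 'rV[R]_d)))
       - grad (F ^~ z) x) ^+ 2)%:E <= ((Lf * (t * pnorm 2 (nu *: (u : 'rV[R]_d)))) ^+ 2)%:E)%E.
    move=> t01; have /andP[t0 _] := t01.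
    have := msbound (segO Xx su t01) Ox.
    by rewrite [x + _ - x]addrAC subrr add0r [pnorm 2 (t *: _)]pnormZ// ger0_norm.
  move=> /(_ A1 A2) H.
  under eq_integral do rewrite remE EFinM.
  rewrite ge0_integralZl_EFin ?sqr_ge0//; last 2 first.
  - by move=> z _; rewrite lee_fin sqr_ge0.
  - apply/measurable_EFinP/measurable_funX/measurable_funB.
      by apply: measurable_funB.
    by apply: measurable_dotv; [exact: mgrad|exact: mvec_cst].
  have c0 : (0 <= ((pnorm 2 (u : 'rV[R]_d) / nu) ^+ 2)%:E)%E by rewrite lee_fin sqr_ge0.
  apply: (le_trans (lee_wpmul2l c0 H)).
  rewrite -!EFinM lee_fin pnormZ// (gtr0_norm hnu) le_eqVlt; apply/orP; left; apply/eqP.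
  by field; rewrite gt_eqF.
rewrite ge0_integralZl_EFin//.
- have -> : (\int[Pu]_u (pnorm 2 (u : 'rV[R]_d) ^+ 6)%:E = moment6%:E)%E.
    rewrite /moment6 fineK; first by rewrite unlock.
    rewrite ge0_fin_numE// unlock; apply: integral_ge0 => u _.
    by rewrite lee_fin exprn_even_ge0.
  by rewrite -EFinM lee_fin /b2 le_eqVlt; apply/orP; left; apply/eqP; ring.
- by move=> u _; rewrite lee_fin exprn_even_ge0.
- exact/measurable_EFinP.
- by rewrite divr_ge0// mulr_ge0 ?sqr_ge0.
Qed.

(** The centre of the estimator errors; it differs from grad f by the mean of [rem]. *)
Definition tp_mean x : 'rV[R]_d := Exv PuP (fun t : UX => two_point F nu x t.1 t.2).

Definition sampling_variance : R :=
  nu ^+ 2 * Lf ^+ 2 * moment6 + 4 * Sp * (sigma ^+ 2 + Mf ^+ 2) + 2 * Mf ^+ 2.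

Let noiseE x : X x ->
  [/\ intg PuP (fun t => pnorm p (noise x t) ^+ 2),
      Ex PuP (fun t => pnorm p (noise x t) ^+ 2) <= Sp * (sigma ^+ 2 + Mf ^+ 2),
      forall i, intg PuP (fun t => noise x t 0 i) & Exv PuP (noise x) = grad f x].
Proof.
move=> Xx; have Ox := XO Xx.
have [I E] := noise_moment hSp hSpE (mgrad Ox) (grad_moment Xx).
have Ii := intg_coord PuP1 p0 (mnoise Ox) I.
have [Ig <-] := grad_mean Ox.
by split => //; exact: (noise_mean hcov (mgrad Ox) Ig Ii).
Qed.

Let remi x : X x -> forall i, intg PuP (fun t => rem x t 0 i).
Proof.
move=> Xx; have [I _] := rem_moment Xx.
exact: (intg_coord PuP1 (ltr0n R 2) (mrem (XO Xx)) I).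
Qed.

Let tpE x t : two_point F nu x t.1 t.2 = noise x t + rem x t.
Proof. by rewrite /rem /noise addrC subrK. Qed.

Let tpi x : X x -> forall i, intg PuP (fun t => two_point F nu x t.1 t.2 0 i).
Proof.
move=> Xx i; have [_ _ Ii _] := noiseE Xx; have := intgD (Ii i) (remi Xx i).
by congr intg; apply/funext => t; rewrite tpE [in RHS]mxE.
Qed.

Let tp_meanE x : X x -> tp_mean x = grad f x + Exv PuP (rem x).
Proof.
move=> Xx; have [_ _ Ii <-] := noiseE Xx; apply/rowP => i; rewrite !mxE.
rewrite -(ExD (Ii i) (remi Xx i)); congr Ex.
by apply/funext => t; rewrite tpE [in LHS]mxE.
Qed.

Lemma tp_mean_bias x : X x -> pnorm 2 (tp_mean x - grad f x) ^+ 2 <= b2.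
Proof.
move=> Xx; rewrite tp_meanE// addrAC subrr add0r.
have [I E] := rem_moment Xx.
by have [_ _ H] := variance_le PuP1 (mrem (XO Xx)) I; exact: le_trans E.
Qed.

(** Split into first-order estimator, its mean and centred remainder with the weights of
    [sqr_sum3_le]; four times the remainder bound is exactly the nu term of [sampling_variance]. *)
Lemma tp_variance x : X x ->
  [/\ forall i, intg PuP (fun t : UX => (two_point F nu x t.1 t.2 - tp_mean x) 0 i),
      Exv PuP (fun t : UX => two_point F nu x t.1 t.2 - tp_mean x) = 0,
      intg PuP (fun t : UX => pnorm p (two_point F nu x t.1 t.2 - tp_mean x) ^+ 2) &
      Ex PuP (fun t : UX => pnorm p (two_point F nu x t.1 t.2 - tp_mean x) ^+ 2) <= sampling_variance].
Proof.
move=> Xx; have Ox := XO Xx.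
have Ii i : intg PuP (fun t : UX => (two_point F nu x t.1 t.2 - tp_mean x) 0 i).
  have := intgB (tpi Xx i) (intg_cst PuP1 (tp_mean x 0 i)).
  by congr intg; apply/funext => t; rewrite !mxE.
have E0 : Exv PuP (fun t : UX => two_point F nu x t.1 t.2 - tp_mean x) = 0.
  apply/rowP => i; rewrite !mxE.
  transitivity (Ex PuP (fun t : UX => two_point F nu x t.1 t.2 0 i - cst (tp_mean x 0 i) t)).
    by congr Ex; apply/funext => t; rewrite [in LHS]mxE [X in _ + X]mxE.
  by rewrite (ExB (tpi Xx i) (intg_cst PuP1 _)) Ex_cst// [X in _ - X]mxE subrr.
have [IN EN _ _] := noiseE Xx; have [IR ER] := rem_moment Xx.
have [IV EV _] := variance_le PuP1 (mrem Ox) IR.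
have [|IJ EJ] := @intg_comb2 _ _ _ PuP PuP1 _ _ 4 4 (2 * Mf ^+ 2) sampling_variance IN IV.
  rewrite /sampling_variance; apply: lerD; last exact: lexx.
  rewrite [leLHS]addrC; apply: lerD.
    apply: (le_trans (ler_wpM2l (ler0n R 4) (le_trans EV ER))).
    by rewrite /b2 mulrCA divff ?mulr1.
  by rewrite -mulrA ler_wpM2l.
have mZ : mvec (fun t : UX => two_point F nu x t.1 t.2 - tp_mean x).
  by apply: mvecB => //; exact: mvec_cst.
suff [] : intg PuP (fun t : UX => pnorm p (two_point F nu x t.1 t.2 - tp_mean x) ^+ 2) /\
  Ex PuP (fun t : UX => pnorm p (two_point F nu x t.1 t.2 - tp_mean x) ^+ 2) <= sampling_variance by [].
apply: (intg_dominated _ _ _ IJ EJ) => [|t|t].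
- exact/measurable_funX/measurable_pnorm.
- exact: sqr_ge0.
- rewrite tp_meanE// tpE.
  have -> : noise x t + rem x t - (grad f x + Exv PuP (rem x)) =
     noise x t - grad f x + (rem x t - Exv PuP (rem x)) by rewrite opprD addrACA.
  apply: (sqr_sum3_le (pnorm_ge0 _ _) (le_trans (pnorm_le (grad f x) (ltr0n R 2) hp) (fM Xx))
    (NM := pnorm p (noise x t - grad f x))).
    by have := pnormD (noise x t) (- grad f x) p1; rewrite pnormN.
  apply: (le_trans (pnormD _ _ p1)); rewrite lerD2l.
  exact: (pnorm_le _ (ltr0n R 2) hp).
Qed.

Let moment6_ge0 : 0 <= moment6.
Proof.
rewrite /moment6 fine_ge0// unlock; apply: integral_ge0 => u _.
by rewrite lee_fin exprn_even_ge0.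
Qed.

(** Both points share the same (u, xi), so the difference of the first-order estimators is linear in
    a gradient difference and (A3) bounds it by |x - y|. The unmatched part carries the factor
    alpha, and the remainders the factor nu. *)
Lemma tp_momentum_variance (alpha : R) x y : X x -> X y -> 0 < alpha <= 1 ->
  let Z := fun t : UX => two_point F nu x t.1 t.2 - (1 - alpha) *: two_point F nu y t.1 t.2
                        - (tp_mean x - (1 - alpha) *: tp_mean y) in
  [/\ mvec Z, forall i, intg PuP (fun t : UX => Z t 0 i), Exv PuP Z = 0,
      intg PuP (fun t : UX => pnorm p (Z t) ^+ 2) &
      Ex PuP (fun t : UX => pnorm p (Z t) ^+ 2) <= 2 * alpha ^+ 2 * sampling_variance
        + 8 * Sp * Lf ^+ 2 * pnorm 2 (x - y) ^+ 2 + 8 * nu ^+ 2 * Lf ^+ 2 * moment6].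
Proof.
move=> Xx Xy /andP[al0 al1] Z; have Ox := XO Xx; have Oy := XO Xy.
have [Ix E0x _ _] := tp_variance Xx; have [Iy E0y _ _] := tp_variance Xy.
have coordBZ (a b : 'rV[R]_d) (k : R) i : (a - k *: b) 0 i = a 0 i - k * b 0 i by rewrite !mxE.
have ZE : Z = (fun t : UX => (two_point F nu x t.1 t.2 - tp_mean x)
     - (1 - alpha) *: (two_point F nu y t.1 t.2 - tp_mean y)).
  by apply/funext => t; rewrite /Z scalerBr; move: (tp_mean x) (_ *: tp_mean y) (_ *: two_point _ _ _ _ _) (two_point _ _ _ _ _) => a1 a2 a3 a4; apply/rowP => i; rewrite !mxE; ring.
have Ii i : intg PuP (fun t : UX => Z t 0 i).
  have := intgB (Ix i) (intgZ (1 - alpha) (Iy i)).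
  by rewrite ZE; congr intg; apply/funext => t; rewrite !mxE.
have EZ : Exv PuP Z = 0.
  apply/rowP => i; rewrite mxE ZE.
  transitivity (Ex PuP (fun t : UX => (two_point F nu x t.1 t.2 - tp_mean x) 0 i -
     (1 - alpha) * (two_point F nu y t.1 t.2 - tp_mean y) 0 i)).
    by congr Ex; apply/funext => t; exact: coordBZ.
  rewrite (ExB (Ix i) (intgZ _ (Iy i))) (ExZ _ (Iy i)).
  move/rowP: E0x => /(_ i); rewrite [X in X = _]mxE => ->.
  move/rowP: E0y => /(_ i); rewrite [X in X = _]mxE => ->.
  by rewrite !mxE mulr0 subrr.
have mZ : mvec Z.
  apply: mvecB; last exact: mvec_cst.
  by apply: mvecB => //; exact: mvecZl.
have [INx ENx _ _] := noiseE Xx; have [IRx ERx] := rem_moment Xx.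
have [IRy ERy] := rem_moment Xy.
pose R' t := rem x t - (1 - alpha) *: rem y t.
have mR' : mvec R' by apply: mvecB; [exact: mrem|apply: mvecZl; exact: mrem].
have [IR' ER'] : intg PuP (fun t => pnorm 2 (R' t) ^+ 2) /\ Ex PuP (fun t => pnorm 2 (R' t) ^+ 2) <= 4 * b2.
  have [IJ EJ] := @intg_comb2 _ _ _ PuP PuP1 _ _ 2 2 0 (4 * b2) IRx IRy (two_budget ERx ERy).
  apply: (intg_dominated _ _ _ IJ EJ) => [|t|t].
  - exact/measurable_funX/measurable_pnorm.
  - exact: sqr_ge0.
  - have := pnormD (rem x t) (- ((1 - alpha) *: rem y t)) (ler1n R 2).
    rewrite pnormN pnormZ// ger0_norm ?subr_ge0// -/(R' t) => H; rewrite addr0.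
    apply: sqr_add_le; first exact: pnorm_ge0.
    apply: (le_trans H); rewrite lerD2l ler_piMl ?pnorm_ge0//.
    by rewrite gerBl ltW.
have [IV EV _] := variance_le PuP1 mR' IR'.
pose DN t := noise x t - noise y t.
have DNE : DN = (fun t : UX => dotv (grad (F ^~ t.2) x - grad (F ^~ t.2) y) t.1 *: (t.1 : 'rV[R]_d)).
  by apply/funext => t; rewrite /DN /noise -scalerBl dotvBl.
have [IDN EDN] : intg PuP (fun t => pnorm p (DN t) ^+ 2) /\
    Ex PuP (fun t => pnorm p (DN t) ^+ 2) <= Sp * (Lf * pnorm 2 (x - y)) ^+ 2.
  rewrite DNE; apply: (noise_moment hSp hSpE (G := fun z => grad (F ^~ z) x - grad (F ^~ z) y)).
    by apply: mvecB; exact: mgrad.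
  exact: msbound.
pose C := 4 * alpha ^+ 2 * Mf ^+ 2 + 4 * (Lf * pnorm 2 (x - y)) ^+ 2.
have [|IJ EJ] := @intg_comb3 _ _ _ PuP PuP1 _ _ _ (8 * alpha ^+ 2) 4 8 C
  (2 * alpha ^+ 2 * sampling_variance + 8 * Sp * Lf ^+ 2 * pnorm 2 (x - y) ^+ 2 + 8 * nu ^+ 2 * Lf ^+ 2 * moment6)
  INx IDN IV.
  rewrite /C /sampling_variance; have VB := le_trans EV ER'; rewrite /b2 in VB.
  exact: (momentum_budget alpha hSp moment6_ge0 ENx EDN VB).
suff [] : intg PuP (fun t : UX => pnorm p (Z t) ^+ 2) /\
   Ex PuP (fun t : UX => pnorm p (Z t) ^+ 2) <= 2 * alpha ^+ 2 * sampling_variance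
     + 8 * Sp * Lf ^+ 2 * pnorm 2 (x - y) ^+ 2 + 8 * nu ^+ 2 * Lf ^+ 2 * moment6 by [].
apply: (intg_dominated _ _ _ IJ EJ) => [|t|t].
- exact/measurable_funX/measurable_pnorm.
- exact: sqr_ge0.
- rewrite /C.
  have ER'E : Exv PuP R' = Exv PuP (rem x) - (1 - alpha) *: Exv PuP (rem y).
    apply/rowP => i; rewrite !mxE.
    rewrite -(ExZ _ (remi Xy i)) -(ExB (remi Xx i) (intgZ _ (remi Xy i))).
    by congr Ex; apply/funext => t'; exact: coordBZ.
  have -> : Z t = alpha *: noise x t - alpha *: grad f x + ((1 - alpha) *: DN t
     - (1 - alpha) *: (grad f x - grad f y)) + (R' t - Exv PuP R').
    rewrite ZE tp_meanE// tp_meanE// !tpE ER'E /R' /DN.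
    exact: momentum_split.
  have T1 := pnormD (alpha *: noise x t - alpha *: grad f x + ((1 - alpha) *: DN t
     - (1 - alpha) *: (grad f x - grad f y))) (R' t - Exv PuP R') p1.
  have T2 := pnormD (alpha *: noise x t - alpha *: grad f x) ((1 - alpha) *: DN t
     - (1 - alpha) *: (grad f x - grad f y)) p1.
  have T3 := pnormD (alpha *: noise x t) (- (alpha *: grad f x)) p1.
  have T4 := pnormD ((1 - alpha) *: DN t) (- ((1 - alpha) *: (grad f x - grad f y))) p1.
  have T5 := pnorm_le (R' t - Exv PuP R') (ltr0n R 2) hp.
  have b1 : pnorm p (alpha *: noise x t) = alpha * pnorm p (noise x t).
    by rewrite pnormZ// gtr0_norm.
  have b3 : pnorm p (- (alpha *: grad f x)) <= alpha * Mf.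
    rewrite pnormN pnormZ// gtr0_norm// ler_wpM2l ?(ltW al0)//.
    by rewrite (le_trans (pnorm_le _ (ltr0n R 2) hp))// fM.
  have a1 : 0 <= 1 - alpha by rewrite subr_ge0.
  have a2 : 1 - alpha <= 1 by rewrite gerBl ltW.
  have b4 : pnorm p ((1 - alpha) *: DN t) <= pnorm p (DN t).
    by rewrite pnormZ// ger0_norm// ler_piMl// pnorm_ge0.
  have b5 : pnorm p (- ((1 - alpha) *: (grad f x - grad f y))) <= Lf * pnorm 2 (x - y).
    rewrite pnormN pnormZ// ger0_norm// (le_trans (ler_piMl (pnorm_ge0 _ _) a2))//.
    by rewrite (le_trans (pnorm_le _ (ltr0n R 2) hp))// fL.
  apply: sqr_sum5_le; first exact: pnorm_ge0.
  apply: (le_trans T1); apply: lerD; last exact: T5.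
  apply: (le_trans T2); rewrite -[leRHS]addrA; apply: lerD.
    by apply: (le_trans T3); rewrite b1 lerD2l.
  exact: (le_trans T4 (lerD b4 b5)).
Qed.

(** Tonelli gives measurability of parametrised integrals of nonnegative functions, hence the split
    into positive and negative parts. *)
Lemma mvec_tp_mean {dT} {T : measurableType dT} (y : T -> 'rV[R]_d) :
  mvec y -> mvec (fun w => tp_mean (y w)).
Proof.
move=> my i; pose Q12 : probability _ R := (Pu \x P)%E.
pose G (z : T * (borelRV R d * Xi)) : R := two_point F nu (y z.1) z.2.1 z.2.2 0 i.
have mG : measurable_fun setT (EFin \o G).
  apply/measurable_EFinP; apply: mvec_two_point => //.
  - by move=> j; exact: (measurableT_comp (my j) measurable_fst).
  - apply/mvecP; exact: (measurableT_comp measurable_fst measurable_snd).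
  - exact: (measurableT_comp measurable_snd measurable_snd).
have -> : (fun w => tp_mean (y w) 0 i) =
    (fun w => fine (fubini_F Q12 (EFin \o G)^\+ w - fubini_F Q12 (EFin \o G)^\- w)%E).
  apply/funext => w; rewrite mxE /Ex /Rintegral integralE.
  by congr (fine (_ - _)%E); apply: eq_integral => t _; rewrite ?funeposE ?funenegE.
apply: (measurableT_comp (fine_measurable measurableT)).
by apply: emeasurable_funB; apply: measurable_fun_fubini_tonelli_F => //;
  [exact: measurable_funepos|exact: measurable_funeneg].
Qed.

Context (x0 : 'rV[R]_d) (Xx0 : X x0) (mu eta alpha rho beta : R) (rhos : nat -> R) (K n0 n : nat).
Context (hmu : 0 < mu) (heta : 0 < eta) (hal : 0 < alpha <= 1) (hrho : 0 < rho) (hbeta : 0 < beta)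
  (hn0 : (0 < n0)%N) (hn : (0 < n)%N) (hK : (0 < K)%N)
  (hrhos : forall k, (k < K)%N -> rhos k = rho / K%:R).
Context {dO : measure_display} {Omega : measurableType dO} (Pr : probability Omega R)
  (u : nat -> nat -> Omega -> borelRV R d) (xi : nat -> nat -> Omega -> Xi)
  (r : Omega -> 'I_K).
Context (hu : forall k j, (k < K)%N -> (j < batch n0 n k)%N -> has_law Pr (u k j) Pu)
  (hxi : forall k j, (k < K)%N -> (j < batch n0 n k)%N -> has_law Pr (xi k j) P)
  (hr : forall k : 'I_K, measurable (r @^-1` [set k]) /\ Pr (r @^-1` [set k]) = (K%:R^-1)%:E)
  (hind : mutually_independent Pr (used_sources K n0 n) (source_sigma u xi r)).
Context (x s : nat -> Omega -> 'rV[R]_d) (lam : nat -> Omega -> 'rV[R]_m).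
Context (hrun : forall w, is_run F X h c v mu eta nu alpha rhos K n0 n x0
            (fun k j => u k j w) (fun k j => xi k j w)
            (fun k => x k w) (fun k => s k w) (fun k => lam k w))
  (hreg : forall w k, (k <= K)%N -> beta * pnorm p (c (x k w))
       <= lpdist p (gradT c (x k w) (c (x k w))) [set - g | g in normal_cone X (x k w)]).
Context (hetaL : eta * (Lf + m%:R * (mu * Mc ^+ 2 + mu * Mbc * Lc + rho * Mbc * Lc)) <= 1 / 2)
  (hnb : 96 * (p - 1) * Sp * eta ^+ 2 * Lf ^+ 2 / alpha <= n%:R).

(** Sources of the iterations before k. The output index is excluded, so that it stays independent
    of the whole run. *)
Definition past k : set source := [set i | match i with
  | inl (inl (k', j)) | inl (inr (k', j)) => (k' < k)%N /\ (j < batch n0 n k')%N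
  | inr _ => False
  end].

Let D := used_sources K n0 n.
Let G := source_sigma u xi r.
Notation OA A := (g_sigma_algebraType (sigma_of G A)).

Lemma source_sigma_measurable i : D i -> G i `<=` measurable.
Proof.
case: i => [[[k j]|[k j]]|[]] /=.
- move=> [kK jb] _ [B mB <-]; exact: (hu kK jb).1.
- move=> [kK jb] _ [B mB <-]; exact: (hxi kK jb).1.
- move=> _ _ [B _ <-]; rewrite setTI.
  have -> : r @^-1` B = \bigcup_(k in B) (r @^-1` [set k]).
    apply/seteqP; split => [w Bw|w [k Bk /= rk]]; first by exists (r w).
    by rewrite /= rk.
  by apply: fin_bigcup_measurable => [|k _]; [exact: finite_finset|exact: (hr _).1].
Qed.

Lemma source_sigma_setI i : D i -> setI_closed (G i).
Proof.
case: i => [[[k j]|[k j]]|[]] _ /=; apply: preimage_system_setI => A B // mA mB.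
- exact: measurableI.
- exact: measurableI.
Qed.

Lemma source_sigma_setT i : D i -> G i setT.
Proof.
by case: i => [[[k j]|[k j]]|[]] _ /=; exists setT => //=; rewrite setTI.
Qed.

Lemma pastD k : (k <= K)%N -> past k `<=` D.
Proof.
by move=> kK [[[k' j]|[k' j]]|//] /= [k'k jb]; split => //; exact: leq_trans kK.
Qed.

Lemma past_mono k l : (k <= l)%N -> past k `<=` past l.
Proof.
by move=> kl [[[k' j]|[k' j]]|//] /= [k'k jb]; split => //; exact: leq_trans kl.
Qed.

Let iu k j : source := inl (inl (k, j)).
Let ixi k j : source := inl (inr (k, j)).

Let uP k j C : measurable C -> G (iu k j) (u k j @^-1` C).
Proof. by move=> mC; exists C => //; rewrite setTI. Qed.

Let xiP k j C : measurable C -> G (ixi k j) (xi k j @^-1` C).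
Proof. by move=> mC; exists C => //; rewrite setTI. Qed.

Lemma run_x0 w : x 0%N w = x0. Proof. by have [[]] := hrun w. Qed.
Lemma run_lam0 w : lam 0%N w = 0. Proof. by have [[]] := hrun w. Qed.

Lemma run_argmin w k : (k < K)%N -> is_argmin X
   (fun y => ((dotv (s k w + gradT c (x k w) (lam k w + mu *: c (x k w)))%R y)%:E
              + h y + (eta^-1 * bregman v (x k w) y)%R%:E)%E) (x k.+1 w).
Proof. by have [_ _ _ + _] := hrun w; exact. Qed.

Lemma run_X w k : (k <= K)%N -> X (x k w).
Proof. by case: k => [|k kK]; [rewrite run_x0|exact: (run_argmin w kK).1]. Qed.

Lemma mvec_constraint {dT} {T : measurableType dT} (y : T -> 'rV[R]_d) :
  mvec y -> mvec (fun w => c (y w)).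
Proof.
move=> my i; apply: (measurable_real_continuous_comp (f := comp_fun c i)) => // z.
by apply: differentiable_continuous; exact: (cC i).1.
Qed.

Lemma mvec_gradT {dT} {T : measurableType dT} (y : T -> 'rV[R]_d) (l : T -> 'rV[R]_m) :
  mvec y -> mvec l -> mvec (fun w => gradT c (y w) (l w)).
Proof.
move=> my ml; apply: mvec_sum => i; apply: mvecZ; first exact: ml.
move=> j; apply: (measurable_real_continuous_comp (f := fun z => grad (comp_fun c i) z 0 j)) => //.
move=> z; apply: (@continuous_comp _ _ _ (grad (comp_fun c i)) (fun y : 'rV[R]_d => y 0 j)).
  exact: (cC i).2.
exact: coord_continuous.
Qed.

Lemma adapted_step A k : (k < K)%N -> @mvec _ (OA A) R d (x k) -> @mvec _ (OA A) R m (lam k) ->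
  @mvec _ (OA A) R d (s k) -> @mvec _ (OA A) R d (x k.+1).
Proof.
move=> kK mx ml ms.
pose g w := s k w + gradT c (x k w) (lam k w + mu *: c (x k w)).
have mg : @mvec _ (OA A) R d g.
  apply: mvecD => //; apply: mvec_gradT => //; apply: mvecD => //.
  exact: (mvecZl mu (mvec_constraint mx)).
exact: (@mvec_argmin R d p q p1 q0 hpq X h v eta Lv _ (OA A) g (x k) (x k.+1) heta cX ch
  hfin dv vmon vsm mg mx (fun w => run_X w (ltnW kK)) (fun w => run_argmin w kK) q1).
Qed.

Lemma mvec_source A k j (y : Omega -> 'rV[R]_d) : A (iu k j) -> A (ixi k j) ->
  @mvec _ (OA A) R d y -> @mvec _ (OA A) R d (fun w => two_point F nu (y w) (u k j w) (xi k j w)).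
Proof.
move=> Au Axi my; apply: mvec_two_point => //.
- by apply/mvecP; apply: (measurable_source Au) => C mC; exact: uP.
- by apply: (measurable_source Axi) => C mC; exact: xiP.
Qed.

(** The shift matters: x^k and lam^k use only iterations before k, while s^k also uses the samples
    of iteration k. *)
Lemma adapted k : (k < K)%N ->
  [/\ @mvec _ (OA (past k)) R d (x k), @mvec _ (OA (past k)) R m (lam k) &
      @mvec _ (OA (past k.+1)) R d (s k)].
Proof.
elim: k => [_|k IH kK].
  have mx : @mvec _ (OA (past 0)) R d (x 0%N).
    rewrite (_ : x 0%N = cst x0); first exact: mvec_cst.
    by apply/funext => w; exact: run_x0.
  split => //.
    rewrite (_ : lam 0%N = cst 0); first exact: mvec_cst.
    by apply/funext => w; exact: run_lam0.
  have -> : s 0%N = (fun w => n0%:R^-1 *: \sum_(j < n0) two_point F nu (x 0%N w) (u 0 j w) (xi 0 j w)).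
    by apply/funext => w; have [_ -> _ _ _] := hrun w.
  apply: mvecZl.
  rewrite (_ : (fun w => _) = (fun w => \sum_(j <- index_enum 'I_n0) two_point F nu (x 0%N w) (u 0 j w) (xi 0 j w)))//.
  apply: mvec_sum => j; apply: mvec_source => //=.
  exact: (mvec_sigma_of (past_mono (leqnSn 0))).
have [mx ml ms] := IH (ltnW kK).
have mxS : @mvec _ (OA (past k.+1)) R d (x k.+1).
  by apply: adapted_step => //; [exact: ltnW|exact: (mvec_sigma_of (past_mono (leqnSn k)))|
    exact: (mvec_sigma_of (past_mono (leqnSn k)))].
split => //.
  have -> : lam k.+1 = (fun w => lam k w + rhos k *: c (x k w)).
    by apply/funext => w; have [_ _ _ _ ->] := hrun w; rewrite // ltnW.
  apply: (mvec_sigma_of (past_mono (leqnSn k))).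
  by apply: mvecD => //; apply: mvecZl; exact: mvec_constraint.
have -> : s k.+1 = (fun w => n%:R^-1 *: \sum_(j < n)
   (two_point F nu (x k.+1 w) (u k.+1 j w) (xi k.+1 j w)
    + (1 - alpha) *: (s k w - two_point F nu (x k w) (u k.+1 j w) (xi k.+1 j w)))).
  by apply/funext => w; have [_ _ H _ _] := hrun w; exact: H.
apply: mvecZl.
rewrite (_ : (fun w => _) = (fun w => \sum_(j <- index_enum 'I_n)
   (two_point F nu (x k.+1 w) (u k.+1 j w) (xi k.+1 j w)
    + (1 - alpha) *: (s k w - two_point F nu (x k w) (u k.+1 j w) (xi k.+1 j w)))))//.
apply: mvec_sum => j; apply: mvecD.
  by apply: mvec_source => //=; exact: (mvec_sigma_of (past_mono (leqnSn k.+1))).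
apply: mvecZl; apply: mvecB; first exact: (mvec_sigma_of (past_mono (leqnSn k.+1))).
by apply: mvec_source => //=; exact: (mvec_sigma_of (past_mono (leqW (leqnSn k)))).
Qed.

Local Notation mean := tp_mean.
Local Notation sig2 := sampling_variance.

Definition error k w := s k w - mean (x k w).

Definition step_noise k w := 2 * alpha ^+ 2 * sig2
  + 8 * Sp * Lf ^+ 2 * pnorm 2 (x k.+1 w - x k w) ^+ 2 + 8 * nu ^+ 2 * Lf ^+ 2 * moment6.

Let inj_iu k : injective (iu k). Proof. by move=> j l [->]. Qed.
Let inj_ixi k : injective (ixi k). Proof. by move=> j l [->]. Qed.
Let iu_ixi k j l : iu k j != ixi k l. Proof. by []. Qed.
Let past_iu k j : ~ past k (iu k j). Proof. by move=> [/=]; rewrite ltnn. Qed.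
Let past_ixi k j : ~ past k (ixi k j). Proof. by move=> [/=]; rewrite ltnn. Qed.

Lemma mvec_error k : (k < K)%N -> @mvec _ (OA (past k.+1)) R d (error k).
Proof.
move=> kK; have [mx _ ms] := adapted kK; apply: mvecB => //.
by apply: mvec_tp_mean => //; exact: (mvec_sigma_of (past_mono (leqnSn k))).
Qed.

(** The batch of n0 centred samples is summed from 0 with step 1 / n0, and n0 (p - 1) / n0^2 = (p -
    1) / n0. *)
Lemma error_init :
  (\int[Pr]_w (pnorm p (error 0 w) ^+ 2)%:E <= ((p - 1) / n0%:R * sig2)%:E)%E.
Proof.
pose Z (w : Omega) (t : borelRV R d * Xi) := two_point F nu x0 t.1 t.2 - mean x0.
have V := tp_variance Xx0.
have [IZ EZ IZ2 EZ2] := V.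
have sig0 : 0 <= sig2 by apply: le_trans EZ2; apply: Rintegral_ge0 => t _; exact: sqr_ge0.
have mZ : @mvec _ (OA (past 0) * (borelRV R d * Xi))%type R d (fun z => Z z.1 z.2).
  apply: mvecB; last exact: mvec_cst.
  apply: (@mvec_two_point R d _ _ _ Xi F nu (fun=> x0)) => //.
  - by apply/mvecP; exact: (measurableT_comp measurable_fst measurable_snd).
  - exact: (measurableT_comp measurable_snd measurable_snd).
have me : @mvec _ (OA (past 0)) R d (cst 0) by exact: mvec_cst.
have := @partial_sum_moment R _ Omega Pr source D G source_sigma_measurable
  source_sigma_setI source_sigma_setT hind _ _ _ _ Pu P p hp d n0 (iu 0) (ixi 0) (u 0%N) (xi 0%N)
  (past 0) (pastD (leq0n K)) _ _ (fun j _ => @past_iu 0 j) (fun j _ => @past_ixi 0 j)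
  (inj_iu (k := 0)) (inj_ixi (k := 0)) (iu_ixi 0) (fun j C _ => @uP 0 j C)
  (fun j C _ => @xiP 0 j C) _ _ Z (fun=> sig2) (cst 0) n0%:R^-1 mZ me
  (fun=> IZ) (fun=> EZ) (fun=> IZ2) (fun=> EZ2) (fun=> sig0) _ n0 (leqnn n0).
move=> /(_ (fun j jb => conj hK jb) (fun j jb => conj hK jb) (fun j => @hu 0 j hK)
  (fun j => @hxi 0 j hK) (@measurable_cst _ _ _ _ _ _)).
have -> : (\int[Pr]_w (pnorm p (cst 0 w + n0%:R^-1 *: \sum_(l < n0) Z w (u 0 l w, xi 0 l w)) ^+ 2)%:E
  = \int[Pr]_w (pnorm p (error 0 w) ^+ 2)%:E)%E.
  apply: eq_integral => w _; congr ((pnorm p _ ^+ 2)%:E).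
  have [_ s0 _ _ _] := hrun w.
  rewrite add0r /error s0 run_x0 sumrB scalerBr sumr_const card_ord -(scaler_nat n0 (mean x0)) scalerA.
  by rewrite mulVf ?scale1r// pnatr_eq0 -lt0n.
move=> H; apply: (le_trans H).
rewrite integral0_eq => [|w _]; last by rewrite (pnorm0 (lt_le_trans (ltr0n R 2) hp)) expr2 mul0r.
have -> : (\int[Pr]__ sig2%:E = sig2%:E)%E.
  by rewrite integral_cst// -[RHS]mule1; congr (_ * _)%E; exact: (probability_setT Pr).
rewrite add0e -EFinM lee_fin.
rewrite le_eqVlt; apply/orP; left; apply/eqP; field.
by rewrite pnatr_eq0 -lt0n.
Qed.

(** The new error is (1 - alpha) times the old one plus the average of n samples, centred given the
    sources up to iteration k, which determine x^(k+1), x^k and s^k. *)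
Lemma error_step k : (k.+1 < K)%N ->
  (\int[Pr]_w (pnorm p (error k.+1 w) ^+ 2)%:E <=
   ((1 - alpha) ^+ 2)%:E * \int[Pr]_w (pnorm p (error k w) ^+ 2)%:E
    + ((p - 1) / n%:R)%:E * \int[Pr]_w (step_noise k w)%:E)%E.
Proof.
move=> kK; have kK' := ltnW kK.
have [mx _ ms] := adapted kK'; have [mx1 _ _] := adapted kK.
pose A := past k.+1.
have mxA : @mvec _ (OA A) R d (x k) by exact: (mvec_sigma_of (past_mono (leqnSn k))).
pose M w := mean (x k.+1 w) - (1 - alpha) *: mean (x k w).
have mM : @mvec _ (OA A) R d M.
  by apply: mvecB; [|apply: mvecZl]; exact: mvec_tp_mean.
pose Z (w : Omega) (t : borelRV R d * Xi) := two_point F nu (x k.+1 w) t.1 t.2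
   - (1 - alpha) *: two_point F nu (x k w) t.1 t.2 - M w.
have V w := tp_momentum_variance (run_X w kK') (run_X w (ltnW kK')) hal.
have IZ w i : intg (Pu \x P)%E (fun t => Z w t 0 i) by have [_ I _ _ _] := V w; exact: I.
have EZ w : Exv (Pu \x P)%E (Z w) = 0 by have [_ _ I _ _] := V w; exact: I.
have IZ2 w : intg (Pu \x P)%E (fun t => pnorm p (Z w t) ^+ 2) by have [_ _ _ I _] := V w; exact: I.
have EZ2 w : Ex (Pu \x P)%E (fun t => pnorm p (Z w t) ^+ 2) <= step_noise k w.
  by have [_ _ _ _ I] := V w; exact: I.
have sn0 w : 0 <= step_noise k w.
  by apply: le_trans (EZ2 w); apply: Rintegral_ge0 => t _; exact: sqr_ge0.
have mT (y : Omega -> 'rV[R]_d) : @mvec _ (OA A) R d y ->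
   @mvec _ (OA A * (borelRV R d * Xi))%type R d (fun z => two_point F nu (y z.1) z.2.1 z.2.2).
  move=> my; apply: mvec_two_point => //.
  - by move=> i; exact: (measurableT_comp (my i) measurable_fst).
  - by apply/mvecP; exact: (measurableT_comp measurable_fst measurable_snd).
  - exact: (measurableT_comp measurable_snd measurable_snd).
have mZ : @mvec _ (OA A * (borelRV R d * Xi))%type R d (fun z => Z z.1 z.2).
  apply: mvecB; last by move=> i; exact: (measurableT_comp (mM i) measurable_fst).
  by apply: mvecB; [|apply: mvecZl]; exact: mT.
have me : @mvec _ (OA A) R d (fun w => (1 - alpha) *: error k w).
  by apply: mvecZl; exact: mvec_error.
have mB : measurable_fun [set: OA A] (step_noise k).
  apply: measurable_funD; last exact: measurable_cst.
  apply: measurable_funD; first exact: measurable_cst.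
  apply: measurable_funM; first exact: measurable_cst.
  by apply/measurable_funX/measurable_pnorm; exact: mvecB.
have := @partial_sum_moment R _ Omega Pr source D G source_sigma_measurable
  source_sigma_setI source_sigma_setT hind _ _ _ _ Pu P p hp d n (iu k.+1) (ixi k.+1)
  (u k.+1) (xi k.+1)
  A (pastD kK') _ _ (fun j _ => @past_iu k.+1 j) (fun j _ => @past_ixi k.+1 j)
  (inj_iu (k := k.+1)) (inj_ixi (k := k.+1)) (iu_ixi k.+1) (fun j C _ => @uP k.+1 j C)
  (fun j C _ => @xiP k.+1 j C) _ _ Z (step_noise k) _ n%:R^-1 mZ me
  IZ EZ IZ2 EZ2 sn0 mB n (leqnn n).
move=> /(_ (fun j jb => conj kK jb) (fun j jb => conj kK jb) (fun j => @hu k.+1 j kK)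
  (fun j => @hxi k.+1 j kK)).
have -> : (\int[Pr]_w (pnorm p ((1 - alpha) *: error k w + n%:R^-1 *: \sum_(l < n) Z w (u k.+1 l w, xi k.+1 l w)) ^+ 2)%:E
  = \int[Pr]_w (pnorm p (error k.+1 w) ^+ 2)%:E)%E.
  apply: eq_integral => w _; congr ((pnorm p _ ^+ 2)%:E).
  have [_ _ /(_ _ kK) sk _ _] := hrun w.
  have n0' : n%:R != 0 :> R by rewrite pnatr_eq0 -lt0n.
  rewrite {2}/error sk.
  have E (a : 'rV[R]_d) : n%:R^-1 *: \sum_(l < n) a = a.
    by rewrite sumr_const card_ord -(scaler_nat n a) scalerA mulVf ?scale1r.
  rewrite -{1}[error k w]E -{1}(E (mean (x k.+1 w))) scalerA mulrC -scalerA -!scalerDr -scalerBr; congr (_ *: _).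
  rewrite scaler_sumr -big_split -sumrB; apply: eq_bigr => l _ /=.
  rewrite /Z /M /error /=.
  move: (mean _) (mean _) (two_point _ _ _ _ _) (two_point _ _ _ _ _) (s k w) => a1 a2 a3 a4 a5.
  by apply/rowP => i; rewrite !mxE; ring.
move=> H; apply: (le_trans H); apply: leeD.
  have -> : (\int[Pr]_w (pnorm p ((1 - alpha) *: error k w) ^+ 2)%:E =
      \int[Pr]_w (((1 - alpha) ^+ 2)%:E * (pnorm p (error k w) ^+ 2)%:E))%E.
    apply: eq_integral => w _; rewrite -EFinM; congr EFin.
    by rewrite (pnormZ _ _ (lt_le_trans (ltr0n R 2) hp)) exprMn real_normK ?num_real.
  rewrite ge0_integralZl_EFin ?sqr_ge0//.
  - by move=> w _; rewrite lee_fin sqr_ge0.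
  - apply/measurable_EFinP/measurable_funX/measurable_pnorm => i.
    by apply: (measurable_fun_sub (sigma_of_measurable source_sigma_measurable (pastD kK'))); exact: mvec_error.
rewrite (_ : n%:R * (p - 1) * n%:R^-1 ^+ 2 = (p - 1) / n%:R)//.
by field; rewrite pnatr_eq0 -lt0n.
Qed.

Lemma mvec_run k : (k <= K)%N -> mvec (x k).
Proof.
case: k => [_|k kK] i.
  have [mx _ _] := adapted hK.
  exact: (measurable_fun_sub (sigma_of_measurable source_sigma_measurable (pastD (leq0n K))) (mx i)).
have [mx ml ms] := adapted kK.
have mx' := adapted_step kK (mvec_sigma_of (past_mono (leqnSn k)) mx)
  (mvec_sigma_of (past_mono (leqnSn k)) ml) ms.
exact: (measurable_fun_sub (sigma_of_measurable source_sigma_measurable (pastD kK)) (mx' i)).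
Qed.

Lemma mvec_error_run k : (k < K)%N -> mvec (error k).
Proof.
move=> kK i.
exact: (measurable_fun_sub (sigma_of_measurable source_sigma_measurable (pastD kK)) (mvec_error kK i)).
Qed.

Lemma measurable_output (phi : 'rV[R]_d -> R) :
  (forall (dT : measure_display) (T : measurableType dT) (y : T -> 'rV[R]_d), mvec y ->
     measurable_fun [set: T] (fun w => phi (y w))) ->
  measurable_fun [set: Omega] (fun w => phi (x (r w) w)).
Proof.
move=> mphi; rewrite (_ : (fun w => _) =
    (fun w => \sum_(k <- index_enum 'I_K) \1_(r @^-1` [set k]) w * phi (x k w))).
  apply: measurable_sum => k; apply: measurable_funM; first by apply: measurable_indic; exact: (hr k).1.
  by apply: mphi; apply: mvec_run; exact: ltnW.
apply/funext => w; rewrite (bigD1 (r w))//= indicE mem_set// mul1r big1 ?addr0// => k.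
by move=> kr; rewrite indicE memNset ?mul0r//= => rk; rewrite rk eqxx in kr.
Qed.

(** The event R = k is independent of the sources that determine x^k, so each term of the
    decomposition over the values of R factors with probability 1 / K. *)
Lemma output_moment (phi : 'rV[R]_d -> R) :
  (forall (dT : measure_display) (T : measurableType dT) (y : T -> 'rV[R]_d), mvec y ->
     measurable_fun [set: T] (fun w => phi (y w))) ->
  (forall y, 0 <= phi y) -> (forall k : 'I_K, Pr (r @^-1` [set k]) = (K%:R^-1)%:E) ->
  (\int[Pr]_w (phi (x (r w) w))%:E =
    \sum_(k < K) (K%:R^-1)%:E * \int[Pr]_w (phi (x k w))%:E)%E.
Proof.
move=> mphi phi0 rK.
have mb : measurable_fun [set: bool] (fun b : bool => b%:R : R) by move=> _ B _.
have mr' (k : 'I_K) : measurable_fun [set: Omega] (fun w => r w == k).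
  move=> _ B _; rewrite setTI.
  have [D' DE] : exists D' : set 'I_K, (fun w => r w == k) @^-1` B = \bigcup_(l in D') (r @^-1` [set l]).
    exists [set l | B (l == k)]; apply/seteqP; split => [w Bw|w [l /= Bl rl]].
      by exists (r w).
    by rewrite /= rl.
  by rewrite DE; apply: fin_bigcup_measurable => [|l _]; [exact: finite_finset|exact: (hr _).1].
have step (k : 'I_K) : (\int[Pr]_w (phi (x k w) * (r w == k)%:R)%:E =
    (K%:R^-1)%:E * \int[Pr]_w (phi (x k w))%:E)%E.
  have [mx _ _] := adapted (ltn_ord k).
  have kK := ltnW (ltn_ord k); have mrk := (hr k).1.
  pose Y w := r w == k.
  pose Ym : {mfun Omega >-> bool} := HB.pack Y (isMeasurableFun.Build _ _ _ _ Y (mr' k)).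
  pose Q : probability bool R := distribution Pr Ym.
  have nr : ~ past k (inr tt) by [].
  have Dr : D (inr tt) by [].
  have ind E B : <<s sigma_of G (past k) >> E -> measurable B ->
      (Pr (E `&` Y @^-1` B) = Pr E * Q B)%E.
    move=> sE mB; apply: (indep_sigma_of source_sigma_measurable source_sigma_setI
      source_sigma_setT hind (pastD kK) Dr nr sE).
    by exists [set l | B (l == k)] => //; rewrite setTI.
  pose g (z : OA (past k) * bool) : \bar R := (phi (x k z.1) * z.2%:R)%:E.
  have mg : measurable_fun setT g.
    apply/measurable_EFinP/measurable_funM.
      exact: (measurableT_comp (mphi _ _ _ mx) measurable_fst).
    exact: (measurableT_comp mb measurable_snd).
  have := freeze (sigma_of_measurable source_sigma_measurable (pastD kK)) (mr' k) ind mg.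
  rewrite /g /= => ->; last by move=> z; rewrite lee_fin mulr_ge0.
  have -> : (\int[Pr]_w (\int[Q]_y (phi (x k w) * y%:R)%:E) =
     \int[Pr]_w ((K%:R^-1)%:E * (phi (x k w))%:E))%E.
    apply: eq_integral => w _.
    rewrite ge0_integral_distribution//=; last by move=> b; rewrite lee_fin mulr_ge0.
    have -> : (\int[Pr]_w0 (phi (x k w) * (Y w0)%:R)%:E =
      \int[Pr]_w0 ((phi (x k w))%:E * (\1_(r @^-1` [set k]) w0)%:E))%E.
      apply: eq_integral => w0 _; rewrite -EFinM indicE /Y; congr (_ * _%:R)%:E.
      by congr nat_of_bool; apply/eqP/idP => [H|/set_mem//]; exact/mem_set.
    rewrite ge0_integralZl_EFin//; last first.
      by apply/measurable_EFinP; apply: measurable_indic; exact: (hr k).1.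
    by rewrite integral_indic// setIT muleC; congr (_ * _)%E; exact: rK.
  rewrite ge0_integralZl_EFin ?invr_ge0//.
  - by move=> w _; rewrite lee_fin.
  - by apply/measurable_EFinP; apply: mphi; exact: mvec_run.
under eq_bigr do rewrite -step.
rewrite -ge0_integral_sum//=.
- apply: eq_integral => w _; rewrite sumEFin (bigD1 (r w))//= eqxx mulr1 big1 ?addr0// => k.
  by rewrite eq_sym => /negbTE ->; rewrite mulr0.
- move=> k; apply/measurable_EFinP/measurable_funM.
    by apply: mphi; apply: mvec_run; exact: ltnW.
  exact: (measurableT_comp mb (mr' k)).
- by move=> k w _; rewrite lee_fin mulr_ge0.
Qed.

Local Notation err k w := (error k w).
Let Delta0 := f x0 + fine (h x0) + mu / 2 * pnorm 2 (c x0) ^+ 2 - Phi_inf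
                + 2 * m%:R * rho * Mbc ^+ 2.

Let Pr1 : Pr [set: Omega] = 1%E := probability_setT Pr.

Let move2 k w := pnorm q (x k.+1 w - x k w) ^+ 2.

Let intg_bounded (g : Omega -> R) (B : R) : measurable_fun [set: Omega] g ->
  (forall w, 0 <= g w <= B) -> intg Pr g.
Proof.
move=> mg gB; apply: (intg_le mg (intg_cst Pr1 B)) => w.
by have /andP[g0 gb] := gB w; rewrite ger0_norm.
Qed.

(** Boundedness of [X] serves for integrability of the moves; its radius does not reach the final
    constants. *)
Let intg_move2 k : (k < K)%N -> intg Pr (move2 k).
Proof.
move=> kK; apply: (intg_bounded (B := (DX + DX) ^+ 2)).
  by apply/measurable_funX/measurable_pnorm; apply: mvecB; apply: mvec_run => //; exact: ltnW.
move=> w; rewrite sqr_ge0/=.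
have H : pnorm q (x k.+1 w - x k w) <= DX + DX.
  apply: (le_trans (pnormD _ _ q1)); rewrite pnormN.
  by apply: lerD; apply/Xbnd/run_X => //; exact: ltnW.
by rewrite lerXn2r ?nnegrE ?pnorm_ge0// (le_trans _ H) ?pnorm_ge0.
Qed.

Let intg_constraint k : (k <= K)%N -> intg Pr (fun w => pnorm p (c (x k w)) ^+ 2).
Proof.
move=> kK; apply: (intg_bounded (B := m%:R * Mbc ^+ 2)).
  by apply/measurable_funX/measurable_pnorm; apply: mvec_constraint; exact: mvec_run.
move=> w; rewrite sqr_ge0/=.
apply: (@le_trans _ _ (pnorm 2 (c (x k w)) ^+ 2)).
  by rewrite lerXn2r ?nnegrE ?pnorm_ge0//; exact: (pnorm_le _ (ltr0n R 2) hp).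
rewrite -dotvv /dotv (le_trans (ler_sum _ _ (G := fun=> Mbc ^+ 2)) _)//.
  move=> i _; rewrite -expr2 -real_normK ?num_real//.
  by rewrite lerXn2r ?nnegrE ?(ltW hMbc)// cb//; exact: run_X.
by rewrite sumr_const card_ord mulr_natl.
Qed.

Let noiseB := 2 * alpha ^+ 2 * sig2 + 8 * nu ^+ 2 * Lf ^+ 2 * moment6.

Local Notation snoise k := (step_noise k).

Let snoise_moment k : (k < K)%N -> intg Pr (snoise k) /\
  Ex Pr (snoise k) <= noiseB + 8 * Sp * Lf ^+ 2 * Ex Pr (move2 k).
Proof.
move=> kK; have IM := intg_move2 kK.
have I1 := intgD (intg_cst Pr1 noiseB) (intgZ (8 * Sp * Lf ^+ 2) IM).
have E1 : Ex Pr (fun w => cst noiseB w + 8 * Sp * Lf ^+ 2 * move2 k w) =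
    noiseB + 8 * Sp * Lf ^+ 2 * Ex Pr (move2 k).
  by rewrite (ExD (intg_cst Pr1 noiseB) (intgZ _ IM)) (ExZ _ IM) (Ex_cst Pr1).
have m2 : measurable_fun [set: Omega] (fun w => pnorm 2 (x k.+1 w - x k w) ^+ 2).
  by apply/measurable_funX/measurable_pnorm; apply: mvecB; apply: mvec_run => //; exact: ltnW.
have I2 : intg Pr (fun w => pnorm 2 (x k.+1 w - x k w) ^+ 2).
  apply: (intg_le m2 IM) => w; rewrite ger0_norm ?sqr_ge0//.
  by rewrite lerXn2r ?nnegrE ?pnorm_ge0//; exact: (pnorm_le _ q0 q2).
have I3 : intg Pr (snoise k).
  apply: intgD; last exact: intg_cst.
  by apply: intgD; [exact: intg_cst|exact: intgZ].
split => //; rewrite -E1; apply: (Ex_le I3 I1) => w.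
rewrite /step_noise addrAC -/noiseB [cst _ _]/= lerD2l.
apply: ler_wpM2l; first by rewrite mulr_ge0 ?sqr_ge0// mulr_ge0// (le_trans _ hSp).
by rewrite /move2 lerXn2r ?nnegrE ?pnorm_ge0//; exact: (pnorm_le _ q0 q2).
Qed.

Let merr2 k : (k < K)%N -> measurable_fun [set: Omega] (fun w => pnorm p (err k w) ^+ 2).
Proof. by move=> kK; apply/measurable_funX/measurable_pnorm; exact: mvec_error_run. Qed.

Let Einit : intg Pr (fun w => pnorm p (err 0%N w) ^+ 2) /\
  Ex Pr (fun w => pnorm p (err 0%N w) ^+ 2) <= (p - 1) / n0%:R * sig2.
Proof.
apply: (intg_ge0 (merr2 hK)); first by move=> w; exact: sqr_ge0.
exact: error_init.
Qed.

(** Integrability is carried along with the bound: the extended inequality [error_step] becomes a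
    real one only once the previous error has a finite mean square. *)
Let Estep k : (k.+1 < K)%N -> intg Pr (fun w => pnorm p (err k w) ^+ 2) ->
  intg Pr (fun w => pnorm p (err k.+1 w) ^+ 2) /\
  Ex Pr (fun w => pnorm p (err k.+1 w) ^+ 2) <=
    (1 - alpha) ^+ 2 * Ex Pr (fun w => pnorm p (err k w) ^+ 2)
    + (p - 1) / n%:R * (noiseB + 8 * Sp * Lf ^+ 2 * Ex Pr (move2 k)).
Proof.
move=> kK Ik; have [IS ES] := snoise_moment (ltnW kK).
apply: (intg_ge0 (merr2 kK)); first by move=> w; exact: sqr_ge0.
have := error_step kK.
rewrite (EFin_Ex Ik) (EFin_Ex IS) -!EFinM -EFinD => H; apply: (le_trans H).
by rewrite lee_fin lerD2l ler_wpM2l// divr_ge0// subr_ge0.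
Qed.

Let intg_err k : (k < K)%N -> intg Pr (fun w => pnorm p (err k w) ^+ 2).
Proof.
elim: k => [_|k IH kK]; first exact: Einit.1.
exact: (Estep kK (IH (ltnW kK))).1.
Qed.

Let SA := \sum_(k < K) Ex Pr (fun w => pnorm p (err k w) ^+ 2).
Let SD := \sum_(k < K) Ex Pr (move2 k) / eta ^+ 2.
Let T := K%:R * (p - 1) * sig2 * (1 / (n0%:R * alpha * K%:R) + 2 * alpha / n%:R).

Let Ex_sqr_ge0 (g : Omega -> R) : (forall w, 0 <= g w) -> 0 <= Ex Pr g.
Proof. by move=> g0; apply: Rintegral_ge0 => w _; exact: g0. Qed.

Let K0 : 0 < K%:R :> R. Proof. by rewrite ltr0n. Qed.

Let SD0 : 0 <= SD.
Proof.
apply: sumr_ge0 => k _; rewrite divr_ge0 ?sqr_ge0//.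
by apply: Ex_sqr_ge0 => w; exact: sqr_ge0.
Qed.

Let sig20 : 0 <= sig2.
Proof.
have Sp0 : 0 <= Sp by rewrite (le_trans _ hSp).
apply: addr_ge0; last by rewrite mulr_ge0 ?sqr_ge0.
apply: addr_ge0; first exact: (mulr_ge0 (mulr_ge0 (sqr_ge0 _) (sqr_ge0 _)) moment6_ge0).
by apply: mulr_ge0; [rewrite mulr_ge0|rewrite addr_ge0 ?sqr_ge0].
Qed.

Let SA_le : SA <= T + SD / 12 + K%:R * (nu ^+ 2 * moment6 / eta ^+ 2) / 12.
Proof.
have al0 : 0 < alpha by case/andP: hal.
apply: (error_budget (Lf := Lf) (Sp := Sp)) => //.
- by rewrite subr_ge0.
- by rewrite ltr0n.
- by rewrite ltr0n.
pose b k := (p - 1) / n%:R * (noiseB + 8 * Sp * Lf ^+ 2 * Ex Pr (move2 k)).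
have b0 k : 0 <= b k.
  apply: mulr_ge0; first by rewrite divr_ge0 ?subr_ge0.
  apply: addr_ge0.
    apply: addr_ge0; first exact: (mulr_ge0 (mulr_ge0 (ler0n R 2) (sqr_ge0 _)) sig20).
    exact: (mulr_ge0 (mulr_ge0 (mulr_ge0 (ler0n R 8) (sqr_ge0 _)) (sqr_ge0 _)) moment6_ge0).
  apply: mulr_ge0; first by rewrite mulr_ge0 ?sqr_ge0// mulr_ge0// (le_trans _ hSp).
  by apply: Ex_sqr_ge0 => w; exact: sqr_ge0.
have := @momentum_sum R (fun k => Ex Pr (fun w => pnorm p (err k w) ^+ 2)) b alpha
  ((p - 1) / n0%:R * sig2) K hal _ b0 Einit.2 hK.
move=> H; apply: le_trans (H _ _) _.
- by move=> k; apply: Ex_sqr_ge0 => w; exact: sqr_ge0.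
- by move=> k kK; exact: (Estep kK (intg_err (ltnW kK))).2.
rewrite lerD2l /b -mulr_sumr ler_wpM2l ?divr_ge0 ?subr_ge0//.
rewrite big_split /= sumr_const card_ord -mulr_sumr /SD -mulr_suml.
rewrite /noiseB -mulr_natr (mulrC (eta ^+ 2)) divfK ?expf_neq0 ?gt_eqF//.
by rewrite le_eqVlt; apply/orP; left; apply/eqP; ring.
Qed.

Theorem reduced_bound :
  (\int[Pr]_w (pnorm p (c (x (r w) w)) ^+ 2)%:E <= (
    pnorm p (c x0) ^+ 2 / K%:R
    + 8 * (Mf ^+ 2 + Mh ^+ 2 + m%:R ^+ 2 * rho ^+ 2 * Mbc ^+ 2 * Mc ^+ 2) / (beta ^+ 2 * mu ^+ 2)
    + 8 * (8 * Lv ^+ 2 + 3) * Delta0 / (beta ^+ 2 * mu ^+ 2 * eta * K%:R)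
    + 4 * (2 * Lv ^+ 2 + 1) * nu ^+ 2 * moment6 / (beta ^+ 2 * mu ^+ 2 * eta ^+ 2)
    + 32 * (2 * Lv ^+ 2 + 1) / (beta ^+ 2 * mu ^+ 2) * (T / K%:R))%:E)%E.
Proof.
pose Sc := \sum_(k < K) Ex Pr (fun w => pnorm p (c (x k w)) ^+ 2).
have -> : (\int[Pr]_w (pnorm p (c (x (r w) w)) ^+ 2)%:E = (K%:R^-1 * Sc)%:E)%E.
  have -> := @output_moment (fun y => pnorm p (c y) ^+ 2) _ _ (fun k => (hr k).2).
  - rewrite /Sc mulr_sumr -sumEFin; apply: eq_bigr => k _.
    by rewrite (EFin_Ex (intg_constraint (ltnW (ltn_ord k)))) EFinM.
  - move=> dT T' y my; apply/measurable_funX/measurable_pnorm.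
    exact: mvec_constraint.
  - by move=> y; exact: sqr_ge0.
rewrite lee_fin.
have IA : intg Pr (fun w => \sum_(k < K) pnorm p (err k w) ^+ 2).
  by apply: (intg_sum Pr1) => k; exact: intg_err.
have ID : intg Pr (fun w => \sum_(k < K) move2 k w / eta ^+ 2).
  have -> : (fun w => \sum_(k < K) move2 k w / eta ^+ 2) =
      (fun w => \sum_(k < K) (eta ^+ 2)^-1 * move2 k w).
    by apply/funext => w; apply: eq_bigr => k _; rewrite mulrC.
  by apply: (intg_sum Pr1) => k; apply: intgZ; exact: intg_move2.
have IC : intg Pr (fun w => \sum_(k < K) pnorm p (c (x k w)) ^+ 2).
  by apply: (intg_sum Pr1) => k; apply: intg_constraint; exact: ltnW.
have path w := @run_bounds R d m p q hp hpq f h c X v cX Lf Mf Mh Mbc Mc Lc Lv mu eta rho beta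
  hLf hMh hMbc hMc hLc hmu heta hrho hbeta (fun x _ => df x) (fun i x _ => (cC i).1 x) dv fL fM
  cb cg csm hfin hh ch vsm hetaL K (x^~ w) (s^~ w) (fun k => tp_mean (x k w)) (lam^~ w)
  b2 Phi_inf hK (run_X w (leq0n K)) (run_lam0 w) (fun k kK => run_argmin w kK)
  _ vmon (fun k kK => tp_mean_bias (run_X w (ltnW kK))) hPhi (hreg w).
have {}path w : 0 <= Delta0 /\
  \sum_(k < K) move2 k w / eta ^+ 2 <= 2 * Delta0 / eta
    + 5 / 2 * (\sum_(k < K) pnorm p (err k w) ^+ 2) + 10 * K%:R * b2 /\
  beta ^+ 2 * mu ^+ 2 * \sum_(k < K) pnorm p (c (x k w)) ^+ 2 <=
    beta ^+ 2 * mu ^+ 2 * pnorm p (c x0) ^+ 2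
    + 8 * K%:R * (Mf ^+ 2 + Mh ^+ 2 + m%:R ^+ 2 * rho ^+ 2 * Mbc ^+ 2 * Mc ^+ 2)
    + 16 / 5 * (5 / 4 * (\sum_(k < K) pnorm p (err k w) ^+ 2) + 5 * K%:R * b2)
    + 32 / 5 * (1 / 4 + Lv ^+ 2) * (\sum_(k < K) move2 k w / eta ^+ 2).
  have lamS w' k : (k < K)%N -> lam k.+1 w' = lam k w' + (rho / K%:R) *: c (x k w').
    by move=> kK; have [_ _ _ _ ->] := hrun w'; rewrite ?hrhos.
  by have := path lamS w; rewrite /= run_x0.
(* A probability space is not empty, so the sign of the constant [Delta0] can be read off a single
   path. *)
have [w0 _] : [set: Omega] !=set0.
  apply/set0P/negP => /eqP E0; have := Pr1; rewrite E0 measure0 => /eqP.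
  by rewrite eqe eq_sym oner_eq0.
have D00 : 0 <= Delta0 := (path w0).1.
have SAE : Ex Pr (fun w => \sum_(k < K) pnorm p (err k w) ^+ 2) = SA.
  by rewrite (Ex_sum Pr1)// => k; exact: intg_err.
have SDE : Ex Pr (fun w => \sum_(k < K) move2 k w / eta ^+ 2) = SD.
  have Ik (k : 'I_K) : intg Pr (move2 k) by exact: intg_move2.
  transitivity (Ex Pr (fun w => \sum_(k < K) (eta ^+ 2)^-1 * move2 k w)).
    by congr Ex; apply/funext => w; apply: eq_bigr => k _; rewrite mulrC.
  rewrite (Ex_sum Pr1); last by move=> k; exact: intgZ.
  by apply: eq_bigr => k _; rewrite (ExZ _ (Ik k)) mulrC.
have ScE : Ex Pr (fun w => \sum_(k < K) pnorm p (c (x k w)) ^+ 2) = Sc.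
  by rewrite (Ex_sum Pr1)// => k; apply: intg_constraint; exact: ltnW.
have /andP[al0 _] := hal.
have T0 : 0 <= T.
  apply: mulr_ge0; first by rewrite mulr_ge0// mulr_ge0// subr_ge0.
  apply: addr_ge0; last by rewrite divr_ge0// mulr_ge0// ltW.
  by rewrite divr_ge0// mulr_ge0// mulr_ge0// ltW.
have eL : eta * Lf <= 1 / 2.
  apply: le_trans hetaL; rewrite ler_pM2l// lerDl mulr_ge0//.
  have := ltW hMbc; have := ltW hMc; have := ltW hLc; have := ltW hmu; have := ltW hrho => *.
  by rewrite !addr_ge0// mulr_ge0 ?sqr_ge0// mulr_ge0.
pose C2 := 32 / 5 * (1 / 4 + Lv ^+ 2).
pose C3 := beta ^+ 2 * mu ^+ 2 * pnorm p (c x0) ^+ 2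
    + 8 * K%:R * (Mf ^+ 2 + Mh ^+ 2 + m%:R ^+ 2 * rho ^+ 2 * Mbc ^+ 2 * Mc ^+ 2)
    + 16 / 5 * (5 * K%:R * b2).
(* The bound on the moves involves only the error sum; the second function enters with coefficient
   0. *)
have [I1 E1] := intg_comb2 Pr1 IA ID (lexx (5 / 2 * _ + 0 * _ + (2 * Delta0 / eta + 10 * K%:R * b2))).
have [I2 E2] := intg_comb2 Pr1 IA ID (lexx (4 * _ + C2 * _ + C3)).
apply: (final_budget hbeta hmu heta (ltW hLf) moment6_ge0 K0 D00 T0 eL erefl SA_le).
- rewrite -{1}SDE; apply: le_trans (Ex_le ID I1 _) (le_trans E1 _) => [w|].
    have [_ [H _]] := path w; apply: (le_trans H).
    by rewrite mul0r addr0 addrA [5 / 2 * _ + _]addrC.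
  by rewrite SAE mul0r addr0 addrA [5 / 2 * _ + _]addrC.
- rewrite -ScE -(ExZ _ IC); apply: le_trans (Ex_le (intgZ _ IC) I2 _) (le_trans E2 _) => [w|].
    have [_ [_ H]] := path w; apply: (le_trans H); rewrite /C2 /C3.
    by move: (\sum_(k < K) _) (\sum_(k < K) _) => e1 e2; lra.
  rewrite SAE SDE /C2 /C3 le_eqVlt; apply/orP; left; apply/eqP; rewrite -/b2.
  by field.
Qed.

(** Needed to compare the stated expectation, whose integrand is only almost everywhere equal to
    this one, with the reduced bound. *)
Lemma reduced_measurable : measurable_fun [set: Omega] (fun w => pnorm p (c (x (r w) w)) ^+ 2).
Proof.
apply: (@measurable_output (fun y => pnorm p (c y) ^+ 2)) => dT T' y my.
by apply/measurable_funX/measurable_pnorm; exact: mvec_constraint.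
Qed.

End ReducedAlgorithm.

(** * Discarding null sets *)

Section NonmeasurableIntegrand.
Import HBNNSimple.

(* f need not be measurable: its integral is a supremum over the simple functions
   below it. *)
Lemma ge0_ae_le_integral_nonmeasurable {d} {T : measurableType d} {R : realType}
    (mu : {measure set T -> \bar R}) (f g : T -> \bar R) :
  (forall x, 0 <= f x)%E -> (forall x, 0 <= g x)%E -> measurable_fun [set: T] g ->
  {ae mu, forall x, (f x <= g x)%E} -> (\int[mu]_x f x <= \int[mu]_x g x)%E.
Proof.
move=> f0 g0 mg fg; rewrite [leLHS]ge0_integralTE//.
apply: ge_ereal_sup => _ [h hf <-].
have -> : sintegral mu h = (\int[mu]_x (h x)%:E)%E.
  by rewrite integral_nnsfun// patch_setT.
apply: ae_ge0_le_integral => //.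
- by move=> x _; rewrite lee_fin; exact: fun_ge0.
- exact/measurable_EFinP.
- by move: fg; apply: filterS => x fgx _; exact: le_trans (hf x) fgx.
Qed.

End NonmeasurableIntegrand.

Section NullModification.
Context {R : realType} {dX} {Xi : measurableType dX} (P : probability Xi R).
Context (N : set Xi) (mN : measurable N) (PN : P N = 0%E).

Lemma ae_notin_null (T : Type) (Q : Xi -> Prop) : (forall z, ~ N z -> Q z) -> {ae P, forall z, Q z}.
Proof.
by move=> H; exists N; split => // z /= nQ; apply: contrapT => nN; apply: nQ; exact: H.
Qed.

Lemma expectation_eq_off_null (f g : Xi -> R) : measurable_fun [set: Xi] f ->
  measurable_fun [set: Xi] g -> (forall z, ~ N z -> f z = g z) -> ('E_P[f] = 'E_P[g])%E.
Proof.
move=> mf mg fg; rewrite unlock; apply: ae_eq_integral => //.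
- exact/measurable_EFinP.
- exact/measurable_EFinP.
- by apply: (ae_notin_null unit) => z nN _; congr EFin; exact: fg.
Qed.

Context {n : nat} (F : 'rV[R]_n -> Xi -> R).

(** With the value 0 on [N] every sample function is continuously differentiable, and since [N] is
    measurable and null, measurability in z and all expectations are preserved. *)
Definition null_modif (x : 'rV[R]_n) z : R := if z \in N then 0 else F x z.

Lemma null_modifE z : ~ N z -> null_modif ^~ z = F ^~ z.
Proof. by move=> nN; apply/funext => x; rewrite /null_modif memNset. Qed.

Lemma null_modif0 z : N z -> null_modif ^~ z = cst 0.
Proof. by move=> Nz; apply/funext => x; rewrite /null_modif mem_set. Qed.

Lemma grad_cst (a : R) (x : 'rV[R]_n) : grad (cst a) x = 0.
Proof. by apply/rowP => i; rewrite !mxE derive_cst. Qed.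

Lemma cont_diff_null_modif : (forall z, ~ N z -> cont_diff (F ^~ z)) ->
  forall z, cont_diff (null_modif ^~ z).
Proof.
move=> FC z; have [Nz|nN] := pselect (N z); last by rewrite null_modifE//; exact: FC.
rewrite null_modif0//; split => [x|]; first exact: differentiable_cst.
have -> : grad (cst 0 : 'rV[R]_n -> R) = cst 0.
  by apply/funext => x; rewrite grad_cst.
by move=> x; exact: cst_continuous.
Qed.

Let mind : measurable_fun [set: Xi] (fun z => (z \notin N)%:R : R).
Proof.
rewrite (_ : (fun z => _) = \1_(~` N)); first by apply: measurable_indic; exact: measurableC.
by apply/funext => z; rewrite indicE in_setC.
Qed.

Lemma measurable_null_modif x : measurable_fun [set: Xi] (F x) ->
  measurable_fun [set: Xi] (null_modif x).
Proof.
move=> mF; rewrite (_ : null_modif x = (fun z => (z \notin N)%:R * F x z)).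
  exact: measurable_funM.
by apply/funext => z; rewrite /null_modif; case: ifP => _; rewrite ?mul0r ?mul1r.
Qed.

Lemma grad_null_modif z x :
  grad (null_modif ^~ z) x = (z \notin N)%:R *: grad (F ^~ z) x.
Proof.
have [Nz|nN] := pselect (N z).
  by rewrite null_modif0// mem_set// scale0r grad_cst.
by rewrite null_modifE// memNset// scale1r.
Qed.

Lemma has_mean_null_modif x a : has_mean P (fun z => grad (F ^~ z) x) a ->
  has_mean P (fun z => grad (null_modif ^~ z) x) a.
Proof.
move=> H i; have [I E] := H i; have mG := intg_measurable I.
have mG' : measurable_fun [set: Xi] (fun z => grad (null_modif ^~ z) x 0 i).
  rewrite (_ : (fun z => _) = (fun z => (z \notin N)%:R * grad (F ^~ z) x 0 i)).
    exact: measurable_funM.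
  by apply/funext => z; rewrite grad_null_modif mxE.
split; last first.
  rewrite -E; apply: expectation_eq_off_null => // z nN.
  by rewrite null_modifE.
apply: (le_integrable measurableT _ _ I); first exact/measurable_EFinP.
move=> z _; rewrite lee_fin grad_null_modif mxE.
by case: (z \notin N); rewrite ?mul1r// mul0r normr0.
Qed.

End NullModification.

Section Retraction.
Context {R : realType} {dO} {Omega : measurableType dO} (Pr : probability Omega R).
Context (N : set Omega) (mN : measurable N) (PN : Pr N = 0%E) (w0 : Omega) (nN0 : ~ N w0).

(* Reruns the algorithm from w0 on the null set N, so that properties holding almost
   surely hold everywhere while laws and independence are unchanged. *)
Definition retract w := if w \in N then w0 else w.

Lemma retract_notin w : ~ N (retract w).
Proof. by rewrite /retract; case: ifPn => // /negP nN Nw; apply: nN; exact/mem_set. Qed.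

Lemma retract_id w : ~ N w -> retract w = w.
Proof. by move=> nN; rewrite /retract memNset. Qed.

Lemma measurable_retract : measurable_fun [set: Omega] retract.
Proof.
move=> _ E mE; rewrite setTI.
have -> : retract @^-1` E = (E `\` N) `|` (if w0 \in E then N else set0).
  apply/seteqP; split => [w /=|w [[Ew nN]|]] /=.
  - rewrite /retract; case: ifPn => [/set_mem Nw E0|/negP nN Ew].
      by right; rewrite mem_set.
    by left; split => // Nw; apply: nN; exact/mem_set.
  - by rewrite retract_id.
  - by case: ifPn => // /set_mem E0 Nw; rewrite /retract mem_set.
by apply: measurableU; [exact: measurableD|case: ifP].
Qed.

Lemma probability_retract E : measurable E -> Pr (retract @^-1` E) = Pr E.
Proof.
move=> mE; have mrE : measurable (retract @^-1` E).
  by rewrite -[X in measurable X]setTI; exact: measurable_retract.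
have H A : measurable A -> Pr A = Pr (A `\` N).
  move=> mA; have PAN : Pr (A `&` N) = 0%E.
    apply/eqP; rewrite eq_le measure_ge0 andbT -PN; apply: le_measure => //; rewrite inE//.
    exact: measurableI.
  rewrite measureD//; last by rewrite ltey_eq fin_num_measure.
  by rewrite -[LHS]sube0; congr (_ - _)%E; rewrite -PAN.
rewrite (H _ mrE) (H _ mE).
suff -> : retract @^-1` E `\` N = E `\` N by [].
apply/seteqP; split => w [/= Ew nN]; split => //.
  by rewrite retract_id in Ew.
by rewrite /= retract_id.
Qed.

Lemma has_law_retract {d'} {T' : measurableType d'} (Y : Omega -> T') (Q : probability T' R) :
  has_law Pr Y Q -> has_law Pr (Y \o retract) Q.
Proof.
move=> [mY lY]; split; first exact: (measurableT_comp mY measurable_retract).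
move=> A mA; rewrite -(lY A mA) comp_preimage probability_retract//.
by rewrite -[X in measurable X]setTI; exact: mY.
Qed.

Lemma mutually_independent_retract {I : choiceType} (D : set I) (G G' : I -> set (set Omega)) :
  (forall i, D i -> G i `<=` measurable) ->
  (forall i, G' i `<=` [set retract @^-1` E | E in G i]) ->
  mutually_independent Pr D G -> mutually_independent Pr D G'.
Proof.
move=> Gm G'G ind J A JA.
have BP0 i : exists B, i \in J -> G i B /\ A i = retract @^-1` B.
  have [iJ|_] := boolP (i \in J); last by exists setT.
  by have [_ /G'G[B GB <-]] := JA _ iJ; exists B.
pose B i := projT1 (cid (BP0 i)).
have BP i : i \in J -> G i (B i) /\ A i = retract @^-1` (B i) := projT2 (cid (BP0 i)).
have mB i : i \in J -> measurable (B i).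
  by move=> iJ; apply: (Gm _ (JA _ iJ).1); exact: (BP _ iJ).1.
have -> : \bigcap_(i in [set` J]) A i = retract @^-1` (\bigcap_(i in [set` J]) B i).
  by apply/seteqP; split => w /= H i iJ; have := H i iJ; rewrite (BP _ iJ).2.
rewrite probability_retract; last by apply: fin_bigcap_measurable; [exact: finite_fset|].
rewrite (ind J B); last by move=> i iJ; split; [exact: (JA _ iJ).1|exact: (BP _ iJ).1].
congr EFin; apply: eq_big_seq => i iJ.
by rewrite (BP _ iJ).2 probability_retract//; exact: mB.
Qed.

End Retraction.

(** Reduction to [reduced_bound]: [F] is altered on the null set of nonsmooth samples and bad
    outcomes are redirected to a good one. Neither change affects laws, independence or the final
    expectation bound. *)
Theorem theorem5p2 (R : realType) (d m : nat) (hd : (3 <= d)%N) (hm : (1 <= m)%N)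
  (p q : R) (hp : 2 <= p) (hpq : p^-1 + q^-1 = 1)
  (* problem data *)
  (dX : measure_display) (Xi : measurableType dX) (P : probability Xi R)
  (F : 'rV[R]_d -> Xi -> R) (f : 'rV[R]_d -> R) (h : 'rV[R]_d -> \bar R)
  (c : 'rV[R]_d -> 'rV[R]_m) (X : set 'rV[R]_d) (v : 'rV[R]_d -> R)
  (hfF : forall x, P.-integrable [set: Xi] (EFin \o F x) /\
                   ('E_P[F x] = (f x)%:E)%E)
  (hfC1 : cont_diff f)
  (hcC1 : forall i, cont_diff (comp_fun c i))
  (hFC1 : {ae P, forall z, cont_diff (fun x => F x z)})
  (hhNy : forall x, h x != -oo%E) (hhconv : convex_ext h)
  (* sampling distribution of the directions, smoothing radius *)
  (Pu : probability (borelRV R d) R) (nu : R) (hnu : 0 < nu)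
  (O : set 'rV[R]_d) (hO : open O) (hXO : smoothing_domain X Pu nu `<=` O)
  (* (A1) *)
  (DX Lf Mf Mh Mbc Mc Lc Phi_inf : R)
  (hDX : 0 < DX) (hLf : 0 < Lf) (hMf : 0 < Mf) (hMh : 0 < Mh)
  (hMbc : 0 < Mbc) (hMc : 0 < Mc) (hLc : 0 < Lc)
  (hX0 : X !=set0) (hXcl : closed X)
  (hXconv : convex_set (X : set (convex_lmodType 'rV[R]_d)))
  (hXbnd : forall x, X x -> lpnorm q x <= DX)
  (hfsm : forall x y, O x -> O y ->
     lpnorm 2 (grad f x - grad f y) <= Lf * lpnorm 2 (x - y))
  (hflip : forall x y, O x -> O y -> `|f x - f y| <= Mf * lpnorm 2 (x - y))
  (hhprop : exists2 x, X x & (h x < +oo)%E) (hhlsc : lsc_on X h)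
  (hhsub0 : forall x, X x -> subdiff h x !=set0)
  (hhsub : forall x, X x -> forall g, subdiff h x g -> lpnorm 2 g <= Mh)
  (hcb : forall (i : 'I_m) x, X x -> `|c x 0 i| <= Mbc)
  (hcg : forall (i : 'I_m) x, X x -> lpnorm 2 (grad (comp_fun c i) x) <= Mc)
  (hcsm : forall (i : 'I_m) x y, X x -> X y ->
     lpnorm 2 (grad (comp_fun c i) x - grad (comp_fun c i) y)
       <= Lc * lpnorm 2 (x - y))
  (hPhi : forall x, X x -> (Phi_inf%:E <= (f x)%:E + h x)%E)
  (* (A2) *)
  (sigma : R) (hsigma : 0 < sigma)
  (hmean : forall x, O x ->
     has_mean P (fun z => grad (fun y => F y z) x) (grad f x))
  (hvar : forall x, O x ->
     ('E_P[fun z => (lpnorm 2 (grad (fun y => F y z) x - grad f x) ^+ 2)%R]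
        <= (sigma ^+ 2)%R%:E)%E)
  (* (A3) *)
  (hms : forall x y, O x -> O y ->
     ('E_P[fun z => (lpnorm 2 (grad (fun w => F w z) x
                               - grad (fun w => F w z) y) ^+ 2)%R] `^ (2^-1)%R
        <= (Lf * lpnorm 2 (x - y))%R%:E)%E)
  (* (A4) *)
  (Sp : R) (hSp : 1 <= Sp)
  (hSpE : forall g : 'rV[R]_d,
     ('E_Pu[fun u : borelRV R d =>
              (lpnorm p (dotv g (u : 'rV[R]_d) *: (u : 'rV[R]_d)) ^+ 2)%R]
        <= (Sp * lpnorm 2 g ^+ 2)%R%:E)%E)
  (hcov : forall i j : 'I_d,
     ('E_Pu[fun u : borelRV R d => ((u : 'rV[R]_d) 0 i * (u : 'rV[R]_d) 0 j)%R]
       = ((i == j)%:R)%R%:E)%E)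
  (hu6 : ('E_Pu[fun u : borelRV R d => (lpnorm 2 (u : 'rV[R]_d) ^+ 6)%R] < +oo)%E)
  (* (A5) *)
  (Lv : R) (hvdiff : forall x, differentiable v x)
  (hvmon : forall x y,
     lpnorm q (x - y) ^+ 2 <= dotv (x - y) (grad v x - grad v y))
  (hvsm : forall x y, X x -> X y ->
     lpnorm p (grad v x - grad v y) <= Lv * lpnorm q (x - y))
  (* algorithm inputs *)
  (x0 : 'rV[R]_d) (hx0 : X x0)
  (mu eta alpha rho : R) (rhos : nat -> R) (K n0 n : nat)
  (hmu : 0 < mu) (heta : 0 < eta) (halpha : 0 < alpha <= 1)
  (hrho : 0 < rho) (hK : (2 <= K)%N) (hn0 : (0 < n0)%N) (hn : (0 < n)%N)
  (hrhos : forall k, (k < K)%N -> rhos k = rho / K%:R)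
  (hrhosmu : forall k, (k < K)%N -> 0 < rhos k < mu)
  (* randomness *)
  (dO : measure_display) (Omega : measurableType dO) (Pr : probability Omega R)
  (u : nat -> nat -> Omega -> borelRV R d) (xi : nat -> nat -> Omega -> Xi)
  (r : Omega -> 'I_K)
  (hu : forall k j, (k < K)%N -> (j < batch n0 n k)%N -> has_law Pr (u k j) Pu)
  (hxi : forall k j, (k < K)%N -> (j < batch n0 n k)%N -> has_law Pr (xi k j) P)
  (hr : forall k : 'I_K, measurable (r @^-1` [set k]) /\
                         Pr (r @^-1` [set k]) = (K%:R^-1)%:E)
  (hind : mutually_independent Pr (used_sources K n0 n) (source_sigma u xi r))
  (* the iterates *)
  (x s : nat -> Omega -> 'rV[R]_d) (lam : nat -> Omega -> 'rV[R]_m)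
  (hrun : forall w, is_run F X h c v mu eta nu alpha rhos K n0 n x0
            (fun k j => u k j w) (fun k j => xi k j w)
            (fun k => x k w) (fun k => s k w) (fun k => lam k w))
  (* (A6) *)
  (beta : R) (hbeta : 0 < beta)
  (hreg : {ae Pr, forall w, forall k, (k <= K)%N ->
     beta * lpnorm p (c (x k w))
       <= lpdist p (gradT c (x k w) (c (x k w)))
            [set - g | g in normal_cone X (x k w)]})
  (* parameter choices *)
  (Lmu Delta0 sigt2 Eu6 : R)
  (hLmu : Lmu = Lf + m%:R * (mu * Mc ^+ 2 + mu * Mbc * Lc + rho * Mbc * Lc))
  (hDelta0 : Delta0 = fine (aug_lagrangian f h c x0 0 mu) - Phi_inf
                      + 2 * m%:R * rho * Mbc ^+ 2)
  (hEu6 : Eu6 = fine ('E_Pu[fun u : borelRV R d => (lpnorm 2 (u : 'rV[R]_d) ^+ 6)%R])%E)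
  (hsigt2 : sigt2 = nu ^+ 2 * Lf ^+ 2 * Eu6 + 4 * Sp * (sigma ^+ 2 + Mf ^+ 2)
                    + 2 * Mf ^+ 2)
  (hetaL : eta * Lmu <= 1 / 2)
  (hnbatch : 96 * (p - 1) * Sp * eta ^+ 2 * Lf ^+ 2 / alpha <= n%:R) :
  ('E_Pr[fun w => (lpnorm p (c (x (r w) w)) ^+ 2)%R] <=
   (lpnorm p (c x0) ^+ 2 / K%:R
    + 8 * (Mf ^+ 2 + Mh ^+ 2 + m%:R ^+ 2 * rho ^+ 2 * Mbc ^+ 2 * Mc ^+ 2)
        / (beta ^+ 2 * mu ^+ 2)
    + 8 * (8 * Lv ^+ 2 + 3) * Delta0 / (beta ^+ 2 * mu ^+ 2 * eta * K%:R)
    + 4 * (2 * Lv ^+ 2 + 1) * nu ^+ 2 * Eu6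
        / (beta ^+ 2 * mu ^+ 2 * eta ^+ 2)
    + 32 * (2 * Lv ^+ 2 + 1) * (p - 1) / (beta ^+ 2 * mu ^+ 2)
        * (1 / (n0%:R * alpha * K%:R) + 2 * alpha / n%:R) * sigt2)%R%:E)%E.
Proof.
have Ad := lpnormE R d; have Am := lpnormE R m.
rewrite Ad in hXbnd hfsm hflip hhsub hcg hcsm hvar hms hSpE hu6 hEu6 hvmon hvsm.
rewrite Am in hreg; rewrite Am.
have XO y : X y -> O y.
  move=> Xy; have [u0 su] := msupport_nonempty Pu; apply: hXO.
  by exists y, 0, u0; split => //; rewrite ?lexx ?ler01// mul0r scale0r addr0.
have fM y : X y -> pnorm 2 (grad f y) <= Mf.
  move=> Xy; exact: (grad_lipschitz_le hO (XO _ Xy) (hfC1.1 y) (ltW hMf) hflip).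
(* A subgradient at y together with one point where [h] is finite excludes the value +oo at y. *)
have hfin y : X y -> h y \is a fin_num.
  move=> Xy; have [g gy] := hhsub0 _ Xy; have [z Xz hz] := hhprop.
  move: (hhNy y) (gy z) hz; case: (h y) => [//| |//] _ /=.
  by rewrite addye// leye_eq => /eqP ->.
have hh y z : X y -> X z -> fine (h z) - fine (h y) <= Mh * pnorm 2 (z - y).
  move=> Xy Xz; have [g gz] := hhsub0 _ Xz; have := gz y.
  rewrite -(fineK (hfin _ Xy)) -(fineK (hfin _ Xz)) -EFinD lee_fin -(opprB z y) dotvNr => H.
  have H1 := le_trans (ler_norm _) (dotv_cauchy g (z - y)).
  have H2 := ler_wpM2r (pnorm_ge0 2 (z - y)) (hhsub _ Xz _ gz).
  by rewrite lerBlDl; move: H; rewrite lerBlDr => /le_trans; apply; rewrite lerD2l (le_trans H1).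
have hPhi' y : X y -> Phi_inf <= f y + fine (h y).
  by move=> Xy; rewrite -lee_fin EFinD fineK ?hfin//; exact: hPhi.
have mF y : measurable_fun [set: Xi] (F y) by exact: (intg_measurable (hfF y).1).
have [N [mN PN sN]] := hFC1.
have FC z : ~ N z -> cont_diff (F ^~ z).
  by move=> nN; apply: contrapT => nC; exact: (nN (sN z nC)).
pose F' := null_modif N F.
have FC' := cont_diff_null_modif FC.
have mF' y := measurable_null_modif mN (mF y).
have mgrad y : O y -> mvec (fun z => grad (F ^~ z) y).
  by move=> Oy i; have [+ _] := hmean _ Oy i; exact: intg_measurable.
have hmean' y (Oy : O y) := has_mean_null_modif mN PN (hmean _ Oy).
have mgrad' y : O y -> mvec (fun z => grad (F' ^~ z) y).
  by move=> Oy i; have [+ _] := hmean' _ Oy i; exact: intg_measurable.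
have hvar' y : O y ->
    ('E_P[fun z => (pnorm 2 (grad (F' ^~ z) y - grad f y) ^+ 2)%R] <= (sigma ^+ 2)%R%:E)%E.
  move=> Oy; apply: le_trans (hvar _ Oy); rewrite le_eqVlt; apply/orP; left; apply/eqP.
  apply: (expectation_eq_off_null mN PN).
  - by apply/measurable_funX/measurable_pnorm/mvecB; [exact: mgrad'|exact: mvec_cst].
  - by apply/measurable_funX/measurable_pnorm/mvecB; [exact: mgrad|exact: mvec_cst].
  - by move=> z nN; rewrite /F' null_modifE.
have hms' y z : O y -> O z ->
    ('E_P[fun t => (pnorm 2 (grad (F' ^~ t) y - grad (F' ^~ t) z) ^+ 2)%R] `^ (2^-1)%R
       <= (Lf * pnorm 2 (y - z))%R%:E)%E.
  move=> Oy Oz; apply: le_trans (hms _ _ Oy Oz).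
  rewrite le_eqVlt; apply/orP; left; apply/eqP; congr (_ `^ _)%E.
  apply: (expectation_eq_off_null mN PN).
  - by apply/measurable_funX/measurable_pnorm/mvecB; exact: mgrad'.
  - by apply/measurable_funX/measurable_pnorm/mvecB; exact: mgrad.
  - by move=> t nN; rewrite /F' null_modifE.
(* [N3] covers the failures of (A6) and the event that some sample actually drawn falls in [N],
   which is null because each such sample has law [P]. *)
have [N3 [mN3 PN3 sN3]] : exists B : set Omega, [/\ measurable B, Pr B = 0%E &
    forall w, ~ B w -> (forall k, (k <= K)%N -> beta * pnorm p (c (x k w))
       <= lpdist p (gradT c (x k w) (c (x k w))) [set - g | g in normal_cone X (x k w)]) /\
      forall k j, (k < K)%N -> (j < batch n0 n k)%N -> ~ N (xi k j w)].
  have H : Pr.-negligible (\bigcup_k \bigcup_j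
      (if (k < K)%N && (j < batch n0 n k)%N then xi k j @^-1` N else set0)).
    apply: negligible_bigcup => k; apply: negligible_bigcup => j.
    case: ifPn => [/andP[kK jb]|_]; last exact: negligible_set0.
    have [mxi lxi] := hxi k j kK jb; exists (xi k j @^-1` N); split => //; last first.
      exact: (etrans (lxi _ mN) PN).
    by rewrite -[X in measurable X]setTI; exact: mxi.
  have [B [mB PB sB]] := negligibleU hreg H.
  exists B; split => // w nB; split.
    by apply: contrapT => nreg; apply: nB; apply: sB; left.
  move=> k j kK jb Nw; apply: nB; apply: sB; right.
  by exists k => //; exists j => //; rewrite kK jb.
have [w0 nw0] : exists w0, ~ N3 w0.
  apply: contrapT => nex; have N3T : N3 = setT.
    by apply/seteqP; split => // w _; apply: contrapT => nw; apply: nex; exists w.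
  by move: PN3; rewrite N3T probability_setT => /eqP; rewrite eqe oner_eq0.
pose pi := retract N3 w0.
have npi w : ~ N3 (pi w) by exact: retract_notin.
have hu' k j (kK : (k < K)%N) (jb : (j < batch n0 n k)%N) : has_law Pr (u k j \o pi) Pu :=
  has_law_retract mN3 PN3 w0 (hu k j kK jb).
have hxi' k j (kK : (k < K)%N) (jb : (j < batch n0 n k)%N) : has_law Pr (xi k j \o pi) P :=
  has_law_retract mN3 PN3 w0 (hxi k j kK jb).
have hr' (k : 'I_K) : measurable ((r \o pi) @^-1` [set k]) /\
    Pr ((r \o pi) @^-1` [set k]) = (K%:R^-1)%:E.
  have [mrk rk] := hr k; rewrite comp_preimage; split.
    by rewrite -[X in measurable X]setTI; exact: (measurable_retract mN3 w0).
  by rewrite -rk; exact: (probability_retract mN3 PN3).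
have hind' : mutually_independent Pr (used_sources K n0 n)
    (source_sigma (fun k j => u k j \o pi) (fun k j => xi k j \o pi) (r \o pi)).
  apply: (mutually_independent_retract mN3 PN3 (w0 := w0) _ _ hind).
    exact: (source_sigma_measurable hu hxi hr).
  case=> [[[k j]|[k j]]|[]] _ [B BP <-].
  - by exists (u k j @^-1` B); [exists B; rewrite // setTI|rewrite setTI].
  - by exists (xi k j @^-1` B); [exists B; rewrite // setTI|rewrite setTI].
  - by exists (r @^-1` B); [exists B; rewrite // setTI|rewrite setTI].
have K0 : (0 < K)%N by exact: leq_trans hK.
(* Off [N3] no sample that is used lies in [N], so [F] and [F'] give the same two-point values and
   the path is a run for [F'] as well. *)
have hrun' w : is_run F' X h c v mu eta nu alpha rhos K n0 n x0
    (fun k j => (u k j \o pi) w) (fun k j => (xi k j \o pi) w)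
    (fun k => (x k \o pi) w) (fun k => (s k \o pi) w) (fun k => (lam k \o pi) w).
  have [_ nN] := sN3 _ (npi w).
  have tpE k j y : (k < K)%N -> (j < batch n0 n k)%N ->
      two_point F' nu y (u k j (pi w)) (xi k j (pi w)) =
      two_point F nu y (u k j (pi w)) (xi k j (pi w)).
    by move=> kK jb; rewrite /two_point /F' /null_modif memNset//; exact: nN.
  have [i1 i2 i3 i4 i5] := hrun (pi w); split => //.
    by rewrite /= i2; congr (_ *: _); apply: eq_bigr => j _; rewrite tpE.
  move=> k kK /=; rewrite i3//; congr (_ *: _); apply: eq_bigr => j _.
  by rewrite !tpE.
have hreg' w k (kK : (k <= K)%N) := (sN3 _ (npi w)).1 k kK.
rewrite hLmu in hetaL.
have RB := reduced_bound hp hpq FC' mF' hfC1.1 hcC1 hXconv hhconv hfin hLf hMf hMh hMbc hMc hLc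
  hXbnd fM (fun y z Xy Xz => hfsm y z (XO y Xy) (XO z Xz)) hcb hcg hcsm hh hPhi' hvdiff hvmon hvsm
  hSp hSpE hcov hu6 hnu hXO hmean' hvar' hms' hx0 hmu heta halpha hrho hbeta hn0 hn K0 hrhos
  hu' hxi' hr' hind' hrun' hreg' hetaL hnbatch.
have MB := reduced_measurable hp hpq FC' mF' hcC1 hXconv hhconv hfin hvdiff hvmon hvsm
  hx0 heta K0 hu' hxi' hr' hrun'.
(* Measurability of the original output is not at hand; it agrees off [N3] with the output of the
   rerun, which is measurable, and an upper bound is all that is needed. *)
rewrite unlock; apply: (le_trans (ge0_ae_le_integral_nonmeasurable (g := fun w =>
   (pnorm p (c ((x (r (pi w)) \o pi) w)) ^+ 2)%:E) _ _ _ _)).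
- by move=> w; rewrite lee_fin sqr_ge0.
- by move=> w; rewrite lee_fin sqr_ge0.
- exact/measurable_EFinP.
- exists N3; split => // w /= nle; apply: contrapT => nN3; apply: nle.
  by rewrite /pi retract_id.
have D0E : Delta0 = f x0 + fine (h x0) + mu / 2 * pnorm 2 (c x0) ^+ 2 - Phi_inf
    + 2 * m%:R * rho * Mbc ^+ 2.
  rewrite hDelta0 /aug_lagrangian dotv0l Am -(fineK (hfin _ hx0)) -!EFinD /=.
  by rewrite addr0.
apply: (le_trans RB); rewrite lee_fin -D0E le_eqVlt; apply/orP; left; apply/eqP.
have E6E : moment6 Pu = Eu6 by rewrite hEu6.
have SVE : sampling_variance Pu Lf Mf sigma Sp nu = sigt2.
  by rewrite hsigt2 /sampling_variance E6E.
rewrite E6E SVE; have Kn0 : K%:R != 0 :> R by rewrite pnatr_eq0 -lt0n.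
move: (K%:R) Kn0 => K' Kn0.
congr (_ + _ + _ + _ + _).
have /andP[al0 _] := halpha.
by field; rewrite Kn0 !pnatr_eq0 -!lt0n hn hn0 !gt_eqF.
Qed.
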